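(* Let $\mathbb{M}$ be a monster model of the theory of the field $\mathbb{C}((t))$. Every definable weak manifold (in $\mathbb{M}$) admits a $\Gamma$-exhaustion.
   Context: $\mathbb{C}((t))$ is viewed as a structure in the language of rings (its valuation ring is definable). $\mathbb{M}$ is a sufficiently saturated and strongly homogeneous elementary extension, with value group $\Gamma$, the valuation topology on $\mathbb{M}$ and the product topology on $\mathbb{M}^d$. ''Definable'' means definable in $\mathbb{M}$ with parameters. Weak manifold: a definable weak manifold is a definable set $X$ together with a definable topology on $X$ (one with a uniformly definable basis), an integer $d\ge 0$, a finite partition of $X$ into definable open subsets $O_1,\dots,O_k$, and for each $i$ a natural number $e_i\ge 1$ and a definable, continuous and open map $\pi_i:O_i\to U_i$ onto a definable open set $U_i\subseteq\mathbb{M}^d$, which is exactly $e_i$-to-one and whose inverse correspondence locally splits: every $u\in U_i$ has a definable open neighbourhood $V\subseteq U_i$ such that $\pi_i^{-1}(V)$ is a disjoint union of $e_i$ definable open sets, each mapped homeomorphically onto $V$ by $\pi_i$. Definable compactness: a definable set with a definable topology is definably compact if every uniformly definable, non-empty, downwards directed family of non-empty closed subsets of it has non-empty intersection. A definable subset of a space is definably compact if it is so in the subspace topology. $\Gamma$-exhaustion: a $\Gamma$-exhaustion of $X$ is a uniformly definable family $\{W_\gamma:\gamma\in\Gamma\}$ of subsets of $X$ such that each $W_\gamma$ is open and definably compact, $W_\gamma\subseteq W_{\gamma'}$ whenever $\gamma\le\gamma'$, and $X=\bigcup_{\gamma\in\Gamma}W_\gamma$. *)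

(* Defs.v *)
From HB Require Import structures.
From mathcomp Require Import all_boot all_order all_algebra.
From mathcomp Require Import fraction.
From mathcomp Require Import all_classical all_reals.
From mathcomp Require Import complex.

Set Implicit Arguments.
Unset Strict Implicit.
Unset Printing Implicit Defensive.

Import GRing.Theory.
Local Open Scope ring_scope.
Local Open Scope classical_set_scope.
Local Open Scope card_scope.

Record powerSeries (C : Type) := PowerSeries { coefps : nat -> C }.

Lemma powerSeriesP (C : Type) (f g : powerSeries C) :
  coefps f =1 coefps g -> f = g.
Proof. by case: f g => [f] [g] /= /funext ->. Qed.

HB.instance Definition _ (C : Type) := gen_eqMixin (powerSeries C).
HB.instance Definition _ (C : Type) := gen_choiceMixin (powerSeries C).

Section PowerSeriesRing.
Variable C : idomainType.
Implicit Types f g h : powerSeries C.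

Definition addps f g := PowerSeries (fun k => coefps f k + coefps g k).
Definition oppps f := PowerSeries (fun k => - coefps f k).
Definition zerops : powerSeries C := PowerSeries (fun=> 0).
Definition oneps : powerSeries C := PowerSeries (fun k => (k == 0%N)%:R).
Definition mulps f g :=
  PowerSeries (fun k => \sum_(i < k.+1) coefps f i * coefps g (k - i)).

Lemma addpsA : associative addps.
Proof. by move=> f g h; apply: powerSeriesP => k /=; rewrite addrA. Qed.
Lemma addpsC : commutative addps.
Proof. by move=> f g; apply: powerSeriesP => k /=; rewrite addrC. Qed.
Lemma add0ps : left_id zerops addps.
Proof. by move=> f; apply: powerSeriesP => k /=; rewrite add0r. Qed.
Lemma addNps : left_inverse zerops oppps addps.
Proof. by move=> f; apply: powerSeriesP => k /=; rewrite addNr. Qed.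

HB.instance Definition _ :=
  GRing.isZmodule.Build (powerSeries C) addpsA addpsC add0ps addNps.

Let trunc n f : {poly C} := \poly_(i < n) coefps f i.

Let coef_trunc n f k : (k < n)%N -> (trunc n f)`_k = coefps f k.
Proof. by move=> kn; rewrite coef_poly kn. Qed.

Let coef_trunc_mul n f g k : (k < n)%N ->
  (trunc n f * trunc n g)`_k = coefps (mulps f g) k.
Proof.
move=> kn; rewrite coefM /=; apply: eq_bigr => i _.
by rewrite !coef_trunc // ?(leq_ltn_trans (leq_subr _ _)) //
  (leq_trans (ltn_ord i)).
Qed.

Lemma mulpsC : commutative mulps.
Proof.
by move=> f g; apply: powerSeriesP => k; rewrite -!(@coef_trunc_mul k.+1) // mulrC.
Qed.

Lemma mulpsA : associative mulps.
Proof.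
move=> f g h; apply: powerSeriesP => k.
transitivity (trunc k.+1 f * (trunc k.+1 g * trunc k.+1 h))`_k.
  rewrite coefM; apply: eq_bigr => i _.
  by rewrite coef_trunc_mul ?ltnS ?leq_subr // coef_trunc.
rewrite mulrA coefM; apply: eq_bigr => i _.
by rewrite coef_trunc_mul // coef_trunc // ltnS leq_subr.
Qed.

Lemma mul1ps : left_id oneps mulps.
Proof.
move=> f; apply: powerSeriesP => k /=.
rewrite big_ord_recl mul1r subn0 big1 ?addr0 // => i _.
by rewrite mul0r.
Qed.

Lemma mulpsDl : left_distributive mulps addps.
Proof.
move=> f g h; apply: powerSeriesP => k /=; rewrite -big_split /=.
by apply: eq_bigr => i _; rewrite mulrDl.
Qed.

Lemma oneps_neq0 : oneps != 0.
Proof.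
apply/eqP => one0; have /eqP : coefps oneps 0 = 0 by rewrite one0.
by rewrite oner_eq0.
Qed.

HB.instance Definition _ := GRing.Zmodule_isComNzRing.Build (powerSeries C)
  mulpsA mulpsC mul1ps mulpsDl oneps_neq0.

Definition unitps : pred (powerSeries C) := fun f => `[< exists g, g * f = 1 >].
Definition invps f :=
  if pselect (exists g, g * f = 1) is left fU then projT1 (cid fU) else f.

Lemma mulVps : {in unitps, left_inverse 1 invps *%R}.
Proof.
move=> f /asboolP fU; rewrite /invps; case: pselect => // fU'.
exact: projT2 (cid fU').
Qed.

Lemma unitpsP f g : g * f = 1 -> unitps f.
Proof. by move=> gf; apply/asboolP; exists g. Qed.

Lemma invps_out : {in [predC unitps], invps =1 id}.
Proof.
move=> f /negP fU; rewrite /invps; case: pselect => // f_inv.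
by case: fU; apply/asboolP.
Qed.

HB.instance Definition _ := GRing.ComNzRing_hasMulInverse.Build (powerSeries C)
  mulVps unitpsP invps_out.

Let least_coef f : f != 0 ->
  exists2 n, coefps f n != 0 & forall i, (i < n)%N -> coefps f i = 0.
Proof.
move=> f0; have ex : exists n, coefps f n != 0.
  apply: contrapT => nex; move/eqP: f0; apply; apply: powerSeriesP => k /=.
  by apply: contrapT => /eqP fk; apply: nex; exists k.
case: (ex_minnP ex) => n fn n_min; exists n => // i.
by rewrite ltnNge; apply: contraNeq => /n_min.
Qed.

Lemma mulps_eq0 f g : f * g = 0 -> (f == 0) || (g == 0).
Proof.
move=> fg0; apply/negPn; rewrite negb_or; apply/negP => /andP[f0 g0].
have [n fn fmin] := least_coef f0; have [m gm gmin] := least_coef g0.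
have /eqP : coefps (f * g) (n + m) = 0 by rewrite fg0.
have ltn_nm : (n < (n + m).+1)%N by rewrite ltnS leq_addr.
rewrite /= (bigD1 (Ordinal ltn_nm)) //= addKn big1 ?addr0.
  by rewrite mulf_eq0 (negPf fn) (negPf gm).
move=> i; rewrite -val_eqE /= neq_ltn => /orP[/fmin ->|ni]; first by rewrite mul0r.
rewrite gmin ?mulr0 // ltn_subLR ?ltn_add2r //.
by rewrite -ltnS.
Qed.

HB.instance Definition _ :=
  GRing.ComUnitRing_isIntegral.Build (powerSeries C) mulps_eq0.

End PowerSeriesRing.

(* C((t)) is the field of fractions of C[[t]] *)
Definition laurent (C : fieldType) : fieldType := {fraction (powerSeries C)}.

Definition integral_series (C : fieldType) : set (laurent C) :=
  range (@FracField.tofrac (powerSeries C)).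

(* The parameters of a formula are its Const subterms.  GRing.holds reads the
   variable 'X_i in the environment e as e`_i, hence as 0 when size e <= i, so
   that every formula is a formula in the variables 'X_i with i < size e. *)

Section Formulas.
Variables K L : unitRingType.

Fixpoint term_over (A : set K) (t : GRing.term K) : Prop :=
  match t with
  | GRing.Const c => A c
  | GRing.Var _ | GRing.NatConst _ => True
  | GRing.Add t1 t2 | GRing.Mul t1 t2 => term_over A t1 /\ term_over A t2
  | GRing.Opp t1 | GRing.NatMul t1 _ | GRing.Inv t1 | GRing.Exp t1 _ =>
      term_over A t1
  end.

Fixpoint formula_over (A : set K) (phi : GRing.formula K) : Prop :=
  match phi with
  | GRing.Bool _ => True
  | GRing.Equal t1 t2 => term_over A t1 /\ term_over A t2
  | GRing.Unit t => term_over A t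
  | GRing.And p q | GRing.Or p q | GRing.Implies p q =>
      formula_over A p /\ formula_over A q
  | GRing.Not p | GRing.Exists _ p | GRing.Forall _ p => formula_over A p
  end.

Fixpoint map_term (f : K -> L) (t : GRing.term K) : GRing.term L :=
  match t with
  | GRing.Var i => GRing.Var L i
  | GRing.Const c => GRing.Const (f c)
  | GRing.NatConst n => GRing.NatConst L n
  | GRing.Add t1 t2 => GRing.Add (map_term f t1) (map_term f t2)
  | GRing.Opp t1 => GRing.Opp (map_term f t1)
  | GRing.NatMul t1 n => GRing.NatMul (map_term f t1) n
  | GRing.Mul t1 t2 => GRing.Mul (map_term f t1) (map_term f t2)
  | GRing.Inv t1 => GRing.Inv (map_term f t1)
  | GRing.Exp t1 n => GRing.Exp (map_term f t1) n
  end.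

Fixpoint map_formula (f : K -> L) (phi : GRing.formula K) : GRing.formula L :=
  match phi with
  | GRing.Bool b => GRing.Bool b
  | GRing.Equal t1 t2 => GRing.Equal (map_term f t1) (map_term f t2)
  | GRing.Unit t => GRing.Unit (map_term f t)
  | GRing.And p q => GRing.And (map_formula f p) (map_formula f q)
  | GRing.Or p q => GRing.Or (map_formula f p) (map_formula f q)
  | GRing.Implies p q => GRing.Implies (map_formula f p) (map_formula f q)
  | GRing.Not p => GRing.Not (map_formula f p)
  | GRing.Exists i p => GRing.Exists i (map_formula f p)
  | GRing.Forall i p => GRing.Forall i (map_formula f p)
  end.

(* f is a partial elementary map with domain A; rformula selects the formulas
   of the language of rings (no inverse, no unit predicate). *)
Definition elementary_on (A : set K) (f : K -> L) : Prop :=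
  forall phi : GRing.formula K, GRing.rformula phi -> formula_over A phi ->
    (GRing.holds [::] phi <-> GRing.holds [::] (map_formula f phi)).

End Formulas.

(* |A| < |kappa| *)
Definition smaller (T : Type) (A : set T) (kappa : Type) : Prop :=
  ~ ([set: kappa] #<= A).

Definition saturated (M : fieldType) (kappa : Type) : Prop :=
  forall A : set M, smaller A kappa ->
  forall p : set (GRing.formula M),
    (forall phi, p phi -> GRing.rformula phi /\ formula_over A phi) ->
    (forall q, q `<=` p -> finite_set q ->
      exists x : M, forall phi, q phi -> GRing.holds [:: x] phi) ->
  exists x : M, forall phi, p phi -> GRing.holds [:: x] phi.

Definition strongly_homogeneous (M : fieldType) (kappa : Type) : Prop :=
  forall (A : set M) (f : M -> M), smaller A kappa -> elementary_on A f ->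
  exists2 sigma : {rmorphism M -> M},
    bijective sigma & forall a, A a -> sigma a = f a.

Definition monster (C M : fieldType) (iota : laurent C -> M) (kappa : Type) :
    Prop :=
  [/\ elementary_on [set: laurent C] iota,
      smaller [set: laurent C] kappa,
      saturated M kappa
    & strongly_homogeneous M kappa].

(* The set defined in M by any formula that defines C[[t]] in C((t)); by
   elementarity it does not depend on the formula. *)
Definition valuation_ring (C M : fieldType) (iota : laurent C -> M) : set M :=
  [set x | exists phi : GRing.formula (laurent C),
    [/\ GRing.rformula phi,
        [set y | GRing.holds [:: y] phi] = integral_series (C := C)
      & GRing.holds [:: x] (map_formula iota phi)]].

Section Definability.
Variable M : fieldType.

Definition definable n (X : set (n.-tuple M)) : Prop :=
  exists2 phi : GRing.formula M,
    GRing.rformula phi & X = [set x : n.-tuple M | GRing.holds x phi].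

Definition definable_map n d (X : set (n.-tuple M))
    (f : n.-tuple M -> d.-tuple M) : Prop :=
  definable [set cat_tuple x (f x) | x in X].

Definition uniformly_definable n (F : set (set (n.-tuple M))) : Prop :=
  exists m (B : set (m.-tuple M)) (D : set ((m + n).-tuple M)),
    [/\ definable B, definable D
      & F = [set [set x | D (cat_tuple b x)] | b in B]].

End Definability.

(* A topology varies over a fixed definable set, so it is given by its set of
   open sets. *)

Section Topologies.
Variable T : Type.
Implicit Types (X Y : set T) (tau : set (set T)).

Definition is_topology X tau : Prop :=
  [/\ forall U, tau U -> U `<=` X,
      tau X,
      forall U V, tau U -> tau V -> tau (U `&` V)
    & forall F, F `<=` tau -> tau (\bigcup_(U in F) U)].

Definition is_basis tau (F : set (set T)) : Prop :=
  F `<=` tau /\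
  forall U x, tau U -> U x -> exists V, [/\ F V, V x & V `<=` U].

Definition subspace_topology tau Y : set (set T) := [set Y `&` U | U in tau].

Definition closed_in X tau A : Prop := A `<=` X /\ tau (X `\` A).

End Topologies.

Definition continuous_map (T T' : Type) (X : set T) (tau : set (set T))
    (tau' : set (set T')) (f : T -> T') : Prop :=
  forall V, tau' V -> tau (X `&` f @^-1` V).

Definition open_map (T T' : Type) (tau : set (set T)) (tau' : set (set T'))
    (f : T -> T') : Prop :=
  forall U, tau U -> tau' (f @` U).

Definition homeomorphism (T T' : Type) (X : set T) (tau : set (set T))
    (X' : set T') (tau' : set (set T')) (f : T -> T') : Prop :=
  [/\ set_bij X X' f, continuous_map X tau tau' f & open_map tau tau' f].

Definition definable_topology (M : fieldType) n (X : set (n.-tuple M))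
    (tau : set (set (n.-tuple M))) : Prop :=
  is_topology X tau /\ exists2 F, uniformly_definable F & is_basis tau F.

Definition definably_compact (M : fieldType) n (X : set (n.-tuple M))
    (tau : set (set (n.-tuple M))) : Prop :=
  forall F : set (set (n.-tuple M)),
    uniformly_definable F ->
    F !=set0 ->
    (forall A, F A -> closed_in X tau A /\ A !=set0) ->
    (forall A B, F A -> F B -> exists2 C, F C & C `<=` A `&` B) ->
    \bigcap_(A in F) A !=set0.

Section Valued.
Variables (M : fieldType) (O : set M).

(* The product on M^d of the topology with basis x + c O, c != 0 *)
Definition valuation_topology d : set (set (d.-tuple M)) :=
  [set U | forall x, U x -> exists c : 'I_d -> M, (forall i, c i != 0) /\
    forall y : d.-tuple M,
      (forall i, O ((tnth y i - tnth x i) / c i)) -> U y].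

Definition valuation_unit : set M := [set u | [/\ u != 0, O u & O u^-1]].

(* The value group M^* / O^* *)
Definition value_group : Type :=
  {gamma : set M |
    exists2 a, a != 0 & gamma = [set a * u | u in valuation_unit]}.

Definition value_le (gamma gamma' : value_group) : Prop :=
  exists a b, [/\ sval gamma a, sval gamma' b & O (b / a)].

(* A family indexed by the value group is uniformly definable when its pullback
   along the valuation M^* -> value_group is. *)
Definition uniformly_definable_value n (W : value_group -> set (n.-tuple M)) :
    Prop :=
  definable [set z : n.+1.-tuple M | exists gamma : value_group,
    sval gamma (thead z) /\ W gamma (behead_tuple z)].

Definition locally_splits n d (X : set (n.-tuple M))
    (tau : set (set (n.-tuple M))) (U : set (d.-tuple M))
    (pi : n.-tuple M -> d.-tuple M) (e : nat) : Prop :=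
  forall u, U u -> exists V : set (d.-tuple M),
    [/\ definable V, @valuation_topology d V, V u, V `<=` U
      & exists S : 'I_e -> set (n.-tuple M),
        [/\ \bigcup_j S j = X `&` pi @^-1` V,
            trivIset [set: 'I_e] S
          & forall j, [/\ definable (S j), tau (S j)
              & homeomorphism (S j) (subspace_topology tau (S j))
                  V (subspace_topology (@valuation_topology d) V) pi]]].

Definition weak_chart n d (X : set (n.-tuple M))
    (tau : set (set (n.-tuple M))) (e : nat)
    (pi : n.-tuple M -> d.-tuple M) (U : set (d.-tuple M)) : Prop :=
  (0 < e)%N /\
  [/\ [/\ definable U, @valuation_topology d U & pi @` X = U],
      [/\ definable_map X pi,
          continuous_map X tau (subspace_topology (@valuation_topology d) U) pi
        & open_map tau (subspace_topology (@valuation_topology d) U) pi],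
      forall u, U u -> (X `&` pi @^-1` [set u]) #= [set: 'I_e]
    & locally_splits X tau U pi e].

Definition weak_manifold n (X : set (n.-tuple M))
    (tau : set (set (n.-tuple M))) : Prop :=
  [/\ definable X, definable_topology X tau
    & exists (d k : nat) (P : 'I_k -> set (n.-tuple M)),
      [/\ partition [set: 'I_k] P X,
          forall i, definable (P i) /\ tau (P i)
        & forall i, exists (e : nat) (pi : n.-tuple M -> d.-tuple M)
            (U : set (d.-tuple M)),
          weak_chart (P i) (subspace_topology tau (P i)) e pi U]].

Definition value_exhaustion n (X : set (n.-tuple M))
    (tau : set (set (n.-tuple M))) (W : value_group -> set (n.-tuple M)) :
    Prop :=
  [/\ uniformly_definable_value W,
      forall gamma, tau (W gamma) /\
        definably_compact (W gamma) (subspace_topology tau (W gamma)),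
      forall gamma gamma', value_le gamma gamma' -> W gamma `<=` W gamma'
    & X = \bigcup_gamma W gamma].

End Valued.

(* Main.v *)
Require Import Defs.
From HB Require Import structures.
From mathcomp Require Import all_boot all_order all_algebra.
From mathcomp Require Import fraction generic_quotient.
From mathcomp Require Import all_classical all_reals.
From mathcomp Require Import complex closed_field.
From mathcomp Require Import zify ring.

Set Implicit Arguments.
Unset Strict Implicit.
Unset Printing Implicit Defensive.

Import Order.TTheory GRing.Theory Num.Theory.
Local Open Scope ring_scope.

(** The exhaustion is explicit.  For a chart pi_i : P_i -> U_i and a value gamma,
    represented by a, let V_i consist of the points u of U_i all of whose
    coordinates have value at least - gamma and whose polydisc u + a O^d lies in
    U_i; then W_gamma is the union of the preimages of the V_i.  Membership in
    V_i depends only on the coset of u modulo s O^d for some s != 0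
    [inner_near], so V_i is open, closed and bounded.  The V_i increase with
    gamma and exhaust U_i because U_i is open.  The point is that W_gamma is
    definably compact.

    A directed family of non-empty closed subsets of W_gamma meets a single P_i
    throughout.  Because the inverse of pi_i locally splits into finitely many
    sheets, pi_i maps closed subsets of W_gamma in P_i to closed sets
    [chart_image_closed].  A common point of the images has a finite fibre, and
    one point of that fibre is common to the family.  So it is enough to treat
    directed definable families of closed subsets of a bounded part of M^d.  For
    a fixed pair of formulas this is a first-order statement
    [definably_compact_in], hence it is enough to prove it over C((t)).

    Over C((t)) a common point is built digit by digit [next_digit].  The digits
    that are possible at some stage form a directed family of non-empty subsets
    of the residue field C, and such a family has a common element
    [directed_common] as soon as its members are all finite or cofinite with a
    uniform bound [almost_decided].  Completeness gives the limit of the digits,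
    and closedness puts it in every member of the family.

    The uniform bound is a consequence of quantifier elimination
    [sat_separated]: a definable relation is a Boolean combination of arbitrary
    conditions on the values of finitely many polynomials and of algebraic
    conditions on their leading coefficients.  Since conditions on values are
    arbitrary relations between integers, quantifiers over values are harmless;
    quantifiers over C are eliminated because C is algebraically closed.  For a
    quantifier over x in C((t)), let c be the point closest to x among 0 and the
    roots in C((t)) of the polynomials and of all their derivatives.  Then no
    cancellation occurs when the polynomials are expanded at c
    [regular_center]: otherwise Hensel's lemma, applied to a suitable derivative,
    would give a root closer to x.  Therefore the leading terms of the
    polynomials at x are functions of the leading term of x - c, and the
    quantifier over x becomes one over c and one over a leading term.  The
    quantifier over the root c is removed by induction on the degree
    [root_elim], by the same choice of a closest root. *)

(** * Hensel's lemma for power series *)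

Section PowerSeriesHensel.
Variable C : fieldType.
Local Notation PS := (powerSeries C).
Implicit Types f g h : PS.

Definition constant_term f := coefps f 0.
Lemma constant_term_zmod : zmod_morphism constant_term.
Proof. by []. Qed.
Lemma constant_term_monoid : monoid_morphism constant_term.
Proof. by split=> // f g; rewrite /constant_term /= big_ord_recl big_ord0 addr0. Qed.
HB.instance Definition _ :=
  GRing.isZmodMorphism.Build PS C constant_term constant_term_zmod.
HB.instance Definition _ :=
  GRing.isMonoidMorphism.Build PS C constant_term constant_term_monoid.

Definition psX : PS := PowerSeries (fun k => (k == 1%N)%:R).
Definition psC (c : C) : PS := PowerSeries (fun k => c *+ (k == 0%N)).

Lemma coefps_mulX f k :
  coefps (psX * f) k = if k is j.+1 then coefps f j else 0.
Proof.
case: k => [|k] /=; first by rewrite big_ord_recl big_ord0 mul0r addr0.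
rewrite big_ord_recl mul0r add0r big_ord_recl big1 ?addr0.
  by rewrite /= mul1r subSS subn0.
by move=> i _; rewrite /= mul0r.
Qed.

Lemma coefps_mulXn n f k :
  coefps (psX ^+ n * f) k = if (k < n)%N then 0 else coefps f (k - n).
Proof.
elim: n k => [|n IHn] k; first by rewrite expr0 mul1r ltn0 subn0.
by rewrite exprS -mulrA coefps_mulX; case: k => [|k] //; rewrite IHn ltnS subSS.
Qed.

Lemma coefps_mulC c f k : coefps (psC c * f) k = c * coefps f k.
Proof.
rewrite /= big_ord_recl /= subn0 big1 ?addr0 // => i _.
by rewrite mulr0n mul0r.
Qed.

(** Congruence modulo X^n is carried as divisibility, which is stable under
    products; [XdvdP] reads it off the coefficients. *)
Definition Xdvd n f := exists g, f = psX ^+ n * g.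

Lemma XdvdP n f : Xdvd n f <-> forall k, (k < n)%N -> coefps f k = 0.
Proof.
split=> [[g ->] k kn|fn]; first by rewrite coefps_mulXn kn.
exists (PowerSeries (fun k => coefps f (k + n))).
apply: powerSeriesP => k; rewrite coefps_mulXn; case: ltnP => [/fn //|nk].
by rewrite /= subnK.
Qed.

Lemma XdvdM n f g : Xdvd n f -> Xdvd n (f * g).
Proof. by case=> h ->; exists (h * g); rewrite mulrA. Qed.

Lemma XdvdD n f g : Xdvd n f -> Xdvd n g -> Xdvd n (f + g).
Proof. by case=> f' -> [g' ->]; exists (f' + g'); rewrite mulrDr. Qed.

Lemma Xdvd_le m n f : (m <= n)%N -> Xdvd n f -> Xdvd m f.
Proof.
by move=> mn [g ->]; exists (psX ^+ (n - m) * g); rewrite mulrA -exprD subnKC.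
Qed.

Lemma Xdvd_all f : (forall n, Xdvd n f) -> f = 0.
Proof. by move=> fn; apply: powerSeriesP => k; have /XdvdP -> := fn k.+1. Qed.

Lemma horner_taylor2 (R : comNzRingType) (p : {poly R}) (x h : R) :
  exists r, p.[x + h] = p.[x] + p^`().[x] * h + h ^+ 2 * r.
Proof.
elim/poly_ind: p => [|p c [r IHp]].
  by exists 0; rewrite linear0 !hornerE; ring.
exists (p^`().[x] + r * (x + h)).
rewrite derivD derivM derivC derivX !hornerE IHp; ring.
Qed.

Lemma horner_congr (R : comNzRingType) (p : {poly R}) (x h : R) :
  exists r, p.[x + h] = p.[x] + h * r.
Proof.
have [r ->] := horner_taylor2 p x h.
exists (p^`().[x] + h * r); ring.
Qed.

(** Newton's method one coefficient at a time: if P(x) vanishes modulo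
    X^(n+1), adding c X^(n+1) to x changes coefficient n+1 of P(x) by P'(x)(0)
    c and no lower one, so a unique c makes it vanish too. *)
Lemma hensel_powerSeries (p : {poly PS}) (xi : C) :
  (map_poly constant_term p).[xi] = 0 ->
  (map_poly constant_term p)^`().[xi] != 0 ->
  exists x : PS, coefps x 0 = xi /\ p.[x] = 0.
Proof.
set q := map_poly _ p => q0 q1.
pose step n x := x + psC (- coefps p.[x] n / q^`().[xi]) * psX ^+ n.
pose x_ := fix F n := if n is m.+1 then step n (F m) else psC xi.
have x_S n : x_ n.+1 = step n.+1 (x_ n) by [].
have x_dvd n : Xdvd n.+1 (x_ n.+1 - x_ n).
  by rewrite x_S /step addrC addKr mulrC; apply: XdvdM; exists 1; rewrite mulr1.
have x_le m n : (m <= n)%N -> Xdvd m.+1 (x_ n - x_ m).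
  elim: n => [|n IHn] in m *.
    by case: m => // _; rewrite subrr; exists 0; rewrite mulr0.
  rewrite leq_eqVlt ltnS => /orP[/eqP->|mn].
    by rewrite subrr; exists 0; rewrite mulr0.
  rewrite -(subrKA (x_ n)); apply: XdvdD; last exact: IHn.
  exact: Xdvd_le (x_dvd n).
have x_0 n : coefps (x_ n) 0 = xi.
  have /XdvdP/(_ 0%N isT) : Xdvd 1 (x_ n - x_ 0%N) by exact: x_le.
  rewrite -[coefps _ _]/(coefps (x_ n) 0 - xi *+ 1) mulr1n => /eqP.
  by rewrite subr_eq0 => /eqP.
have hornerq f r : coefps f 0 = xi -> coefps (r : {poly PS}).[f] 0 =
    (map_poly constant_term r).[xi].
  by move=> <-; rewrite -[coefps _ 0]/(constant_term _) -horner_map.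
have px_ n : Xdvd n.+1 p.[x_ n].
  elim: n => [|n [f fE]].
    by apply/XdvdP => -[|//] _; rewrite hornerq.
  rewrite x_S /step.
  set c := psC _; set h := c * _.
  have [r ->] := horner_taylor2 p (x_ n) h.
  apply: XdvdD; last first.
    apply: XdvdM; apply: (@Xdvd_le _ (n.+1 * 2)); first by lia.
    by exists (c ^+ 2); rewrite /h exprMn mulrC exprM.
  apply/XdvdP => k; rewrite ltnS leq_eqVlt => /orP[/eqP ->|kn].
    rewrite -[coefps _ _]/(coefps p.[x_ n] n.+1 + coefps (p^`().[x_ n] * h) n.+1).
    rewrite [_ * h]mulrC /h /c -mulrA coefps_mulC coefps_mulXn ltnn subnn.
    by rewrite hornerq // -deriv_map -/q mulrAC -mulrA divff // mulr1 subrr.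
  rewrite -[coefps _ _]/(coefps p.[x_ n] k + coefps (p^`().[x_ n] * h) k).
  rewrite fE coefps_mulXn kn add0r [_ * h]mulrC /h /c -mulrA coefps_mulC.
  by rewrite coefps_mulXn kn mulr0.
(* The k-th coefficient is stable from the k-th approximation on. *)
pose x := PowerSeries (fun k => coefps (x_ k) k).
have xx_ n : Xdvd n.+1 (x - x_ n).
  apply/XdvdP => k; rewrite ltnS => kn.
  have /XdvdP/(_ k (ltnSn k)) /= := x_le k n kn.
  by move=> /eqP; rewrite subr_eq0 => /eqP ->; rewrite subrr.
exists x; split; first by rewrite /= mulr1n.
apply: Xdvd_all => n; apply: (@Xdvd_le _ n.+1) => //.
have [r] := horner_congr p (x_ n) (x - x_ n).
rewrite addrC subrK => ->; apply: XdvdD => //; exact: XdvdM.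
Qed.

(** Hensel's lemma for the linear polynomial f Y - 1. *)
Lemma powerSeries_inv f : coefps f 0 != 0 -> exists g, f * g = 1.
Proof.
move=> f0.
have [||g [_ gE]] := @hensel_powerSeries (f *: 'X - 1) (coefps f 0)^-1.
- rewrite rmorphB rmorph1 /= map_polyZ map_polyX !hornerE /constant_term.
  by rewrite divff ?subrr.
- rewrite rmorphB rmorph1 /= map_polyZ map_polyX derivB derivZ derivX derivC.
  by rewrite subr0 hornerZ hornerC mulr1.
exists g; apply/eqP; rewrite -subr_eq0.
by move: gE; rewrite !hornerE => ->.
Qed.

Lemma powerSeries_factor f : f != 0 ->
  exists n g h, f = psX ^+ n * g /\ g * h = 1.
Proof.
move=> f0; have ex : exists n, coefps f n != 0.
  apply: contrapT => nex; move/eqP: f0; apply; apply: powerSeriesP => k.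
  by apply: contrapT => /eqP fk; apply: nex; exists k.
case: (ex_minnP ex) => n fn n_min.
have [|g fE] := (XdvdP n f).2.
  by move=> k kn; apply: contraTeq kn => /n_min; rewrite -leqNgt.
have [|h gh] := @powerSeries_inv g; last by exists n, g, h.
by move: fn; rewrite fE coefps_mulXn ltnn subnn.
Qed.

End PowerSeriesHensel.

(** * Discretely valued henselian fields *)

(** The properties of a field of Laurent series on which quantifier
    elimination rests: a uniformizer, its valuation ring with the residue map,
    a section of that map, and Hensel's lemma. In [unif_part] the integer i is
    the value of x. *)
Record henselian_field (C K : fieldType) := HenselianField {
  unif : K;
  intg : K -> Prop;
  res : K -> C;
  lift_res : C -> K;
  unif_neq0 : unif != 0;
  intg1 : intg 1;
  intgB : forall x y, intg x -> intg y -> intg (x - y);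
  intgM : forall x y, intg x -> intg y -> intg (x * y);
  res1 : res 1 = 1;
  resB : forall x y, intg x -> intg y -> res (x - y) = res x - res y;
  resM : forall x y, intg x -> intg y -> res (x * y) = res x * res y;
  intg_unif : intg unif;
  res_unif : res unif = 0;
  intg_div : forall x, intg x -> res x = 0 -> intg (x / unif);
  unif_part : forall x, x != 0 ->
    exists i : int, intg (x * unif ^ (- i)) /\ res (x * unif ^ (- i)) != 0;
  intg_lift : forall c, intg (lift_res c);
  res_lift : forall c, res (lift_res c) = c;
  hensel : forall (p : {poly K}) (xi : C), (forall i, intg p`_i) ->
    (\poly_(i < size p) res p`_i).[xi] = 0 ->
    (\poly_(i < size p) res p`_i)^`().[xi] != 0 ->
    exists x, [/\ intg x, res x = xi & root p x]
}.

Lemma divXn_shift (K : fieldType) (t u v : K) (n m : nat) : t != 0 ->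
  (t ^+ n * u) / (t ^+ m * v) * t ^ (- (n%:Z - m%:Z)) = u * v^-1.
Proof.
move=> t0; rewrite opprB expfzDr // -exprnN -exprnP invfM.
have : t ^+ n != 0 by rewrite expf_neq0.
have : t ^+ m != 0 by rewrite expf_neq0.
move: (t ^+ n) (t ^+ m) (v^-1) => a b w a0 b0.
by field; apply/andP; split.
Qed.

Section LaurentSeries.
Variable C : fieldType.
Local Notation PS := (powerSeries C).
Local Notation K := (laurent C).
Local Notation F := (@FracField.tofrac (powerSeries C)).

Definition laurent_t : K := F (psX C).

Definition series_res (x : K) : C :=
  if pselect (exists f, F f = x) is left e then constant_term (projT1 (cid e))
  else 0.

Lemma tofrac_inj : injective F.
Proof. by move=> f g /eqP; rewrite tofrac_eq => /eqP. Qed.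

Lemma series_resE f : series_res (F f) = constant_term f.
Proof.
rewrite /series_res; case: pselect => [e|[]]; last by exists f.
by have /tofrac_inj -> := projT2 (cid e).
Qed.

Lemma integral_seriesP x : integral_series x <-> exists f, F f = x.
Proof. by split=> [[f _ <-]|[f <-]]; exists f. Qed.

Lemma integral_tofrac f : integral_series (F f). Proof. by exists f. Qed.

Lemma psX_neq0 : psX C != 0.
Proof.
apply/eqP => X0; have /eqP : coefps (psX C) 1 = 0 by rewrite X0.
by rewrite /= oner_eq0.
Qed.

Lemma laurent_t_neq0 : laurent_t != 0.
Proof. by rewrite tofrac_eq0 psX_neq0. Qed.

Lemma fractionP (x : K) : exists f g, g != 0 /\ x = F f / F g.
Proof.
elim/quotW: x => r; exists \n_r, \d_r.
have d0 : \d_r != 0 by exact: denom_ratioP.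
split=> //.
apply: (canRL (mulfK _)); first by rewrite tofrac_eq0.
unlock FracField.tofrac; rewrite -[LHS]FracField.pi_mul.
apply/eqmodP; rewrite /= FracField.equivfE /FracField.mulf /=.
by rewrite !numden_Ratio ?oner_neq0 // ?mulf_neq0 ?oner_neq0 // !mulr1 mulrC.
Qed.

Lemma laurent_unif_part (x : K) : x != 0 ->
  exists i : int, integral_series (x * laurent_t ^ (- i)) /\
     series_res (x * laurent_t ^ (- i)) != 0.
Proof.
have [f [g [g0 ->]]] := fractionP x => x0.
have f0 : f != 0 by apply: contraNneq x0 => ->; rewrite tofrac0 mul0r.
have [n [u [u' [-> uu']]]] := powerSeries_factor f0.
have [m [v [v' [gE vv']]]] := powerSeries_factor g0.
have v0 : F v != 0.
  by rewrite tofrac_eq0; apply: contra_eq_neq vv' => ->; rewrite mul0r eq_sym oner_neq0.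
have Fv : (F v)^-1 = F v'.
  by apply: (mulfI v0); rewrite divff // -tofracM vv' tofrac1.
exists (n%:Z - m%:Z).
suff -> : F (psX C ^+ n * u) / F g * laurent_t ^ (- (n%:Z - m%:Z)) = F (u * v').
  split; first exact: integral_tofrac.
  rewrite series_resE rmorphM /= mulf_neq0 //.
    apply/eqP => e; have /eqP : constant_term (u * u') = 1 by rewrite uu' rmorph1.
    by rewrite rmorphM /= e mul0r eq_sym oner_eq0.
  apply/eqP => e; have /eqP : constant_term (v * v') = 1 by rewrite vv' rmorph1.
  by rewrite rmorphM /= e mulr0 eq_sym oner_eq0.
by rewrite gE !tofracM !tofracXn divXn_shift ?laurent_t_neq0 // Fv.
Qed.

Lemma laurent_hensel (p : {poly K}) (xi : C) :
    (forall i, integral_series p`_i) ->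
    (\poly_(i < size p) series_res p`_i).[xi] = 0 ->
    (\poly_(i < size p) series_res p`_i)^`().[xi] != 0 ->
    exists x, [/\ integral_series x, series_res x = xi & root p x].
Proof.
move=> pO.
have /choice[q qE] : forall i, exists f, F f = p`_i.
  by move=> i; apply/integral_seriesP.
pose Q := \poly_(i < size p) q i.
have pE : p = map_poly F Q.
  apply/polyP => i; rewrite coef_map /= coef_poly; case: ltnP => // pi.
  by rewrite nth_default ?tofrac0.
have -> : \poly_(i < size p) series_res p`_i = map_poly (@constant_term C) Q.
  apply/polyP => i; rewrite coef_map /= !coef_poly; case: ltnP => // _.
  by rewrite -qE series_resE.
move=> q0 q1; have [x [x0 qx]] := hensel_powerSeries q0 q1.
exists (F x); split; [exact: integral_tofrac|by rewrite series_resE|].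
by rewrite pE rootE horner_map qx /= tofrac0.
Qed.

Definition laurent_henselian : henselian_field C K.
Proof.
refine (@HenselianField C K laurent_t (@integral_series C) series_res
  (fun c => F (psC c)) _ _ _ _ _ _ _ _ _ _ laurent_unif_part _ _
  laurent_hensel).
- exact: laurent_t_neq0.
- by rewrite -tofrac1; exact: integral_tofrac.
- move=> x y /integral_seriesP[f <-] /integral_seriesP[g <-].
  by rewrite -tofracB; exact: integral_tofrac.
- move=> x y /integral_seriesP[f <-] /integral_seriesP[g <-].
  by rewrite -tofracM; exact: integral_tofrac.
- by rewrite -tofrac1 series_resE rmorph1.
- move=> x y /integral_seriesP[f <-] /integral_seriesP[g <-].
  by rewrite -tofracB !series_resE rmorphB.
- move=> x y /integral_seriesP[f <-] /integral_seriesP[g <-].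
  by rewrite -tofracM !series_resE rmorphM.
- exact: integral_tofrac.
- by rewrite series_resE.
- move=> x /integral_seriesP[f <-]; rewrite series_resE => f0.
  have /(XdvdP 1)[g ->] : forall k, (k < 1)%N -> coefps f k = 0 by case.
  rewrite expr1 tofracM mulrC mulKf ?laurent_t_neq0 //; exact: integral_tofrac.
- by move=> c; exact: integral_tofrac.
- by move=> c; rewrite series_resE /constant_term /= mulr1n.
Defined.

End LaurentSeries.

(** * Values, leading coefficients and initial polynomials *)

Section ValuationTheory.
Variables (C K : fieldType) (V : henselian_field C K).
Local Notation t := (unif V).
Local Notation O := (intg V).
Local Notation rs := (res V).
Implicit Types (x y : K) (i j z : int) (p q : {poly K}).

Let t0 := unif_neq0 V.

Lemma intg0 : O 0.
Proof. by rewrite -(subrr 1); apply: intgB; exact: intg1. Qed.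
Lemma intgN x : O x -> O (- x).
Proof. by move=> Ox; rewrite -sub0r; apply: intgB => //; exact: intg0. Qed.
Lemma intgD x y : O x -> O y -> O (x + y).
Proof. by move=> Ox Oy; rewrite -(opprK y); apply/intgB/intgN. Qed.
Lemma res0 : rs 0 = 0.
Proof. by rewrite -(subrr 1) resB ?subrr //; exact: intg1. Qed.
Lemma resN x : O x -> rs (- x) = - rs x.
Proof. by move=> Ox; rewrite -sub0r resB ?res0 ?sub0r //; exact: intg0. Qed.
Lemma resD x y : O x -> O y -> rs (x + y) = rs x + rs y.
Proof. by move=> Ox Oy; rewrite -{1}(opprK y) resB ?resN ?opprK //; exact: intgN. Qed.
Lemma intgX x n : O x -> O (x ^+ n).
Proof.
move=> Ox; elim: n => [|n IHn]; first by rewrite expr0; exact: intg1.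
by rewrite exprS; exact: intgM.
Qed.
Lemma resX x n : O x -> rs (x ^+ n) = rs x ^+ n.
Proof.
move=> Ox; elim: n => [|n IHn]; first by rewrite !expr0 res1.
by rewrite !exprS resM ?IHn //; exact: intgX.
Qed.
Lemma intg_sum (I : Type) (s : seq I) (f : I -> K) :
  (forall a, O (f a)) -> O (\sum_(a <- s) f a).
Proof. by move=> Of; apply: (big_ind O) => //; [exact: intg0|exact: intgD]. Qed.
Lemma res_sum (I : Type) (s : seq I) (f : I -> K) :
  (forall a, O (f a)) -> rs (\sum_(a <- s) f a) = \sum_(a <- s) rs (f a).
Proof.
move=> Of; elim: s => [|a s IHs]; first by rewrite !big_nil res0.
by rewrite !big_cons resD ?IHs //; exact: intg_sum.
Qed.

Lemma intg_unifX (n : nat) : O (t ^ n%:Z).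
Proof. by rewrite -exprnP; apply/intgX/intg_unif. Qed.

Definition vge j x := O (x * t ^ (- j)).

Lemma unifz_neq0 j : t ^ j != 0. Proof. exact: expfz_neq0. Qed.
Lemma unifzD i j : t ^ (i + j) = t ^ i * t ^ j. Proof. exact: expfzDr. Qed.
Lemma unifzN i : t ^ (- i) = (t ^ i)^-1. Proof. by rewrite invr_expz. Qed.
Hint Resolve unifz_neq0 : core.

Lemma vge_le i j x : i <= j -> vge j x -> vge i x.
Proof.
move=> ij; rewrite /vge => gx.
have -> : x * t ^ (- i) = x * t ^ (- j) * t ^ (j - i).
  by rewrite -mulrA -unifzD; congr (_ * t ^ _); lia.
apply: intgM => //; have -> : j - i = (absz (j - i)%R)%:Z by lia.
exact: intg_unifX.
Qed.

Lemma vge0 j : vge j 0. Proof. by rewrite /vge mul0r; exact: intg0. Qed.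
Lemma vgeD j x y : vge j x -> vge j y -> vge j (x + y).
Proof. by rewrite /vge mulrDl; exact: intgD. Qed.
Lemma vgeB j x y : vge j x -> vge j y -> vge j (x - y).
Proof. by rewrite /vge mulrBl; exact: intgB. Qed.
Lemma vgeM i j x y : vge i x -> vge j y -> vge (i + j) (x * y).
Proof. by rewrite /vge opprD unifzD mulrACA; exact: intgM. Qed.
Lemma vge_intg x : vge 0 x <-> O x.
Proof. by rewrite /vge oppr0 expr0z mulr1. Qed.
Lemma vge_shift i j x : vge (i + j) (x * t ^ i) <-> vge j x.
Proof.
by rewrite /vge -mulrA -unifzD; have -> : i - (i + j) = - j by lia.
Qed.

Lemma vge_factor j x : vge j x <-> exists o, O o /\ x = t ^ j * o.
Proof.
split=> [gx|[o [Oo ->]]].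
  exists (x * t ^ (- j)); split=> //.
  by rewrite mulrCA -unifzD subrr expr0z mulr1.
by rewrite /vge mulrAC -unifzD subrr expr0z mul1r.
Qed.

(** The coefficient of t^j in x, for x of value at least j. *)
Definition res_at j x := rs (x * t ^ (- j)).

Lemma res_at_gt i j x : i < j -> vge j x -> res_at i x = 0.
Proof.
move=> ij gx; rewrite /res_at.
have -> : x * t ^ (- i) = x * t ^ (- j) * t ^ (absz (j - i - 1)%R)%:Z * t ^ 1%:Z.
  by rewrite -!mulrA -!unifzD; congr (_ * t ^ _); lia.
rewrite expr1z.
rewrite resM; last exact: intg_unif.
  by rewrite res_unif mulr0.
by apply: intgM => //; exact: intg_unifX.
Qed.

Lemma res_at_eq0 i x : vge i x -> res_at i x = 0 -> vge (i + 1) x.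
Proof.
rewrite /vge /res_at => gx /(intg_div gx).
by rewrite -mulrA -{2}(expr1z t) -unifzN -unifzD; have -> : - i + -1 = - (i + 1) by lia.
Qed.

Lemma res_atB i x y : vge i x -> vge i y -> res_at i (x - y) = res_at i x - res_at i y.
Proof. by move=> gx gy; rewrite /res_at mulrBl resB. Qed.

Definition has_vord x i := vge i x /\ res_at i x != 0.

Lemma has_vord_uniq x i j : has_vord x i -> has_vord x j -> i = j.
Proof.
move=> [gi ri] [gj rj]; case: (ltgtP i j) => // ij.
  by rewrite (res_at_gt ij gj) eqxx in ri.
by rewrite (res_at_gt ij gi) eqxx in rj.
Qed.

Lemma has_vord_neq0 x i : has_vord x i -> x != 0.
Proof. by case=> _; apply: contraNneq => ->; rewrite /res_at mul0r res0. Qed.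

(** The value of x, with None for the value of 0. *)
Definition vord x : option int :=
  if x == 0 then None else Some (xget 0 [set i | has_vord x i]%classic).

Definition ac x : C := if vord x is Some i then res_at i x else 0.

Lemma vordP x i : vord x = Some i <-> has_vord x i.
Proof.
rewrite /vord; split.
  case: ifPn => // x0 [<-].
  by have [j hj] := unif_part V x0; case: xgetP => [k _ //|/(_ j)].
move=> hi; rewrite (negPf (has_vord_neq0 hi)); congr Some.
by case: xgetP => [k _ hk|/(_ i) []//]; exact: has_vord_uniq hk hi.
Qed.

Lemma vord_None x : vord x = None <-> x = 0.
Proof. by rewrite /vord; case: eqP. Qed.

Lemma vord0 : vord 0 = None. Proof. by rewrite vord_None. Qed.
Lemma ac0 : ac 0 = 0. Proof. by rewrite /ac vord0. Qed.

Lemma vord_ex x : x != 0 -> exists i, vord x = Some i.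
Proof. by move=> x0; rewrite /vord (negPf x0); eexists. Qed.

Lemma acE x i : vord x = Some i -> ac x = res_at i x.
Proof. by rewrite /ac => ->. Qed.

Lemma ac_eq0 x : (ac x == 0) = (x == 0).
Proof.
have [->|x0] := eqVneq x 0; first by rewrite ac0 eqxx.
have [i vi] := vord_ex x0; rewrite (acE vi).
by apply/negbTE; case: ((vordP _ _).1 vi).
Qed.

Lemma vgeP j x : vge j x <-> (if vord x is Some i then j <= i else True).
Proof.
case vx : (vord x) => [i|].
  have hi := (vordP _ _).1 vx; split=> [gj|ji]; last exact: vge_le ji hi.1.
  rewrite leNgt; apply/negP => ij.
  by case: hi => _; rewrite (res_at_gt ij gj) eqxx.
by split=> // _; rewrite ((vord_None _).1 vx); exact: vge0.
Qed.

(** The coefficient of t^j is additive on elements of value at least j and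
    recovers the leading coefficient of those of value j; this is what makes
    the leading term of a sum computable. *)
Lemma res_atE j x : vge j x -> res_at j x = if vord x == Some j then ac x else 0.
Proof.
move=> gx; case: eqP => [/acE //|ne]; case vx : (vord x) => [i|]; last first.
  by rewrite ((vord_None _).1 vx) /res_at mul0r res0.
move/vgeP: (gx); rewrite vx => ji; apply: (@res_at_gt _ i).
  by rewrite lt_neqAle ji andbT; apply/eqP => e; apply: ne; rewrite e.
by case: ((vordP _ _).1 vx).
Qed.

Lemma has_vordM x y i j : has_vord x i -> has_vord y j -> has_vord (x * y) (i + j).
Proof.
move=> [gx rx] [gy ry]; split; first exact: vgeM.
rewrite /res_at opprD unifzD mulrACA [rs _](resM (h := V)) //; exact: mulf_neq0.
Qed.

Lemma vordM x y i j : vord x = Some i -> vord y = Some j -> vord (x * y) = Some (i + j).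
Proof. by move=> /vordP vx /vordP vy; apply/vordP; exact: has_vordM. Qed.

Lemma acM x y : ac (x * y) = ac x * ac y.
Proof.
have [->|x0] := eqVneq x 0; first by rewrite !(mul0r, ac0).
have [->|y0] := eqVneq y 0; first by rewrite !(mulr0, ac0).
have [i vx] := vord_ex x0; have [j vy] := vord_ex y0.
rewrite (acE (vordM vx vy)) (acE vx) (acE vy) /res_at opprD unifzD mulrACA.
by apply: resM; [case: ((vordP _ _).1 vx)|case: ((vordP _ _).1 vy)].
Qed.

Definition monom z (xi : C) := t ^ z * lift_res V xi.

Lemma vge_monom z xi : vge z (monom z xi).
Proof.
rewrite /vge /monom mulrAC -unifzD subrr expr0z mul1r; exact: intg_lift.
Qed.
Lemma res_at_monom z xi : res_at z (monom z xi) = xi.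
Proof. by rewrite /res_at /monom mulrAC -unifzD subrr expr0z mul1r res_lift. Qed.
Lemma vord_monom z xi : xi != 0 -> vord (monom z xi) = Some z.
Proof.
by move=> xi0; apply/vordP; split; rewrite ?res_at_monom //; exact: vge_monom.
Qed.
Lemma ac_monom z xi : xi != 0 -> ac (monom z xi) = xi.
Proof. by move=> /(vord_monom z)/acE ->; exact: res_at_monom. Qed.

Lemma vord_scale x z xi : xi != 0 -> O x -> rs x = xi ->
  vord (t ^ z * x) = Some z /\ ac (t ^ z * x) = xi.
Proof.
move=> xi0 Ox rx; have e : t ^ z * x * t ^ (- z) = x.
  by rewrite mulrAC -unifzD subrr expr0z mul1r.
have v : vord (t ^ z * x) = Some z by apply/vordP; rewrite /has_vord /vge /res_at e rx.
by split=> //; rewrite (acE v) /res_at e.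
Qed.

Lemma same_rv_closer x y z : vord x = Some z -> vord y = Some z -> ac x = ac y ->
  vge (z + 1) (x - y).
Proof.
move=> vx vy; rewrite (acE vx) (acE vy) => exy.
have [gx _] := (vordP _ _).1 vx; have [gy _] := (vordP _ _).1 vy.
apply: res_at_eq0; first exact: vgeB.
by rewrite res_atB // exy subrr.
Qed.

Lemma closer_total x y :
  (forall j, vge j x -> vge j y) \/ (forall j, vge j y -> vge j x).
Proof.
have [->|x0] := eqVneq x 0; first by right=> j _; exact: vge0.
have [->|y0] := eqVneq y 0; first by left=> j _; exact: vge0.
have [i vx] := vord_ex x0; have [k vy] := vord_ex y0.
have [ik|ki] := leP i k.
  by left=> j /vgeP; rewrite vx => ji; apply/vgeP; rewrite vy; exact: le_trans ik.
by right=> j /vgeP; rewrite vy => jk; apply/vgeP; rewrite vx;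
  apply: le_trans jk (ltW ki).
Qed.

Definition reduction q : {poly C} := \poly_(k < size q) rs q`_k.

Lemma coef_reduction q k : (reduction q)`_k = rs q`_k.
Proof. by rewrite coef_poly; case: ltnP => // si; rewrite nth_default ?res0. Qed.

Lemma horner_reduction q x : (forall k : nat, O q`_k) -> O x ->
  O q.[x] /\ rs q.[x] = (reduction q).[rs x].
Proof.
move=> Oq Ox; rewrite horner_coef horner_poly.
have Oqx (i : nat) : O (q`_i * x ^+ i) by apply: intgM => //; exact: intgX.
split; first exact: intg_sum.
by rewrite res_sum //; apply: eq_bigr => i _; rewrite resM ?resX //; exact: intgX.
Qed.

Lemma intg_deriv q : (forall k : nat, O q`_k) -> forall k : nat, O q^`()`_k.
Proof.
move=> Oq i; rewrite coef_deriv -mulr_natr; apply: intgM => //.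
elim: i.+1 => [|n IHn]; first exact: intg0.
by rewrite -addn1 natrD; apply: intgD => //; exact: intg1.
Qed.

Lemma res_mulrn x n : O x -> rs (x *+ n) = rs x *+ n.
Proof.
move=> Ox; elim: n => [|n IHn]; first by rewrite !mulr0n res0.
rewrite !mulrS resD ?IHn //; elim: n {IHn} => [|n IHn]; first by rewrite mulr0n;
  exact: intg0.
by rewrite mulrS; exact: intgD.
Qed.

Lemma reduction_deriv q : (forall k : nat, O q`_k) ->
  reduction q^`() = (reduction q)^`().
Proof.
move=> Oq; apply/polyP => i; rewrite coef_deriv !coef_reduction coef_deriv.
exact: res_mulrn.
Qed.

Lemma intg_derivn q n : (forall k : nat, O q`_k) -> forall k : nat, O q^`(n)`_k.
Proof. by move=> Oq; elim: n => [//|n IHn]; rewrite derivnS; exact: intg_deriv. Qed.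

Lemma reduction_derivn q n : (forall k : nat, O q`_k) ->
  reduction q^`(n) = (reduction q)^`(n).
Proof.
move=> Oq; elim: n => [|n IHn]; first by rewrite !derivn0.
by rewrite !derivnS reduction_deriv ?IHn //; exact: intg_derivn.
Qed.

(** Hensel's lemma at a zero that is simple for the n-th derivative of the
    reduction. *)
Lemma hensel_derivn q n xi : (forall k : nat, O q`_k) ->
  (reduction q)^`(n).[xi] = 0 -> (reduction q)^`(n.+1).[xi] != 0 ->
  exists x, [/\ O x, rs x = xi & root q^`(n) x].
Proof.
move=> Oq r0 r1; apply: (hensel (h := V)); first exact: intg_derivn.
  by rewrite -[X in X.[_]]/(reduction _) reduction_derivn.
by rewrite -[X in X^`()]/(reduction _) reduction_derivn // -derivnS.
Qed.

(** m is the least value of a term of p at an argument of value z. *)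
Definition lowest p z m := (forall k : nat, vge (m - z * k%:Z) p`_k) /\
  exists k : nat, vord p`_k = Some (m - z * k%:Z).

Lemma lowest_ex p z : p != 0 -> exists m, lowest p z m.
Proof.
move=> p0.
have H n : (forall k : nat, (k < n)%N -> p`_k = 0) \/
   exists m, (forall k : nat, (k < n)%N -> vge (m - z * k%:Z) p`_k) /\
     exists k : nat, vord p`_k = Some (m - z * k%:Z).
  elim: n => [|n [IHn|[m [mn mk]]]]; first by left.
    have [pn|pn] := eqVneq p`_n 0.
      by left=> k; rewrite ltnS leq_eqVlt => /orP[/eqP ->|/IHn].
    right; have [i vi] := vord_ex pn; exists (i + z * n%:Z).
    split; last by exists n; rewrite vi; congr Some; lia.
    move=> k; rewrite ltnS leq_eqVlt => /orP[/eqP ->|/IHn ->]; last exact: vge0.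
    by apply/vgeP; rewrite vi; lia.
  right; have [pn|pn] := eqVneq p`_n 0.
    exists m; split=> // k; rewrite ltnS leq_eqVlt => /orP[/eqP ->|/mn//].
    by rewrite pn; exact: vge0.
  have [i vi] := vord_ex pn; have [mi|im] := leP m (i + z * n%:Z).
    exists m; split=> // k; rewrite ltnS leq_eqVlt => /orP[/eqP ->|/mn//].
    by apply/vgeP; rewrite vi; lia.
  exists (i + z * n%:Z).
  split; last by exists n; rewrite vi; congr Some; lia.
  move=> k; rewrite ltnS leq_eqVlt => /orP[/eqP ->|/mn].
    by apply/vgeP; rewrite vi; lia.
  by apply: vge_le; lia.
have [pz|[m [mn mk]]] := H (size p).
  by case/eqP: p0; apply/polyP => k; rewrite coef0; case: (ltnP k (size p)) =>
    [/pz|/leq_sizeP->].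
exists m; split=> // k; have [/mn//|pk] := ltnP k (size p).
by rewrite nth_default //; exact: vge0.
Qed.

Definition min_value p z : int := xget 0 [set m | lowest p z m]%classic.

Lemma min_valueP p z : p != 0 -> lowest p z (min_value p z).
Proof.
move=> /(lowest_ex z)[m hm].
by rewrite /min_value; case: xgetP => [k _ //|/(_ m)].
Qed.

(** With m as in [lowest], the polynomial t^(-m) p(t^z X) has coefficients in
    the valuation ring, and not all of them reduce to 0. *)
Definition scaled p z m : {poly K} := t ^ (- m) *: (p \Po (t ^ z *: 'X)).

Lemma unifzX z (k : nat) : (t ^ z) ^+ k = t ^ (z * k%:Z).
Proof. by rewrite exprnP exprz_exp. Qed.

Lemma coef_comp_polyZX (R : comNzRingType) (p : {poly R}) (c : R) (k : nat) :
  (p \Po (c *: 'X))`_k = p`_k * c ^+ k.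
Proof.
rewrite comp_polyE; under eq_bigr do rewrite exprZn scalerA.
rewrite -(poly_def _ (fun i : nat => p`_i * c ^+ i)) coef_poly; case: ltnP => // pk.
by rewrite nth_default ?mul0r.
Qed.

Lemma coef_scaled p z m k : (scaled p z m)`_k = p`_k * t ^ (- (m - z * k%:Z)).
Proof.
rewrite /scaled coefZ coef_comp_polyZX unifzX.
have -> : - (m - z * k%:Z) = - m + z * k%:Z by lia.
by rewrite unifzD mulrCA.
Qed.

Lemma intg_scaled p z m : lowest p z m -> forall k, O (scaled p z m)`_k.
Proof. by move=> [g _] k; rewrite coef_scaled; exact: g. Qed.

(** The polynomial over the residue field that gives the leading coefficient
    of p(x) from that of x, for x of value z, unless it vanishes there: see
    [horner_initial]. *)
Definition initial p z : {poly C} :=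
  if p == 0 then 0 else reduction (scaled p z (min_value p z)).

Lemma initialE p z : p != 0 -> initial p z = reduction (scaled p z (min_value p z)).
Proof. by rewrite /initial => /negPf ->. Qed.

Lemma coef_initial p z k : p != 0 ->
  (initial p z)`_k = if vord p`_k == Some (min_value p z - z * k%:Z) then ac p`_k
    else 0.
Proof.
move=> p0; rewrite initialE // coef_reduction coef_scaled -/(res_at _ _) res_atE //.
by case: (min_valueP z p0).
Qed.

Lemma initial_neq0 p z : p != 0 -> initial p z != 0.
Proof.
move=> p0; have [_ [k vk]] := min_valueP z p0.
apply/eqP => /(congr1 (fun q : {poly C} => q`_k)).
rewrite coef_initial // vk eqxx coef0 => /eqP; rewrite ac_eq0 => /eqP pk.
by rewrite pk vord0 in vk.
Qed.

Lemma size_initial p z : (size (initial p z) <= size p)%N.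
Proof.
have [->|p0] := eqVneq p 0; first by rewrite /initial eqxx size_poly0.
apply/leq_sizeP => k pk; rewrite coef_initial // nth_default //.
by rewrite vord0.
Qed.

Lemma horner_scaled p z m x : p.[t ^ z * x] = t ^ m * (scaled p z m).[x].
Proof.
rewrite /scaled hornerZ horner_comp hornerZ hornerX mulrA -unifzD subrr expr0z mul1r.
by rewrite mulrC.
Qed.

Lemma horner_initial p x z : p != 0 -> vord x = Some z -> (initial p z).[ac x] != 0 ->
  vord p.[x] = Some (min_value p z) /\ ac p.[x] = (initial p z).[ac x].
Proof.
move=> p0 vx; rewrite initialE // => r0.
have -> : p.[x] = t ^ min_value p z * (scaled p z (min_value p z)).[x * t ^ (- z)].
  rewrite -horner_scaled; congr (p.[_]).
  by rewrite mulrC -mulrA -unifzD addrC subrr expr0z mulr1.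
have [Ox _] := (vordP _ _).1 vx.
have [Op rp] := horner_reduction (intg_scaled (min_valueP z p0)) Ox.
by apply: vord_scale => //; rewrite rp (acE vx).
Qed.

Lemma derivn_scaled p z m n :
  (scaled p z m)^`(n) = t ^ (- m) *: ((t ^ z) ^+ n *: (p^`(n) \Po (t ^ z *: 'X))).
Proof.
rewrite /scaled derivnZ; congr (_ *: _).
elim: n => [|n IHn]; first by rewrite !derivn0 expr0 scale1r.
rewrite derivnS IHn derivZ deriv_comp -derivnS derivZ derivX.
by rewrite -scalerAr mulr1 scalerA -exprSr.
Qed.

Lemma root_derivn_scaled p z m n x : root (scaled p z m)^`(n) x ->
  root p^`(n) (t ^ z * x).
Proof.
rewrite derivn_scaled !rootE !hornerZ horner_comp !hornerE.
by rewrite !mulf_eq0 expf_eq0 (negPf (unifz_neq0 _)) (negPf (unifz_neq0 z)) andbF.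
Qed.

Lemma hensel_initial p z xi : xi != 0 ->
  (initial p z).[xi] = 0 -> (initial p z)^`().[xi] != 0 ->
  exists x, [/\ vord x = Some z, ac x = xi & root p x].
Proof.
move=> xi0; have [->|p0] := eqVneq p 0.
  by rewrite /initial eqxx deriv0 horner0 eqxx.
rewrite initialE // => r0 r1.
have [x [Ox rx /(root_derivn_scaled (n := 0))]] :=
  @hensel_derivn (scaled p z (min_value p z)) 0 xi (intg_scaled (min_valueP z p0))
    r0 r1.
have [vx ax] := vord_scale z xi0 Ox rx.
by exists (t ^ z * x).
Qed.

Hypothesis C_char0 : [pchar C] =i pred0.

(** The derivative of order deg q is a non-zero constant in characteristic 0. *)
Lemma derivn_nonroot (q : {poly C}) xi : q != 0 -> exists n, q^`(n).[xi] != 0.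
Proof.
move=> q0; exists (size q).-1.
have lq : q^`((size q).-1) = (lead_coef q *+ (size q).-1`!)%:P.
  apply/polyP => i; rewrite coef_derivn coefC; case: i => [|i].
    by rewrite addn0 ffactnn.
  by rewrite nth_default ?mul0rn // addnS -[X in (X <= _)%N]prednK ?size_poly_gt0
    // ltnS leq_addr.
rewrite lq hornerC -mulr_natr mulf_neq0 ?lead_coef_eq0 //.
by rewrite ((pcharf0P _).1 C_char0) -lt0n fact_gt0.
Qed.

(** If xi = ac x is a zero of the initial polynomial, of multiplicity n + 1,
    it is a simple zero of its n-th derivative, which is the reduction of the
    n-th derivative of p up to scaling; the root that Hensel's lemma provides
    has the leading term of x. The last clause records that n = 0 means a
    simple zero. *)
Lemma irregular_closer p x z : p != 0 -> vord x = Some z -> (initial p z).[ac x] = 0 ->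
  exists n c, [/\ p^`(n) != 0, root p^`(n) c, vge (z + 1) (x - c) &
    n = 0%N -> (initial p z)^`().[ac x] != 0].
Proof.
move=> p0 vx r0.
have ex := derivn_nonroot (ac x) (initial_neq0 z p0).
case: (ex_minnP ex) => -[|n] rn n_min; first by rewrite derivn0 r0 eqxx in rn.
have rn0 : (initial p z)^`(n).[ac x] = 0.
  by apply/eqP; apply: contraTT (ltnSn n) => /n_min; rewrite -leqNgt.
have xi0 : ac x != 0.
  by rewrite ac_eq0; apply/eqP => xx0; rewrite xx0 vord0 in vx.
have [c [Oc rc rootc]] : exists c, [/\ O c, rs c = ac x &
    root (scaled p z (min_value p z))^`(n) c].
  by apply: hensel_derivn; [exact: intg_scaled (min_valueP z p0)|rewrite
    -initialE|rewrite -initialE].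
have [vc acc] := vord_scale z xi0 Oc rc.
exists n, (t ^ z * c); split.
- apply: contraNneq rn => pn0; rewrite initialE // -reduction_derivn;
  last exact: intg_scaled (min_valueP z p0).
  rewrite derivnS derivn_scaled pn0 comp_poly0 !scaler0 deriv0.
  by rewrite /reduction size_poly0 poly_def big_ord0 horner0.
- exact: root_derivn_scaled rootc.
- exact: same_rv_closer.
- by move=> n0; rewrite n0 derivn1 in rn.
Qed.

End ValuationTheory.

(** * Regular centers *)

Lemma poly_roots_list (F : fieldType) (p : {poly F}) : p != 0 ->
  exists2 s : seq F, (size s <= size p)%N & forall x, root p x -> x \in s.
Proof.
have [n] := ubnP (size p); elim: n => // n IHn in p *; rewrite ltnS => pn p0.
have [[a]|nr] := pselect (exists a, root p a); last first.
  by exists [::] => // x rx; case: nr; exists x.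
case/factor_theorem=> q pE.
have q0 : q != 0 by apply: contraNneq p0 => q0; rewrite pE q0 mul0r.
have sp : size p = (size q).+1.
  by rewrite pE size_Mmonic ?monicXsubC // size_XsubC addnC.
have [|//|s sq qs] := IHn q; first by rewrite -sp.
exists (a :: s) => [|x]; first by rewrite sp.
by rewrite pE rootM root_XsubC inE => /orP[/qs ->|->//]; exact: orbT.
Qed.

Section Centers.
Variables (C K : fieldType) (V : henselian_field C K).
Hypothesis C_char0 : [pchar C] =i pred0.
Implicit Types (x c : K) (p g : {poly K}).

Definition rv x : int * C := (odflt 0 (vord V x), ac V x).

(** No cancellation between the terms of least value of p at an argument with
    leading term rho. *)
Definition regular p (rho : int * C) := p = 0 \/ (initial V p rho.1).[rho.2] <> 0.

Definition simple_zero p (rho : int * C) :=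
  (initial V p rho.1).[rho.2] = 0 /\ (initial V p rho.1)^`().[rho.2] <> 0.

Definition shift p c := p \Po ('X + c%:P).

Lemma horner_shift p c x : (shift p c).[x - c] = p.[x].
Proof. by rewrite /shift horner_comp !hornerE subrK. Qed.

Lemma shift_eq0 p c : (shift p c == 0) = (p == 0).
Proof. by rewrite /shift comp_poly2_eq0 ?size_XaddC. Qed.

Lemma derivn_shift p c n : (shift p c)^`(n) = shift p^`(n) c.
Proof.
elim: n => [|n IHn]; first by rewrite !derivn0.
by rewrite !derivnS IHn /shift deriv_comp derivD derivX derivC addr0 mulr1.
Qed.

(** The values of x - c are totally ordered and there are finitely many roots
    c. *)
Lemma closest_root (ps : seq {poly K}) x :
  exists c, (c = 0 \/ exists p, [/\ p \in ps, p != 0 & root p c]) /\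
    forall p c', p \in ps -> p != 0 -> root p c' ->
      forall j, vge V j (x - c') -> vge V j (x - c).
Proof.
elim: ps => [|p ps [c [cS cP]]]; first by exists 0; split; [left|].
have cS' : c = 0 \/ exists q, [/\ q \in p :: ps, q != 0 & root q c].
  case: cS => [->|[q [qs q0 rq]]]; [by left|right].
  by exists q; rewrite inE qs orbT.
have [->|p0] := eqVneq p 0.
  exists c; split=> [|q c']; last first.
    by rewrite inE => /orP[/eqP ->|qs]; [rewrite eqxx|exact: cP].
  by case: cS => [->|[q [qs q0 rq]]]; [left|right; exists q; rewrite inE qs orbT].
have [s _ sP] := poly_roots_list p0.
have [c1 [c1S c1c c1s]] : exists c1, [/\
    c1 = 0 \/ exists q, [/\ q \in p :: ps, q != 0 & root q c1],
    forall j, vge V j (x - c) -> vge V j (x - c1) &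
    forall c', c' \in s -> root p c' -> forall j, vge V j (x - c') -> vge V j (x - c1)].
  elim: s {sP} => [|a s [c1 [c1S c1c c1s]]]; first by exists c.
  have [ra|ra] := boolP (root p a); last first.
    exists c1; split=> // c'; rewrite inE => /orP[/eqP ->|/c1s //].
    by rewrite (negPf ra).
  have [H|H] := closer_total V (x - a) (x - c1).
    by exists c1; split=> // c'; rewrite inE => /orP[/eqP ->|/c1s //].
  exists a; split.
  - by right; exists p; rewrite inE eqxx.
  - by move=> j /c1c /H.
  - move=> c'; rewrite inE => /orP[/eqP -> //|c's rc' j /(c1s _ c's rc')].
    exact: H.
exists c1; split=> // q c'; rewrite inE => /orP[/eqP -> _ rc'|qs q0 rc' j gj].
  by apply: c1s; rewrite ?sP.
exact: c1c (cP _ _ qs q0 rc' _ gj).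
Qed.

Lemma vord_rv x : x != 0 -> vord V x = Some (rv x).1.
Proof. by move=> /(vord_ex V)[i vi]; rewrite /rv vi. Qed.

Lemma rv2_neq0 x : x != 0 -> (rv x).2 != 0.
Proof. by rewrite /rv /= ac_eq0. Qed.

Lemma derivn_neq0_size p n : p^`(n) != 0 -> (n < size p)%N.
Proof. by rewrite ltnNge; apply: contraNN => pn; rewrite derivn_poly0. Qed.

(** The center is the point closest to x among 0 and the roots of all the
    derivatives: a cancellation at that center would give a closer root, by
    [irregular_closer]. For the polynomial g itself only the derivatives of
    positive order serve as sources of centers; a root x of g is then not
    regular, but the zero of the initial polynomial is simple, as a multiple
    one would again give a closer root. *)
Lemma regular_center (ps : seq {poly K}) g x :
  exists c, [\/ c = 0,
     exists p n, [/\ p \in ps, p^`(n) != 0 & root p^`(n) c] |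
     exists n, g^`(n.+1) != 0 /\ root g^`(n.+1) c] /\
   (x != c ->
     (forall p, p \in ps -> regular (shift p c) (rv (x - c))) /\
     (root g x -> g != 0 -> simple_zero (shift g c) (rv (x - c)))).
Proof.
pose qs := flatten [seq [seq p^`(n) | n <- iota 0 (size p)] | p <- ps] ++
  [seq g^`(n.+1) | n <- iota 0 (size g)].
have qs1 p n : p \in ps -> p^`(n) != 0 -> p^`(n) \in qs.
  move=> pps /derivn_neq0_size pn; rewrite mem_cat; apply/orP; left.
  apply/flattenP; exists [seq p^`(n) | n <- iota 0 (size p)].
    by apply/mapP; exists p.
  by apply/mapP; exists n; rewrite // mem_iota.
have qs2 n : g^`(n.+1) != 0 -> g^`(n.+1) \in qs.
  move=> /derivn_neq0_size gn; rewrite mem_cat; apply/orP; right.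
  by apply/mapP; exists n; rewrite // mem_iota /= add0n ltnW.
have [c [cS cP]] := closest_root qs x; exists c; split.
  case: cS => [->|[q [+ q0 rq]]]; first by constructor 1.
  rewrite mem_cat => /orP[/flattenP[_ /mapP[p pps ->] /mapP[n _ qE]]|/mapP[n _ qE]].
    by constructor 2; exists p, n; rewrite -qE.
  by constructor 3; exists n; rewrite -qE.
move=> xc; have xc0 : x - c != 0 by rewrite subr_eq0.
have vx := vord_rv xc0.
have closer p n c' : p^`(n) \in qs -> (shift p c)^`(n) != 0 ->
    root (shift p c)^`(n) c' -> ~ vge V ((rv (x - c)).1 + 1) (x - c - c').
  rewrite derivn_shift shift_eq0 => pq p0 rc'.
  rewrite -addrA -opprD => /(cP _ _ pq p0) H.
  have : root p^`(n) (c + c') by rewrite rootE -(horner_shift _ c) addrC addKr.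
  move=> /H /vgeP; rewrite vx; lia.
split=> [p pps|rg g0].
  have [p0|p0] := eqVneq (shift p c) 0; [by left|right] => r0.
  have [n [c' [pn rc' gc' _]]] := irregular_closer C_char0 p0 vx r0.
  apply: (closer p n c') => //; apply: qs1 => //.
  by move: pn; rewrite derivn_shift shift_eq0.
have g0' : shift g c != 0 by rewrite shift_eq0.
have r0 : (initial V (shift g c) (rv (x - c)).1).[ac V (x - c)] = 0.
  apply/eqP; apply: contraT => r1.
  have [vg _] := horner_initial g0' vx r1.
  by move: vg; rewrite horner_shift (eqP rg) vord0.
split=> //.
have [n [c' [gn rc' gc' simp]]] := irregular_closer C_char0 g0' vx r0.
case: n => [|n] in gn rc' simp *; first exact/eqP/simp.
case: (closer g n.+1 c') => //; apply: qs2.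
by move: gn; rewrite derivn_shift shift_eq0.
Qed.

Lemma regular_horner p x : x != 0 -> regular p (rv x) -> p != 0 ->
  vord V p.[x] = Some (min_value V p (rv x).1) /\ ac V p.[x]
    = (initial V p (rv x).1).[(rv x).2].
Proof.
by move=> x0 [->|/eqP r0] p0; [rewrite eqxx in p0|apply: horner_initial => //;
  exact: vord_rv].
Qed.

Lemma simple_zero_root p z xi : xi != 0 -> simple_zero p (z, xi) ->
  exists x, [/\ x != 0, rv x = (z, xi) & root p x].
Proof.
move=> xi0 [r0 /eqP r1]; have [x [vx ax rx]] := hensel_initial xi0 r0 r1.
exists x; split=> //; last by rewrite /rv vx ax.
by apply/eqP => x0; rewrite x0 vord0 in vx.
Qed.

Lemma rv_surj z xi : xi != 0 -> exists x, x != 0 /\ rv x = (z, xi).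
Proof.
move=> xi0; exists (monom V z xi); rewrite /rv vord_monom // ac_monom //.
by split=> //; rewrite -(ac_eq0 V) ac_monom.
Qed.

End Centers.

(** * Conditions separated into values and residues *)

Section Separation.
Variable C : fieldType.

Section Classes.
Variables (E : Type) (ZS : (E -> option int) -> Prop) (CS : (E -> C) -> Prop).
Implicit Types (A B P Q : E -> Prop) (f g : E -> C) (h : E -> option int).

(** A may be any relation between the values h(e), for finitely many h in ZS. *)
Definition value_pred A := exists hs : seq (E -> option int),
  (forall h, List.In h hs -> ZS h) /\
  forall e e', (forall h, List.In h hs -> h e = h e') -> A e -> A e'.

(** Inverses are included so that leading coefficients of quotients are
    covered. *)
Inductive ratfun : (E -> C) -> Prop :=
| ratfun_base f : CS f -> ratfun f
| ratfun_const c : ratfun (fun=> c)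
| ratfun_add f g : ratfun f -> ratfun g -> ratfun (fun e => f e + g e)
| ratfun_mul f g : ratfun f -> ratfun g -> ratfun (fun e => f e * g e)
| ratfun_opp f : ratfun f -> ratfun (fun e => - f e)
| ratfun_inv f : ratfun f -> ratfun (fun e => (f e)^-1).

Inductive residue_pred : (E -> Prop) -> Prop :=
| residue_pred0 f : ratfun f -> residue_pred (fun e => f e = 0)
| residue_pred_and P Q : residue_pred P -> residue_pred Q -> residue_pred (fun e =>
  P e /\ Q e)
| residue_pred_not P : residue_pred P -> residue_pred (fun e => ~ P e).

Inductive separated : (E -> Prop) -> Prop :=
| separated_z A : value_pred A -> separated A
| separated_c f : ratfun f -> separated (fun e => f e = 0)
| separated_and P Q : separated P -> separated Q -> separated (fun e => P e /\ Q e)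
| separated_not P : separated P -> separated (fun e => ~ P e).

Lemma separated_ext P Q : (forall e, P e <-> Q e) -> separated P -> separated Q.
Proof. by move=> PQ; have -> : P = Q by apply/funext => e; apply/propext. Qed.

Lemma value_pred_const (b : Prop) : value_pred (fun=> b).
Proof. by exists [::]; split. Qed.

Lemma value_pred_and A B : value_pred A -> value_pred B -> value_pred (fun e =>
  A e /\ B e).
Proof.
move=> [s [sZ sA]] [r [rZ rB]]; exists (s ++ r); split.
  by move=> h /List.in_app_iff[/sZ|/rZ].
move=> e e' ee' [Ae Be]; split.
  by apply: sA Ae => h hs; apply: ee'; apply/List.in_app_iff; left.
by apply: rB Be => h hr; apply: ee'; apply/List.in_app_iff; right.
Qed.

Lemma value_pred_not A : value_pred A -> value_pred (fun e => ~ A e).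
Proof.
move=> [s [sZ sA]]; exists s; split=> // e e' ee' nA Ae'.
by apply: nA; apply: sA Ae' => h /ee'.
Qed.

Lemma separated_const (b : Prop) : separated (fun=> b).
Proof. exact/separated_z/value_pred_const. Qed.

Lemma separated_or P Q : separated P -> separated Q -> separated (fun e => P e \/ Q e).
Proof.
move=> gP gQ; apply: separated_ext (separated_not (separated_and (separated_not gP)
  (separated_not gQ))).
by move=> e; split=> [/not_andP[/contrapT|/contrapT]|[?|?] []]; tauto.
Qed.

Lemma separated_exists_in (I : Type) (s : seq I) (P : I -> E -> Prop) :
  (forall i, List.In i s -> separated (P i)) -> separated (fun e => exists i,
    List.In i s /\ P i e).
Proof.
elim: s => [|a s IHs] Ps.
  by apply: separated_ext (separated_const False) => e; split=> // -[i []].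
have gs : separated (fun e => exists i, List.In i s /\ P i e).
  by apply: IHs => i si; apply: Ps; right.
apply: separated_ext (separated_or (Ps a (or_introl erefl)) gs) => e; split.
  by case=> [Pa|[i [si Pi]]]; [exists a|exists i]; split=> //; [left|right].
by case=> i [[<-|si] Pi]; [left|right; exists i].
Qed.

Lemma separated_forall_in (I : Type) (s : seq I) (P : I -> E -> Prop) :
  (forall i, List.In i s -> separated (P i)) -> separated (fun e => forall i,
    List.In i s -> P i e).
Proof.
move=> Ps.
have g : separated (fun e => exists i, List.In i s /\ ~ P i e).
  by apply: separated_exists_in => i /Ps; exact: separated_not.
apply: separated_ext (separated_not g) => e; split=> [nex i si|H [i [si]]];
  last by apply; exact: H.
by apply: contrapT => nP; apply: nex; exists i.
Qed.

(** Leading coefficients of sums are rational in those of the terms only after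
    a case distinction on values. *)
Inductive piecewise : (E -> C) -> Prop :=
| piecewise_ratfun f : ratfun f -> piecewise f
| piecewise_if A f g : value_pred A -> piecewise f -> piecewise g ->
  piecewise (fun e => if `[< A e >] then f e else g e).

Lemma piecewise_zero f : piecewise f -> separated (fun e => f e = 0).
Proof.
elim=> [{}f fr|A {}f g Az _ gf _ gg]; first exact: separated_c.
have gA := separated_z Az.
apply: separated_ext (separated_or (separated_and gA gf) (separated_and
  (separated_not gA) gg)) => e.
by case: asboolP; tauto.
Qed.

Lemma piecewise_map (op : C -> C) f : (forall f, ratfun f -> ratfun (fun e =>
  op (f e))) ->
  piecewise f -> piecewise (fun e => op (f e)).
Proof.
move=> opr; elim=> [{}f fr|A {}f g Az _ gf _ gg]; first exact/piecewise_ratfun/opr.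
have -> : (fun e => op (if `[< A e >] then f e else g e)) =
  fun e => if `[< A e >] then op (f e) else op (g e).
  by apply/funext => e; case: ifP.
exact: piecewise_if.
Qed.

Lemma piecewise_map2 (op : C -> C -> C) f g :
  (forall f g, ratfun f -> ratfun g -> ratfun (fun e => op (f e) (g e))) ->
  piecewise f -> piecewise g -> piecewise (fun e => op (f e) (g e)).
Proof.
move=> opr pf; elim=> [{}g gr|A g1 g2 Az _ gf _ gg].
  elim: pf => [{}f fr|A f1 f2 Az _ gf _ gg]; first exact/piecewise_ratfun/opr.
  have -> : (fun e => op (if `[< A e >] then f1 e else f2 e) (g e)) =
    fun e => if `[< A e >] then op (f1 e) (g e) else op (f2 e) (g e).
    by apply/funext => e; case: ifP.
  exact: piecewise_if.
have -> : (fun e => op (f e) (if `[< A e >] then g1 e else g2 e)) =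
  fun e => if `[< A e >] then op (f e) (g1 e) else op (f e) (g2 e).
  by apply/funext => e; case: ifP.
exact: piecewise_if.
Qed.

Lemma piecewise_add f g : piecewise f -> piecewise g -> piecewise (fun e => f e + g e).
Proof. by apply: (piecewise_map2 (op := +%R)); exact: ratfun_add. Qed.
Lemma piecewise_mul f g : piecewise f -> piecewise g -> piecewise (fun e => f e * g e).
Proof. by apply: (piecewise_map2 (op := *%R)); exact: ratfun_mul. Qed.
Lemma piecewise_opp f : piecewise f -> piecewise (fun e => - f e).
Proof. by apply: (piecewise_map (op := -%R)); exact: ratfun_opp. Qed.
Lemma piecewise_inv f : piecewise f -> piecewise (fun e => (f e)^-1).
Proof. by apply: (piecewise_map (op := GRing.inv)); exact: ratfun_inv. Qed.
Lemma piecewise_const c : piecewise (fun=> c).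
Proof. exact/piecewise_ratfun/ratfun_const. Qed.

Lemma piecewise_sum (I : Type) (s : seq I) (f : I -> E -> C) :
  (forall i, piecewise (f i)) -> piecewise (fun e => \sum_(i <- s) f i e).
Proof.
move=> fr; elim: s => [|a s IHs].
  have -> : (fun e => \sum_(i <- [::]) f i e) = fun=> 0.
    by apply/funext => e; rewrite big_nil.
  exact: piecewise_const.
have -> : (fun e => \sum_(i <- a :: s) f i e) = fun e => f a e + \sum_(i <- s) f i e.
  by apply/funext => e; rewrite big_cons.
exact: piecewise_add.
Qed.

(** In this normal form a quantifier over a pair (value, residue) distributes
    over the two factors of each disjunct. *)
Inductive dnf : (E -> Prop) -> Prop :=
| dnf_one A B : value_pred A -> residue_pred B -> dnf (fun e => A e /\ B e)
| dnf_or P Q : dnf P -> dnf Q -> dnf (fun e => P e \/ Q e).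

Lemma dnf_ext P Q : (forall e, P e <-> Q e) -> dnf P -> dnf Q.
Proof. by move=> PQ; have -> : P = Q by apply/funext => e; apply/propext. Qed.

Lemma residue_pred_true : residue_pred (fun=> 0 = 0 :> C).
Proof. exact/residue_pred0/ratfun_const. Qed.

Lemma dnf_and P Q : dnf P -> dnf Q -> dnf (fun e => P e /\ Q e).
Proof.
move=> dP; elim=> [A B Az Bc|Q1 Q2 _ d1 _ d2]; last first.
  by apply: dnf_ext (dnf_or d1 d2) => e; tauto.
elim: dP => [A' B' Az' Bc'|P1 P2 _ d1 _ d2]; last first.
  by apply: dnf_ext (dnf_or d1 d2) => e; tauto.
apply: dnf_ext (dnf_one (value_pred_and Az' Az) (residue_pred_and Bc' Bc)) => e; tauto.
Qed.

Lemma dnf_not P : dnf P -> dnf (fun e => ~ P e).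
Proof.
elim=> [A B Az Bc|P1 P2 _ d1 _ d2]; last first.
  by apply: dnf_ext (dnf_and d1 d2) => e; tauto.
apply: dnf_ext (dnf_or (dnf_one (value_pred_not Az) residue_pred_true)
  (dnf_one (value_pred_const True) (residue_pred_not Bc))) => e.
split=> [|/not_andP]; first by tauto.
by case; tauto.
Qed.

Lemma separated_dnf P : separated P -> dnf P.
Proof.
elim=> [A Az|f fr|{}P Q _ dP _ dQ|{}P _ dP].
- by apply: dnf_ext (dnf_one Az residue_pred_true) => e; tauto.
- by apply: dnf_ext (dnf_one (value_pred_const True) (residue_pred0 fr)) => e; tauto.
- exact: dnf_and.
- exact: dnf_not.
Qed.

Lemma residue_pred_separated P : residue_pred P -> separated P.
Proof. by elim=> *; [exact: separated_c|exact: separated_and|exact: separated_not]. Qed.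

Lemma residue_pred_ext P Q : (forall e, P e <-> Q e) -> residue_pred P ->
  residue_pred Q.
Proof. by move=> PQ; have -> : P = Q by apply/funext => e; apply/propext. Qed.

Lemma residue_pred_or P Q : residue_pred P -> residue_pred Q ->
  residue_pred (fun e => P e \/ Q e).
Proof.
move=> gP gQ; apply: residue_pred_ext (residue_pred_not (residue_pred_and
  (residue_pred_not gP) (residue_pred_not gQ))).
by move=> e; split=> [/not_andP[/contrapT|/contrapT]|[?|?] []]; tauto.
Qed.

End Classes.

(** Separated predicates are pulled back along a correspondence u, u' between
    E and E', valid on a set of points D, as soon as the basic functions are.
    The class DD of admissible D accommodates sets D that shrink with each
    basic function, such as the regular points of the polynomials met so far. *)
Section Transfer.
Variables (T E E' : Type) (u : T -> E) (u' : T -> E').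
Variables (ZS : (E -> option int) -> Prop) (CS : (E -> C) -> Prop).
Variables (ZS' : (E' -> option int) -> Prop) (CS' : (E' -> C) -> Prop).
Variable DD : (T -> Prop) -> Prop.
Hypothesis DT : DD (fun=> True).
Hypothesis DI : forall D1 D2, DD D1 -> DD D2 -> DD (fun x => D1 x /\ D2 x).
Hypothesis Zu : forall h, ZS h -> exists D hs, [/\ DD D,
  forall h', List.In h' hs -> ZS' h' &
  forall x y, D x -> D y -> (forall h', List.In h' hs -> h' (u' x) = h' (u' y)) ->
    h (u x) = h (u y)].
Hypothesis Cu : forall g, CS g -> exists D g', [/\ DD D, piecewise ZS' CS' g' &
  forall x, D x -> g (u x) = g' (u' x)].

Lemma transfer_value_pred A : value_pred ZS A -> exists D A', [/\ DD D,
  value_pred ZS' A' &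
  forall x, D x -> A (u x) <-> A' (u' x)].
Proof.
move=> [hs [hsZ hsA]].
have [D [hs' [DDD hs'Z hs'u]]] : exists D hs', [/\ DD D,
   forall h', List.In h' hs' -> ZS' h' &
   forall x y, D x -> D y -> (forall h', List.In h' hs' -> h' (u' x) = h' (u' y)) ->
     forall h, List.In h hs -> h (u x) = h (u y)].
  elim: hs hsZ {hsA} => [|h hs IH] hsZ; first by exists (fun=> True), [::].
  have [|D1 [s1 [DD1 s1Z s1u]]] := IH; first by move=> k kh; apply: hsZ; right.
  have [D2 [s2 [DD2 s2Z s2u]]] := Zu (hsZ h (or_introl erefl)).
  exists (fun x => D1 x /\ D2 x), (s1 ++ s2); split; first exact: DI.
    by move=> k /List.in_app_iff[/s1Z|/s2Z].
  move=> x y [D1x D2x] [D1y D2y] xy k [<-|ks].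
    by apply: s2u => // l ls; apply: xy; apply/List.in_app_iff; right.
  by apply: s1u => // l ls; apply: xy; apply/List.in_app_iff; left.
exists D, (fun e' => exists x, [/\ D x, A (u x) &
  forall h', List.In h' hs' -> h' (u' x) = h' e']); split=> //.
  exists hs'; split=> // e e' ee' [x [Dx Ax xe]]; exists x; split=> // h hh.
  by rewrite xe ?ee'.
move=> x Dx; split=> [Ax|[y [Dy Ay yx]]]; first by exists x.
by apply: hsA Ay => h hh; apply: hs'u.
Qed.

Lemma transfer_ratfun f : ratfun CS f -> exists D f', [/\ DD D, piecewise ZS' CS' f' &
  forall x, D x -> f (u x) = f' (u' x)].
Proof.
elim=> [g /Cu//|c|{}f g _ [D1 [f' [d1 p1 e1]]] _ [D2 [g' [d2 p2 e2]]]
  |{}f g _ [D1 [f' [d1 p1 e1]]] _ [D2 [g' [d2 p2 e2]]]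
  |{}f _ [D [f' [d p e]]]|{}f _ [D [f' [d p e]]]].
- by exists (fun=> True), (fun=> c); split=> //; exact: piecewise_const.
- exists (fun x => D1 x /\ D2 x), (fun x => f' x + g' x); split; first exact: DI.
    exact: piecewise_add.
  by move=> x [Dx Dy]; rewrite e1 ?e2.
- exists (fun x => D1 x /\ D2 x), (fun x => f' x * g' x); split; first exact: DI.
    exact: piecewise_mul.
  by move=> x [Dx Dy]; rewrite e1 ?e2.
- by exists D, (fun x => - f' x); split=> // [|x Dx]; [exact: piecewise_opp|rewrite e].
- by exists D, (fun x => (f' x)^-1); split=> // [|x Dx];
  [exact: piecewise_inv|rewrite e].
Qed.

Lemma transfer_separated Q : separated ZS CS Q -> exists D Q', [/\ DD D,
  separated ZS' CS' Q' &
  forall x, D x -> Q (u x) <-> Q' (u' x)].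
Proof.
elim=> [A /transfer_value_pred[D [A' [d z e]]]|f /transfer_ratfun[D [f' [d p e]]]
   |P {}Q _ [D1 [P' [d1 g1 e1]]] _ [D2 [Q' [d2 g2 e2]]]|P _ [D [P' [d g e]]]].
- by exists D, A'; split=> //; exact: separated_z.
- exists D, (fun x => f' x = 0); split=> //; first exact: piecewise_zero.
  by move=> x Dx; rewrite e.
- exists (fun x => D1 x /\ D2 x), (fun x => P' x /\ Q' x); split; first exact: DI.
    exact: separated_and.
  by move=> x [Dx Dy]; rewrite e1 ?e2.
- by exists D, (fun x => ~ P' x); split=> // [|x Dx]; [exact: separated_not|rewrite e].
Qed.

End Transfer.
End Separation.

(** * Quantifiers over leading terms *)

Section RVElimination.
Variable (C : closedFieldType).
Variables (Y : Type) (ZS : (Y -> option int) -> Prop) (CS : (Y -> C) -> Prop).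

(** Basic functions on pairs of a point of Y and a leading term (z, xi), the
    second component of the pair. *)
Definition rvZ (h : Y * (int * C) -> option int) :=
  (exists2 k, ZS k & h = fun e => k e.1) \/ h = fun e => Some e.2.1.
Definition rvC (f : Y * (int * C) -> C) :=
  (exists2 k, CS k & f = fun e => k e.1) \/ f = fun e => e.2.2.

Local Notation env fs y xi := ((xi : C) :: [seq (f : Y -> C) y | f <- fs]).

(** The list fs0 of functions already in use is a parameter, so that terms and
    formulas for several functions can share one environment. *)
Lemma ratfun_term f : ratfun rvC f -> forall fs0, exists fs (t : GRing.term C),
  (forall g, List.In g fs -> ratfun CS g) /\
  forall fs1 y z xi, GRing.eval (env (fs0 ++ fs ++ fs1) y xi) t = f (y, (z, xi)).
Proof.
elim=> [g [[k kC ->]|->]|c|{}f g _ IH1 _ IH2|{}f g _ IH1 _ IH2|{}f _ IH|{}f _ IH] fs0.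
- exists [:: k], (GRing.Var C (size fs0).+1); split.
    by move=> g' [<-|//]; exact: ratfun_base.
  by move=> fs1 y z xi; rewrite /= map_cat nth_cat size_map ltnn subnn.
- by exists [::], (GRing.Var C 0).
- by exists [::], (GRing.Const c).
- have [s1 [t1 [r1 e1]]] := IH1 fs0; have [s2 [t2 [r2 e2]]] := IH2 (fs0 ++ s1).
  exists (s1 ++ s2), (GRing.Add t1 t2); split.
    by move=> k /List.in_app_iff[/r1|/r2].
  move=> fs1 y z xi /=; congr (_ + _); first by rewrite -catA (e1 _ _ z).
  by rewrite -(e2 fs1 y z) !catA.
- have [s1 [t1 [r1 e1]]] := IH1 fs0; have [s2 [t2 [r2 e2]]] := IH2 (fs0 ++ s1).
  exists (s1 ++ s2), (GRing.Mul t1 t2); split.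
    by move=> k /List.in_app_iff[/r1|/r2].
  move=> fs1 y z xi /=; congr (_ * _); first by rewrite -catA (e1 _ _ z).
  by rewrite -(e2 fs1 y z) !catA.
- have [s [t [r e]]] := IH fs0; exists s, (GRing.Opp t); split=> // fs1 y z xi.
  by rewrite /= (e _ _ z).
- have [s [t [r e]]] := IH fs0; exists s, (GRing.Inv t); split=> // fs1 y z xi.
  by rewrite /= (e _ _ z).
Qed.

Lemma residue_pred_formula P : residue_pred rvC P -> forall fs0,
  exists fs (phi : GRing.formula C),
  (forall g, List.In g fs -> ratfun CS g) /\
  forall fs1 y z xi, GRing.holds (env (fs0 ++ fs ++ fs1) y xi) phi <-> P (y, (z, xi)).
Proof.
elim=> [f /ratfun_term H|{}P Q _ IH1 _ IH2|{}P _ IH] fs0.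
- have [s [t [r e]]] := H fs0.
  by exists s, (GRing.Equal t (GRing.Const 0)); split=> // fs1 y z xi;
    rewrite /= (e _ _ z).
- have [s1 [t1 [r1 e1]]] := IH1 fs0; have [s2 [t2 [r2 e2]]] := IH2 (fs0 ++ s1).
  exists (s1 ++ s2), (GRing.And t1 t2); split.
    by move=> k /List.in_app_iff[/r1|/r2].
  move=> fs1 y z xi /=; have := e1 (s2 ++ fs1) y z xi; have := e2 fs1 y z xi.
  by rewrite -!catA; tauto.
- have [s [t [r e]]] := IH fs0; exists s, (GRing.Not t); split=> // fs1 y z xi.
  by have := e fs1 y z xi; rewrite /=; tauto.
Qed.

Lemma rterm_ratfun fs (t : GRing.term C) : (forall g, List.In g fs -> ratfun CS g) ->
  GRing.rterm t -> ratfun CS (fun y => GRing.eval (env fs y 0) t).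
Proof.
move=> fsr; elim: t => //=.
- move=> [|i] _ /=; first exact: ratfun_const.
  elim: fs fsr i => [|f fs IH] fsr i.
    have -> : (fun y : Y => nth 0 [seq (g : Y -> C) y | g <- [::]] i) = fun=> 0.
      by apply/funext => y; rewrite nth_nil.
    exact: ratfun_const.
  case: i => [|i] /=; first by apply: fsr; left.
  by apply: IH => g gs; apply: fsr; right.
- by move=> c _; exact: ratfun_const.
- by move=> n _; exact: ratfun_const.
- by move=> t1 IH1 t2 IH2 /andP[r1 r2]; apply: ratfun_add; [exact: IH1|exact: IH2].
- by move=> t1 IH1 r1; apply: ratfun_opp; exact: IH1.
- move=> t1 IH1 n r1.
  elim: n => [|n IHn].
    have -> : (fun y => GRing.eval (env fs y 0) t1 *+ 0) = fun=> 0.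
      by apply/funext => y; rewrite mulr0n.
    exact: ratfun_const.
  have -> : (fun y => GRing.eval (env fs y 0) t1 *+ n.+1) =
    fun y => GRing.eval (env fs y 0) t1 + GRing.eval (env fs y 0) t1 *+ n.
    by apply/funext => y; rewrite mulrS.
  by apply: ratfun_add => //; exact: IH1.
- by move=> t1 IH1 t2 IH2 /andP[r1 r2]; apply: ratfun_mul; [exact: IH1|exact: IH2].
- move=> t1 IH1 n r1.
  elim: n => [|n IHn].
    have -> : (fun y => GRing.eval (env fs y 0) t1 ^+ 0) = fun=> 1.
      by apply/funext => y; rewrite expr0.
    exact: ratfun_const.
  have -> : (fun y => GRing.eval (env fs y 0) t1 ^+ n.+1) =
    fun y => GRing.eval (env fs y 0) t1 * GRing.eval (env fs y 0) t1 ^+ n.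
    by apply/funext => y; rewrite exprS.
  by apply: ratfun_mul => //; exact: IH1.
Qed.

Lemma qf_residue_pred fs (phi : GRing.formula C) : (forall g, List.In g fs ->
  ratfun CS g) ->
  GRing.qf_form phi -> GRing.rformula phi ->
  residue_pred CS (fun y => GRing.holds (env fs y 0) phi).
Proof.
move=> fsr.
have ctrue : residue_pred CS (fun=> 0 = 0 :> C) by exact: residue_pred_true.
elim: phi => //=.
- move=> b _ _; case: b; first by apply: residue_pred_ext ctrue.
  by apply: residue_pred_ext (residue_pred_not ctrue) => e; split=> // /(_ erefl).
- move=> t1 t2 _ /andP[r1 r2].
  have H := residue_pred0 (ratfun_add (rterm_ratfun fsr r1) (ratfun_opp
    (rterm_ratfun fsr r2))).
  apply: residue_pred_ext H => y /=; split=> /eqP; first by rewrite subr_eq0 => /eqP.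
  by rewrite -subr_eq0 => /eqP.
- move=> f1 IH1 f2 IH2 /andP[q1 q2] /andP[r1 r2].
  by apply: residue_pred_and; [exact: IH1|exact: IH2].
- move=> f1 IH1 f2 IH2 /andP[q1 q2] /andP[r1 r2].
  by apply: residue_pred_or; [exact: IH1|exact: IH2].
- move=> f1 IH1 f2 IH2 /andP[q1 q2] /andP[r1 r2].
  have H := residue_pred_or (residue_pred_not (IH1 q1 r1)) (IH2 q2 r2).
  apply: residue_pred_ext H => y; split=> [[nP /nP//|//]|PQ].
  by have [/PQ|] := pselect (GRing.holds (env fs y 0) f1); [right|left].
- by move=> f1 IH1 q1 r1; apply: residue_pred_not; exact: IH1.
Qed.

(** Quantifier elimination in the algebraically closed residue field. *)
Lemma residue_pred_exists P : residue_pred rvC P -> residue_pred CS (fun y =>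
  exists rho, P (y, rho)).
Proof.
move=> /residue_pred_formula/(_ [::])[fs [phi [fsr e]]].
pose phi' := ('exists 'X_0, GRing.to_rform phi)%T.
have rphi' : GRing.rformula phi' by exact: GRing.to_rform_rformula.
pose wf := @ClosedFieldQE.wf_ex_elim C.
pose ok := @ClosedFieldQE.holds_ex_elim C (@solve_monicpoly C).
pose psi := GRing.quantifier_elim (@ClosedFieldQE.ex_elim C) phi'.
have /andP[qfpsi rpsi] : GRing.qf_form psi && GRing.rformula psi.
  exact: (GRing.quantifier_elim_wf wf).
apply: residue_pred_ext (qf_residue_pred fsr qfpsi rpsi) => y.
have -> : GRing.holds (env fs y 0) psi <-> GRing.holds (env fs y 0) phi'.
  have P1 := GRing.qf_evalP (env fs y 0) qfpsi.
  have P2 := GRing.quantifier_elim_rformP wf ok (env fs y 0) rphi'.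
  by split=> [/P1/P2|/P2/P1].
split=> [[xi /= /GRing.to_rformP H]|[[z xi] H]].
  by exists (0, xi); apply/(e [::]); rewrite !cats0.
by exists xi; apply/GRing.to_rformP; move/(e [::]): H; rewrite !cats0.
Qed.

Lemma value_pred_exists A : value_pred rvZ A ->
  value_pred ZS (fun y => exists rho, A (y, rho)).
Proof.
move=> [hs [hsZ hsA]].
have [ks [ksZ ksh]] : exists ks, (forall k, List.In k ks -> ZS k) /\
    forall y y', (forall k, List.In k ks -> k y = k y') ->
    forall h, List.In h hs -> forall rho, h (y, rho) = h (y', rho).
  elim: hs hsZ {hsA} => [|h hs IH] hsZ; first by exists [::].
  have [|ks [ksZ ksh]] := IH; first by move=> k kh; apply: hsZ; right.
  have [[k kZ hE]|hE] := hsZ h (or_introl erefl).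
    exists (k :: ks); split; first by move=> k' [<-|/ksZ].
    move=> y y' yy' h' [<-|h's] rho; first by rewrite hE /=; apply: yy'; left.
    by apply: ksh => // k' k's; apply: yy'; right.
  exists ks; split=> // y y' yy' h' [<-|h's] rho; first by rewrite hE.
  exact: ksh.
exists ks; split=> // y y' yy' [rho Ay]; exists rho.
by apply: hsA Ay => h hh; apply: ksh.
Qed.

Lemma residue_pred_rv_irrel P : residue_pred rvC P -> forall y z z' xi, P (y, (z,
  xi)) <-> P (y, (z', xi)).
Proof.
move=> /residue_pred_formula/(_ [::])[fs [phi [_ e]]] y z z' xi.
by rewrite -(e [::]) -(e [::] y z').
Qed.

Lemma value_pred_rv_irrel A : value_pred rvZ A ->
  forall y z xi xi', A (y, (z, xi)) -> A (y, (z, xi')).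
Proof.
move=> [hs [hsZ hsA]] y z xi xi'; apply: hsA => h /hsZ[[k _ ->]|->] //.
Qed.

(** After passage to disjunctive normal form the value and the residue are
    independent. The conditions on values are arbitrary, so projecting the
    value away costs nothing. *)
Lemma separated_rv_exists Q : separated rvZ rvC Q -> separated ZS CS (fun y =>
  exists rho, Q (y, rho)).
Proof.
move=> /separated_dnf; elim=> [A B Az Bc|P {}Q _ gP _ gQ]; last first.
  apply: separated_ext (separated_or gP gQ) => y; split.
    by case=> -[rho H]; exists rho; [left|right].
  by case=> rho [H|H]; [left|right]; exists rho.
have := separated_and (separated_z CS (value_pred_exists Az))
  (residue_pred_separated ZS (residue_pred_exists Bc)).
apply: separated_ext => y; split=> [[[[z xi] Ay] [[z' xi'] By]]|[rho [Ay By]]].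
  exists (z, xi'); split; first exact: (value_pred_rv_irrel Az) Ay.
  exact: (residue_pred_rv_irrel Bc y z' z xi').1 By.
by split; exists rho.
Qed.

End RVElimination.

(** * Families of polynomials *)

Section PolynomialFamilies.
Variables (K : fieldType).

Record subring (Y : Type) (A : (Y -> K) -> Prop) : Prop := Subring {
  subring1 : A (fun=> 1);
  subringB : forall f g, A f -> A g -> A (fun y => f y - g y);
  subringM : forall f g, A f -> A g -> A (fun y => f y * g y) }.

Section Family.
Variables (Y : Type) (A : (Y -> K) -> Prop) (A_ring : subring A).
Implicit Types (f g : Y -> K) (p q : Y -> {poly K}).

Lemma subring0 : A (fun=> 0).
Proof.
have := subringB A_ring (subring1 A_ring) (subring1 A_ring).
by have -> : (fun _ : Y => 1 - 1 : K) = fun=> 0 by apply/funext => y; rewrite subrr.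
Qed.
Lemma subringN f : A f -> A (fun y => - f y).
Proof.
move=> Af; have := subringB A_ring subring0 Af.
by have -> : (fun y => 0 - f y) = fun y => - f y by apply/funext => y; rewrite sub0r.
Qed.
Lemma subringD f g : A f -> A g -> A (fun y => f y + g y).
Proof.
move=> Af Ag; have := subringB A_ring Af (subringN Ag).
by have -> : (fun y => f y - - g y) = fun y => f y + g y
  by apply/funext => y; rewrite opprK.
Qed.
Lemma subring_sum n (f : nat -> Y -> K) : (forall i, A (f i)) ->
  A (fun y => \sum_(i < n) f i y).
Proof.
move=> Af; elim: n => [|n IHn].
  have -> : (fun y => \sum_(i < 0) f i y) = fun=> 0.
    by apply/funext => y; rewrite big_ord0.
  exact: subring0.
have -> : (fun y => \sum_(i < n.+1) f i y) = fun y => \sum_(i < n) f i y + f n y.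
  by apply/funext => y; rewrite big_ord_recr.
exact: subringD.
Qed.
Lemma subring_mulrn f n : A f -> A (fun y => f y *+ n).
Proof.
move=> Af; elim: n => [|n IHn].
  have -> : (fun y => f y *+ 0) = fun=> 0 by apply/funext.
  exact: subring0.
have -> : (fun y => f y *+ n.+1) = fun y => f y + f y *+ n.
  by apply/funext => y; rewrite mulrS.
exact: subringD.
Qed.

(** Families of polynomials in one variable, of bounded degree, with
    coefficients in a ring A of functions of the parameter. *)
Definition polyfam p :=
  (exists n : nat, forall y, (size (p y) <= n)%N) /\ forall k, A (fun y => (p y)`_k).

Definition polyfamN n p := polyfam p /\ forall y, (size (p y) <= n)%N.

Lemma polyfamC f : A f -> polyfam (fun y => (f y)%:P).
Proof.
move=> Af; split=> [|k]; first by exists 1%N => y; exact: size_polyC_leq1.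
case: k => [|k].
  by have -> : (fun y => ((f y)%:P)`_0) = f by apply/funext => y; rewrite coefC.
have -> : (fun y => ((f y)%:P)`_k.+1) = fun=> 0 by apply/funext => y; rewrite coefC.
exact: subring0.
Qed.

Lemma polyfamX : polyfam (fun=> 'X).
Proof.
split=> [|k]; first by exists 2%N => y; rewrite size_polyX.
have -> : (fun=> 'X`_k) = fun _ : Y => 1 *+ (k == 1%N) :> K.
  by apply/funext => y; rewrite coefX.
exact: (subring_mulrn _ (subring1 A_ring)).
Qed.

Lemma polyfamB p q : polyfam p -> polyfam q -> polyfam (fun y => p y - q y).
Proof.
move=> [[n pn] pA] [[m qm] qA]; split=> [|k].
  exists (maxn n m) => y; rewrite (leq_trans (size_polyD _ _)) // size_polyN.
  by rewrite geq_max !leq_max pn qm orbT.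
have -> : (fun y => (p y - q y)`_k) = fun y => (p y)`_k - (q y)`_k.
  by apply/funext => y; rewrite coefB.
exact: subringB.
Qed.

Lemma polyfamM p q : polyfam p -> polyfam q -> polyfam (fun y => p y * q y).
Proof.
move=> [[n pn] pA] [[m qm] qA]; split=> [|k].
  exists (n + m)%N => y; rewrite (leq_trans (size_polyMleq _ _)) //.
  by rewrite (leq_trans (leq_pred _)) // leq_add.
have -> : (fun y => (p y * q y)`_k) = fun y =>
  \sum_(i < k.+1) (p y)`_i * (q y)`_(k - i).
  by apply/funext => y; rewrite coefM.
by apply: (subring_sum k.+1 (f := fun i y => (p y)`_i * (q y)`_(k - i))) => i;
  exact: subringM.
Qed.

Lemma polyfam0 : polyfam (fun=> 0).
Proof. exact: polyfamC subring0. Qed.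

Lemma polyfamD p q : polyfam p -> polyfam q -> polyfam (fun y => p y + q y).
Proof.
move=> pp pq; have := polyfamB pp (polyfamB polyfam0 pq).
have -> : (fun y => p y - (0 - q y)) = fun y => p y + q y.
  by apply/funext => y; rewrite sub0r opprK.
by [].
Qed.

Lemma polyfam_exp p n : polyfam p -> polyfam (fun y => p y ^+ n).
Proof.
move=> pp; elim: n => [|n IHn]; first exact: polyfamC (subring1 A_ring).
have -> : (fun y => p y ^+ n.+1) = fun y => p y * p y ^+ n.
  by apply/funext => y; rewrite exprS.
exact: polyfamM.
Qed.

Lemma polyfam_sum n (p : nat -> Y -> {poly K}) : (forall i, polyfam (p i)) ->
  polyfam (fun y => \sum_(i < n) p i y).
Proof.
move=> Af; elim: n => [|n IHn].
  have -> : (fun y => \sum_(i < 0) p i y) = fun=> 0.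
    by apply/funext => y; rewrite big_ord0.
  exact: polyfam0.
have -> : (fun y => \sum_(i < n.+1) p i y) = fun y => \sum_(i < n) p i y + p n y.
  by apply/funext => y; rewrite big_ord_recr.
exact: polyfamD.
Qed.

Lemma size_derivn_leq (p : {poly K}) n : (size p^`(n) <= size p - n)%N.
Proof.
apply/leq_sizeP => k pk; rewrite coef_derivn nth_default ?mul0rn //.
by rewrite -leq_subLR.
Qed.

Lemma polyfamN_derivn n m r p : (n - r <= m)%N -> polyfamN n p ->
  polyfamN m (fun y => (p y)^`(r)).
Proof.
move=> nm [[_ pA] pn].
have sz y : (size (p y)^`(r) <= m)%N.
  by rewrite (leq_trans (size_derivn_leq _ _)) // (leq_trans _ nm) // leq_sub2r.
split=> //; split=> [|k]; first by exists m.
have -> : (fun y => (p y)^`(r)`_k) = fun y => (p y)`_(r + k) *+ (r + k) ^_ r.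
  by apply/funext => y; rewrite coef_derivn.
exact: subring_mulrn.
Qed.

(** The functions of (y, x) polynomial in x; with P := polyfam they form again
    a ring, so that variables can be added one at a time. *)
Definition evals (P : (Y -> {poly K}) -> Prop) (F : Y * K -> K) :=
  exists2 p, P p & F = fun e => (p e.1).[e.2].

Lemma subring_evals : subring (evals polyfam).
Proof.
split=> [|_ _ [p pp ->] [q pq ->]|_ _ [p pp ->] [q pq ->]].
- exists (fun=> 1); first exact: polyfamC (subring1 A_ring).
  by apply/funext => y; rewrite hornerC.
- exists (fun y => p y - q y); first exact: polyfamB.
  by apply/funext => y; rewrite hornerD hornerN.
- exists (fun y => p y * q y); first exact: polyfamM.
  by apply/funext => y; rewrite hornerM.
Qed.

Lemma evals_fst f : A f -> evals polyfam (fun e => f e.1).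
Proof.
move=> Af; exists (fun y => (f y)%:P); first exact: polyfamC.
by apply/funext => y; rewrite hornerC.
Qed.

Lemma evals_snd : evals polyfam snd.
Proof.
by exists (fun=> 'X); [exact: polyfamX|apply/funext => y; rewrite hornerX].
Qed.

(** The coefficient of X^n in g need not be its leading one for every
    parameter, so division is replaced by repeated cross-multiplication with
    that coefficient. *)
Lemma pseudo_reduce n (g : Y -> {poly K}) p : polyfamN n.+1 g -> polyfam p ->
  exists m r, polyfamN n r /\ forall y, exists s : {poly K},
    (g y)`_n ^+ m *: p y = s * g y + r y.
Proof.
move=> gN [[N pN] pA].
have {pN} : polyfamN (n + N) p.
  by split=> [|y]; [split=> //; exists N|rewrite (leq_trans (pN y)) ?leq_addl].
elim: N p {pA} => [|N IHN] p pN.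
  exists 0%N, p; rewrite addn0 in pN; split=> // y.
  by exists 0; rewrite expr0 scale1r mul0r add0r.
pose a y := (g y)`_n; pose b y := (p y)`_(n + N).
(* The terms of degree n + N cancel. *)
pose p1 y := (a y)%:P * p y - (b y)%:P * ('X ^+ N * g y).
have p1f : polyfam p1.
  have fa : polyfam (fun y => (a y)%:P) by apply: polyfamC; exact: gN.1.2.
  have fb : polyfam (fun y => (b y)%:P) by apply: polyfamC; exact: pN.1.2.
  have fX : polyfam (fun y => 'X ^+ N * g y).
    by apply: polyfamM gN.1; exact: polyfam_exp polyfamX.
  apply: polyfamB; apply: polyfamM => //; exact: pN.1.
have p1N : polyfamN (n + N) p1.
  split=> // y; apply/leq_sizeP => j nj; rewrite coefB !coefCM coefXnM.
  rewrite ltnNge (leq_trans (leq_addl n N) nj) /=.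
  move: nj; rewrite leq_eqVlt => /orP[/eqP <-|nj].
    by rewrite addnK mulrC subrr.
  rewrite (@nth_default _ _ (p y)); last by rewrite (leq_trans (pN.2 y)) // addnS.
  rewrite (@nth_default _ _ (g y)); last first.
    by rewrite (leq_trans (gN.2 y)) // ltn_subRL addnC.
  by rewrite !mulr0 subrr.
have [m [r [rN rE]]] := IHN p1 p1N; exists m.+1, r; split=> // y.
have [q qE] := rE y; exists (q + (a y ^+ m * b y)%:P * 'X ^+ N).
rewrite mulrDl addrAC -qE /p1 -/(a y) exprSr -scalerA -!mul_polyC polyCM.
by rewrite mulrBr -!mulrA addrNK.
Qed.

End Family.

Lemma polyfam_shift (Y : Type) (A : (Y -> K) -> Prop) p : subring A ->
  polyfam A p -> polyfam (evals (polyfam A)) (fun e => shift (p e.1) e.2).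
Proof.
move=> A_ring pp; have A1 := subring_evals A_ring.
have [[N pN] pA] := pp.
have -> : (fun e : Y * K => shift (p e.1) e.2) =
    fun e => \sum_(i < N) ((p e.1)`_i)%:P * ('X + (e.2)%:P) ^+ i.
  apply/funext => e; rewrite /shift comp_polyE.
  rewrite (big_ord_widen _ (fun i => (p e.1)`_i *: ('X + (e.2)%:P) ^+ i) (pN e.1)).
  rewrite big_mkcond /=; apply: eq_bigr => i _; rewrite mul_polyC.
  by case: ltnP => // pi; rewrite nth_default ?scale0r.
apply: (polyfam_sum A1 N (p := fun i e => ((p e.1)`_i)%:P * ('X + (e.2)%:P) ^+ i)) => i.
apply: (polyfamM A1).
  exact: (polyfamC A1 (evals_fst A_ring (pA i))).
apply: (polyfam_exp A1); apply: (polyfamD A1); first exact: (polyfamX A1).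
exact: (polyfamC A1 (evals_snd A_ring)).
Qed.

End PolynomialFamilies.

Lemma List_InP (T : eqType) (x : T) (s : seq T) : reflect (List.In x s) (x \in s).
Proof.
elim: s => [|a s IHs] /=; first by constructor.
rewrite inE; apply: (iffP orP) => [[/eqP ->|/IHs]|[->|/IHs]]; by [left|right].
Qed.

Section FieldConditions.
Variables (C : closedFieldType) (K : fieldType) (V : henselian_field C K).

Definition valF (Y : Type) (A : (Y -> K) -> Prop) (h : Y -> option int) :=
  exists2 f, A f & h = fun y => vord V (f y).
Definition acF (Y : Type) (A : (Y -> K) -> Prop) (g : Y -> C) :=
  exists2 f, A f & g = fun y => ac V (f y).
Definition separatedK (Y : Type) (A : (Y -> K) -> Prop) := separated (valF A) (acF A).

Lemma lowest_vord (p q : {poly K}) z m : (forall k : nat, vord V p`_k = vord V q`_k) ->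
  lowest V p z m -> lowest V q z m.
Proof.
move=> pq [g [k vk]]; split; last by exists k; rewrite -pq.
by move=> l; have := g l; rewrite !vgeP pq.
Qed.

Lemma vord_eq0 x y : vord V x = vord V y -> (x == 0) = (y == 0).
Proof. by rewrite /vord; case: eqP => //; case: eqP. Qed.

Lemma poly_vord_eq0 (p q : {poly K}) : (forall k : nat, vord V p`_k = vord V q`_k) ->
  (p == 0) = (q == 0).
Proof.
by move=> pq; apply/eqP/eqP => e; apply/polyP => k; rewrite coef0; apply/eqP;
  [rewrite -(vord_eq0 (pq k))|rewrite (vord_eq0 (pq k))]; rewrite e coef0.
Qed.

Lemma min_value_vord (p q : {poly K}) z : (forall k : nat, vord V p`_k = vord V q`_k) ->
  min_value V p z = min_value V q z.
Proof.
move=> pq; congr xget; apply/funext => m; apply/propext; split; exact: lowest_vord.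
Qed.

Section InitialForm.
Variables (Y : Type) (A : (Y -> K) -> Prop).
Local Notation ZR := (@rvZ C Y (valF A)).
Local Notation CR := (rvC (acF A)).
Implicit Types q : Y -> {poly K}.

Definition coef_vords q N : seq (Y * (int * C) -> option int) :=
  (fun e => Some e.2.1) :: [seq (fun e => vord V (q e.1)`_k) | k <- iota 0 N].

Lemma coef_vords_rvZ q N : polyfam A q -> forall h, List.In h (coef_vords q N) -> ZR h.
Proof.
move=> [_ qA] h [<-|]; first by right.
elim: (iota 0 N) => //= k s IHs [<-|/IHs //].
by left; exists (fun y => vord V (q y)`_k) => //; exists (fun y => (q y)`_k).
Qed.

Lemma coef_vordsP q N e e' : (forall y, (size (q y) <= N)%N) ->
  (forall h, List.In h (coef_vords q N) -> h e = h e') ->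
  e.2.1 = e'.2.1 /\ forall k : nat, vord V (q e.1)`_k = vord V (q e'.1)`_k.
Proof.
move=> qN ee'; split.
  by have [] := ee' (fun e => Some e.2.1) (or_introl erefl).
move=> k; have [kN|Nk] := ltnP k N; last first.
  by rewrite !nth_default // (leq_trans (qN _)).
apply: (ee' (fun e => vord V (q e.1)`_k)); right.
have /List_InP : k \in iota 0 N by rewrite mem_iota.
elim: (iota 0 N) => //= a s IHs [->|/IHs]; by [left|right].
Qed.

(** The data attached to the Newton polygon, such as [min_value], depend on
    the values of the coefficients only. *)
Lemma value_pred_coefs q (P : {poly K} -> int -> Prop) : polyfam A q ->
  (forall (p p' : {poly K}) z, (forall k : nat, vord V p`_k = vord V p'`_k) ->
    P p z -> P p' z) ->
  value_pred ZR (fun e => P (q e.1) e.2.1).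
Proof.
move=> qf Pv; have [[N qN] _] := qf.
exists (coef_vords q N); split; first exact: coef_vords_rvZ.
by move=> e e' /(coef_vordsP qN)[-> H]; exact: Pv.
Qed.

(** A coefficient of the initial polynomial is the leading coefficient of the
    corresponding coefficient of q, or 0, according to a condition on values. *)
Lemma piecewise_coef_initial q k : polyfam A q ->
  piecewise ZR CR (fun e => (initial V (q e.1) e.2.1)`_k).
Proof.
move=> qf; pose P (p : {poly K}) z := p != 0 /\
  vord V p`_k = Some (min_value V p z - z * k%:Z).
have Pz : value_pred ZR (fun e => P (q e.1) e.2.1).
  apply: value_pred_coefs => // p p' z pp'.
  by rewrite /P (poly_vord_eq0 pp') pp' (min_value_vord _ pp').
have -> : (fun e : Y * (int * C) => (initial V (q e.1) e.2.1)`_k) =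
   fun e => if `[< P (q e.1) e.2.1 >] then ac V (q e.1)`_k else 0.
  apply/funext => e; case: asboolP => [[q0 vk]|nP];
    first by rewrite coef_initial // vk eqxx.
  have [q0|q0] := eqVneq (q e.1) 0; first by rewrite /initial q0 eqxx coef0.
  by rewrite coef_initial //; case: eqP => // vk; case: nP.
apply: piecewise_if => //; last exact: piecewise_const.
apply/piecewise_ratfun/ratfun_base; left; exists (fun y => ac V (q y)`_k) => //.
by exists (fun y => (q y)`_k) => //; exact: qf.2.
Qed.

Lemma piecewise_xi : piecewise ZR CR (fun e => e.2.2).
Proof. by apply/piecewise_ratfun/ratfun_base; right. Qed.

Lemma piecewise_exp E ZS CS (f : E -> C) n : piecewise ZS CS f ->
  piecewise ZS CS (fun e => f e ^+ n).
Proof.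
move=> pf; elim: n => [|n IHn].
  have -> : (fun e => f e ^+ 0) = fun=> 1 by apply/funext.
  exact: piecewise_const.
have -> : (fun e => f e ^+ n.+1) = fun e => f e * f e ^+ n.
  by apply/funext => e; rewrite exprS.
exact: piecewise_mul.
Qed.

Lemma piecewise_horner_initial q : polyfam A q ->
  piecewise ZR CR (fun e => (initial V (q e.1) e.2.1).[e.2.2]).
Proof.
move=> qf; have [[N qN] _] := qf.
have -> : (fun e : Y * (int * C) => (initial V (q e.1) e.2.1).[e.2.2]) =
   fun e => \sum_(i <- iota 0 N) (initial V (q e.1) e.2.1)`_i * e.2.2 ^+ i.
  apply/funext => e; rewrite (horner_coef_wide _ (n := N)).
    by rewrite -(big_mkord xpredT (fun i =>
      (initial V (q e.1) e.2.1)`_i * e.2.2 ^+ i)) /index_iota subn0.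
  exact: leq_trans (size_initial _ _ _) (qN _).
apply: (@piecewise_sum C _ _ _ _ _ (fun (i : nat) e =>
  (initial V (q e.1) e.2.1)`_i * e.2.2 ^+ i)) => i.
by apply: piecewise_mul; [exact:
  piecewise_coef_initial|apply/piecewise_exp/piecewise_xi].
Qed.

Lemma piecewise_horner_deriv_initial q : polyfam A q ->
  piecewise ZR CR (fun e => (initial V (q e.1) e.2.1)^`().[e.2.2]).
Proof.
move=> qf; have [[N qN] _] := qf.
have -> : (fun e : Y * (int * C) => (initial V (q e.1) e.2.1)^`().[e.2.2]) =
   fun e => \sum_(i <- iota 0 N) ((initial V (q e.1) e.2.1)`_i.+1 * i.+1%:R) *
     e.2.2 ^+ i.
  apply/funext => e; rewrite (horner_coef_wide _ (n := N)).
    rewrite -(big_mkord xpredT (fun i =>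
      (initial V (q e.1) e.2.1)^`()`_i * e.2.2 ^+ i)).
    by rewrite /index_iota subn0; apply: eq_bigr => i _; rewrite coef_deriv mulr_natr.
  rewrite -derivn1 (leq_trans (size_derivn_leq _ _)) // (leq_trans (leq_subr _ _)) //.
  exact: leq_trans (size_initial _ _ _) (qN _).
apply: (@piecewise_sum C _ _ _ _ _ (fun (i : nat) e =>
  ((initial V (q e.1) e.2.1)`_i.+1 * i.+1%:R) * e.2.2 ^+ i)) => i.
apply: piecewise_mul; last exact/piecewise_exp/piecewise_xi.
by apply: piecewise_mul; [exact: piecewise_coef_initial|exact: piecewise_const].
Qed.

Lemma separated_regular q : polyfam A q -> separated ZR CR (fun e =>
  regular V (q e.1) e.2).
Proof.
move=> qf; apply: separated_or; last
  exact/separated_not/piecewise_zero/piecewise_horner_initial.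
apply: separated_z; apply: (value_pred_coefs (P := fun p _ => p = 0)) =>
  // p p' _ /poly_vord_eq0 e.
by move=> /eqP; rewrite e => /eqP.
Qed.

Lemma separated_simple_zero q : polyfam A q ->
  separated ZR CR (fun e => simple_zero V (q e.1) e.2).
Proof.
move=> qf; apply: separated_and; first exact/piecewise_zero/piecewise_horner_initial.
exact/separated_not/piecewise_zero/piecewise_horner_deriv_initial.
Qed.

End InitialForm.

(** At a center where finitely many polynomials are regular, the value and the
    leading coefficient of p(x) are given by the initial polynomial of p
    expanded at c, hence by the leading term of x - c. *)
Lemma separated_near_center (Y : Type) (A : (Y -> K) -> Prop)
    (P : (Y -> {poly K}) -> Prop) (Q : Y * K -> Prop) :
  subring A -> (forall p, P p -> polyfam A p) -> separatedK (evals P) Q ->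
  exists ps Q', [/\ forall p, List.In p ps -> P p,
    separated (rvZ (valF (evals (polyfam A)))) (rvC (acF (evals (polyfam A)))) Q' &
    forall y c x, x != c ->
      (forall p, List.In p ps -> regular V (shift (p y) c) (rv V (x - c))) ->
      Q (y, x) <-> Q' ((y, c), rv V (x - c))].
Proof.
move=> A_ring PA Qg.
pose cond ps (e : (Y * K) * K) := e.2 != e.1.2 /\
  forall p, List.In p ps -> regular V (shift (p e.1.1) e.1.2) (rv V (e.2 - e.1.2)).
pose DD (D : (Y * K) * K -> Prop) := exists ps : seq (Y -> {poly K}),
  (forall p, List.In p ps -> P p) /\ forall e, cond ps e -> D e.
have shf p : P p -> polyfam (evals (polyfam A)) (fun e => shift (p e.1) e.2).
  by move=> /PA; exact: polyfam_shift.
have cond1 p e : cond [:: p] e -> e.2 - e.1.2 != 0 /\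
    regular V (shift (p e.1.1) e.1.2) (rv V (e.2 - e.1.2)).
  by case=> e0 H; rewrite subr_eq0; split=> //; apply: H; left.
have [||||D [Q' [[ps [psP psD]] gQ' QQ']]] :=
  @transfer_separated C ((Y * K) * K) (Y * K)
  ((Y * K) * (int * C)) (fun e => (e.1.1, e.2)) (fun e => (e.1, rv V (e.2 - e.1.2)))
  (valF (evals P)) (acF (evals P)) (rvZ (valF (evals (polyfam A))))
  (rvC (acF (evals (polyfam A)))) DD _ _ _ _ Q Qg.
- by exists [::].
- move=> D1 D2 [s1 [s1P s1D]] [s2 [s2P s2D]]; exists (s1 ++ s2); split.
    by move=> p /List.in_app_iff[/s1P|/s2P].
  move=> e [e0 H]; split.
    by apply: s1D; split=> // p ps; apply: H; apply/List.in_app_iff; left.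
  by apply: s2D; split=> // p ps; apply: H; apply/List.in_app_iff; right.
- move=> _ [_ [p pP ->] ->]; have [[N pN] _] := shf p pP.
  exists (cond [:: p]), (coef_vords (fun e => shift (p e.1) e.2) N); split.
  + by exists [:: p]; split=> // p' [<-|].
  + by apply: coef_vords_rvZ; exact: shf.
  + move=> e e' /cond1[e0 re] /cond1[e'0 re'] /= /(coef_vordsP pN) /= [zz vv].
    rewrite -(horner_shift (p e.1.1) e.1.2 e.2).
    rewrite -(horner_shift (p e'.1.1) e'.1.2 e'.2).
    have [q0|q0] := eqVneq (shift (p e.1.1) e.1.2) 0.
      have /eqP -> : shift (p e'.1.1) e'.1.2 == 0 by rewrite -(poly_vord_eq0 vv) q0.
      by rewrite q0 !horner0.
    have q'0 : shift (p e'.1.1) e'.1.2 != 0 by rewrite -(poly_vord_eq0 vv).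
    have [-> _] := regular_horner e0 re q0.
    have [-> _] := regular_horner e'0 re' q'0.
    by rewrite (min_value_vord _ vv) /= zz.
- move=> _ [_ [p pP ->] ->].
  exists (cond [:: p]), (fun e => (initial V (shift (p e.1.1) e.1.2)
    e.2.1).[e.2.2]); split.
  + by exists [:: p]; split=> // p' [<-|].
  + apply: (piecewise_horner_initial (q := fun e => shift (p e.1) e.2)); exact: shf.
  + move=> e /cond1[e0 re] /=; rewrite -(horner_shift _ e.1.2).
    have [q0|q0] := eqVneq (shift (p e.1.1) e.1.2) 0.
      by rewrite q0 /initial eqxx !horner0 ac0.
    by have [_ ->] := regular_horner e0 re q0.
exists ps, Q'; split=> // y c x xc H.
by apply: (QQ' ((y, c), x)); apply: psD.
Qed.

End FieldConditions.

(** * Quantifiers over the field *)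

Section FieldElimination.
Variables (C : closedFieldType) (K : fieldType) (V : henselian_field C K).
Hypothesis C_char0 : [pchar C] =i pred0.

Lemma In_map_eval (Y : Type) (ps : seq (Y -> {poly K})) y q :
  q \in [seq p y | p <- ps] -> exists2 p, List.In p ps & q = p y.
Proof.
elim: ps => //= p ps IHs; rewrite inE => /orP[/eqP ->|/IHs[p' p's ->]].
  by exists p; [left|].
by exists p'; [right|].
Qed.

Lemma eval_In_map (Y : Type) (ps : seq (Y -> {poly K})) y p :
  List.In p ps -> p y \in [seq p y | p <- ps].
Proof.
elim: ps => //= p' ps IHs [->|/IHs ps_y]; rewrite inE ?eqxx //.
by rewrite ps_y orbT.
Qed.

Lemma separated_subst (Y Y' : Type) (A : (Y -> K) -> Prop) (A' : (Y' -> K) -> Prop)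
    (phi : Y' -> Y) (Q : Y -> Prop) :
  (forall f, A f -> A' (fun y => f (phi y))) ->
  separatedK V A Q -> separatedK V A' (fun y => Q (phi y)).
Proof.
move=> Aphi Qg.
have [||||D [Q' [DT gQ' QQ']]] := @transfer_separated C Y' Y Y' phi id (valF V A)
  (acF V A)
  (valF V A') (acF V A') (fun D => forall y, D y) _ _ _ _ Q Qg => //.
- move=> _ [f Af ->]; exists (fun=> True), [:: fun y => vord V (f (phi y))]; split=> //.
    by move=> h [<-|//]; exists (fun y => f (phi y)); first exact: Aphi.
  by move=> x y _ _ /(_ (fun y => vord V (f (phi y)))) ->; [|left].
- move=> _ [f Af ->]; exists (fun=> True), (fun y => ac V (f (phi y))); split=> //.
  by apply/piecewise_ratfun/ratfun_base; exists (fun y => f (phi y)); first exact: Aphi.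
- by apply: separated_ext gQ' => y; split=> /QQ'; apply.
Qed.

Lemma goodK_zero (Y : Type) (A : (Y -> K) -> Prop) f : A f ->
  separatedK V A (fun y => f y = 0).
Proof.
move=> Af; have H : ratfun (acF V A) (fun y => ac V (f y)).
  by apply: ratfun_base; exists f.
apply: separated_ext (separated_c _ H) => y; split=> [/eqP|->]; last by rewrite ac0.
by rewrite ac_eq0 => /eqP.
Qed.

Section OneVariable.
Variables (Y : Type) (A : (Y -> K) -> Prop) (A_ring : subring A).
Local Notation AX := (evals (polyfam A)).
Local Notation separatedR := (separated (rvZ (valF V AX)) (rvC (acF V AX))).
Variable ps : seq (Y -> {poly K}).
Hypothesis ps_fam : forall p, List.In p ps -> polyfam A p.
Variables (Q' : (Y * K) * (int * C) -> Prop) (Q'_separated : separatedR Q').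

Lemma separated_around_center (R : (Y * K) * (int * C) -> Prop) : separatedR R ->
  separatedK V AX (fun e => exists rho : int * C, [/\ rho.2 <> 0, R (e, rho),
    forall p, List.In p ps -> regular V (shift (p e.1) e.2) rho & Q' (e, rho)]).
Proof.
move=> Rg.
have g1 : separatedR (fun e => e.2.2 <> 0).
  by apply/separated_not/piecewise_zero/piecewise_ratfun/ratfun_base; right.
have g2 : separatedR (fun e => forall p, List.In p ps ->
    regular V (shift (p e.1.1) e.1.2) e.2).
  apply: separated_forall_in => p pps.
  apply: (separated_regular V (q := fun e => shift (p e.1) e.2)).
  by apply: polyfam_shift => //; exact: ps_fam.
apply: separated_ext (separated_rv_exists (separated_and (separated_and g1 Rg)
  (separated_and g2 Q'_separated))).
by move=> e; split=> -[rho]; [case=> -[? ?] [? ?]|case]; exists rho.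
Qed.

End OneVariable.

Lemma separated_at0 (Y : Type) (A : (Y -> K) -> Prop) (H : Y * K -> Prop) :
  subring A -> separatedK V (evals (polyfam A)) H -> separatedK V A (fun y => H (y, 0)).
Proof.
move=> A_ring; apply: (separated_subst (phi := fun y => (y, 0))) => _ [p [_ pA] ->].
rewrite /=; have -> : (fun y => (p y).[0]) = fun y => (p y)`_0.
  by apply/funext => y; rewrite horner_coef0.
exact: pA.
Qed.

Lemma vord_mulI x x' y y' : x != 0 -> vord V x = vord V x' ->
  vord V (x * y) = vord V (x' * y') -> vord V y = vord V y'.
Proof.
move=> x0 xx' xy.
have x'0 : x' != 0 by rewrite -(vord_eq0 xx').
have [y0|y0] := eqVneq y 0.
  move: (vord_eq0 xy); rewrite y0 mulr0 eqxx => /esym.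
  by rewrite mulf_eq0 (negPf x'0) => /eqP ->.
have y'0 : y' != 0.
  by move: (vord_eq0 xy); rewrite !mulf_eq0 (negPf x0) (negPf x'0) (negPf y0) /= => <-.
have [i vx] := vord_ex V x0; have [j vy] := vord_ex V y0.
have [i' vx'] := vord_ex V x'0; have [j' vy'] := vord_ex V y'0.
move: xy; rewrite (vordM vx vy) (vordM vx' vy') vy vy' => -[].
by move: xx'; rewrite vx vx' => -[->] /addrI ->.
Qed.

Lemma vordX x x' n : vord V x = vord V x' -> vord V (x ^+ n) = vord V (x' ^+ n).
Proof.
have [->|x0] := eqVneq x 0.
  by rewrite vord0 => /esym/vord_None ->.
have [i vx] := vord_ex V x0; rewrite vx => /esym vx'.
have H y k : vord V y = Some i -> vord V (y ^+ k) = Some (i *+ k).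
  move=> vy; elim: k => [|k IHk]; last by rewrite exprS mulrS; exact: vordM.
  rewrite expr0 mulr0n; apply/vordP; split; first by rewrite vge_intg; exact: intg1.
  by rewrite /res_at oppr0 expr0z mulr1 res1 oner_eq0.
by rewrite !H.
Qed.

Lemma acX x n : ac V (x ^+ n) = ac V x ^+ n.
Proof.
elim: n => [|n IHn]; last by rewrite !exprS acM IHn.
rewrite !expr0 (@acE _ _ _ _ 0) /res_at ?oppr0 ?expr0z ?mulr1 ?res1 //.
apply/vordP; split; first by rewrite vge_intg; exact: intg1.
by rewrite /res_at oppr0 expr0z mulr1 res1 oner_eq0.
Qed.

(** On the roots of g where the coefficient of X^(n+1) is not 0, every
    polynomial may be replaced by its pseudo-remainder, of degree at most n;
    values and leading coefficients then differ by those of a power of that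
    coefficient. *)
Lemma separated_reduce (Y : Type) (A : (Y -> K) -> Prop) (g : Y -> {poly K}) n
    (Q : Y * K -> Prop) : subring A -> polyfamN A n.+2 g ->
  separatedK V (evals (polyfam A)) Q ->
  exists2 Q', separatedK V (evals (polyfamN A n.+1)) Q' &
    forall y x, (g y)`_n.+1 != 0 -> root (g y) x -> Q (y, x) <-> Q' (y, x).
Proof.
move=> A_ring gN Qg; pose a y := (g y)`_n.+1.
pose good_pt (e : Y * K) := a e.1 != 0 /\ root (g e.1) e.2.
have aN : polyfamN A n.+1 (fun y => (a y)%:P).
  split; last by move=> y; exact: leq_trans (size_polyC_leq1 _) _.
  by apply: polyfamC => //; exact: gN.1.2.
have reduction p : polyfam A p -> exists m r, polyfamN A n.+1 r /\
    forall e, good_pt e -> a e.1 ^+ m * (p e.1).[e.2] = (r e.1).[e.2].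
  move=> pp; have [m [r [rN rE]]] := pseudo_reduce A_ring gN pp.
  exists m, r; split=> // e [ae /eqP vge]; have [s sE] := rE e.1.
  by rewrite -hornerZ sE hornerD hornerM vge mulr0 add0r.
have [||||D [Q' [DT gQ' QQ']]] := @transfer_separated C (Y * K) (Y * K) (Y * K) id id
  (valF V (evals (polyfam A))) (acF V (evals (polyfam A)))
  (valF V (evals (polyfamN A n.+1))) (acF V (evals (polyfamN A n.+1)))
  (fun D => forall e, good_pt e -> D e) _ _ _ _ Q Qg => //.
- by move=> D1 D2 D1P D2P e vge; split; [exact: D1P|exact: D2P].
- move=> _ [_ [p pp ->] ->]; have [m [r [rN rE]]] := reduction p pp.
  exists good_pt, [:: fun e => vord V (r e.1).[e.2]; fun e => vord V (a e.1)%:P.[e.2]].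
  split=> //.
    move=> h [<-|[<-|//]]; [exists (fun e => (r e.1).[e.2])|
      exists (fun e => (a e.1)%:P.[e.2])] => //; first by exists r.
    by exists (fun y => (a y)%:P).
  move=> e e' vge ge' H /=.
  have h1 := H _ (or_introl erefl); have h2 := H _ (or_intror (or_introl erefl)).
  rewrite /= !hornerC in h2.
  apply: (vord_mulI (x := a e.1 ^+ m) (x' := a e'.1 ^+ m)).
  + by rewrite expf_neq0 //; case: vge.
  + exact: vordX.
  + by rewrite !rE.
- move=> _ [_ [p pp ->] ->]; have [m [r [rN rE]]] := reduction p pp.
  exists good_pt, (fun e => ac V (r e.1).[e.2] * (ac V (a e.1)%:P.[e.2] ^+ m)^-1).
  split=> //.
    apply: piecewise_mul.
      apply/piecewise_ratfun/ratfun_base; exists (fun e => (r e.1).[e.2]) => //;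
        by exists r.
    apply/piecewise_inv/piecewise_exp/piecewise_ratfun/ratfun_base.
    exists (fun e => (a e.1)%:P.[e.2]) => //; by exists (fun y => (a y)%:P).
  move=> e vge /=; rewrite -rE // acM hornerC acX mulrAC divff ?mul1r //.
  by rewrite expf_neq0 // ac_eq0; case: vge.
- by exists Q' => // y x ay rx; apply: (QQ' (y, x)); exact: DT.
Qed.

(** Induction on the degree of g. After reduction of Q modulo g, the closest
    center to a root x of g is 0 or a root of a polynomial of smaller degree.
    Either x is that center, or x - c has a leading term at which the
    expansion of g has a simple zero, and then Hensel's lemma turns every such
    leading term into a root. *)
Lemma root_elim n (Y : Type) (A : (Y -> K) -> Prop) (g : Y -> {poly K})
    (Q : Y * K -> Prop) :
  subring A -> polyfamN A n g -> separatedK V (evals (polyfam A)) Q ->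
  separatedK V A (fun y => exists x, [/\ g y != 0, root (g y) x & Q (y, x)]).
Proof.
elim: n Y A g Q => [|n IHn] Y A g Q A_ring gN Qg.
  apply: separated_ext (separated_const _ _ False) => y; split=> // -[x [g0 _ _]].
  by case/negP: g0; rewrite -size_poly_leq0; exact: gN.2.
case: n IHn gN => [|n] IHn gN.
  apply: separated_ext (separated_const _ _ False) => y; split=> // -[x [g0 rx _]].
  move: (gN.2 y) rx => /size1_polyC gE; rewrite gE rootC => /eqP e.
  by rewrite gE e eqxx in g0.
pose a y := (g y)`_n.+1.
have ga : separatedK V A (fun y => a y = 0) by apply: goodK_zero; exact: gN.1.2.
(* Where the coefficient of degree n + 1 vanishes, g has smaller degree. *)
pose g0 y := take_poly n.+1 (g y).
have g0N : polyfamN A n.+1 g0.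
  split=> [|y]; last exact: size_take_poly.
  split=> [|k]; first by exists n.+1 => y; exact: size_take_poly.
  have [kn|nk] := ltnP k n.+1.
    have -> : (fun y => (g0 y)`_k) = fun y => (g y)`_k.
      by apply/funext => y; rewrite coef_take_poly kn.
    exact: gN.1.2.
  have -> : (fun y => (g0 y)`_k) = fun=> 0.
    by apply/funext => y; rewrite coef_take_poly ltnNge nk.
  exact: subring0.
have g0E y : a y = 0 -> g0 y = g y.
  move=> ay; apply/polyP => k; rewrite coef_take_poly; case: ltnP => //.
  rewrite leq_eqVlt => /orP[/eqP <- //|nk].
  by rewrite nth_default // (leq_trans (gN.2 y)).
have [Q1 gQ1 QQ1] := separated_reduce A_ring gN Qg.
have [ps [Q2 [psN gQ2 QQ2]]] := separated_near_center A_ring (fun p (pN : polyfamN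
  A n.+1 p) => pN.1) gQ1.
have psf p : List.In p ps -> polyfam A p by move=> /psN[].
pose H (e : Y * K) := (g e.1).[e.2] = 0 /\ Q e \/ exists rho : int * C,
  [/\ rho.2 <> 0, simple_zero V (shift (g e.1) e.2) rho,
    forall p, List.In p ps -> regular V (shift (p e.1) e.2) rho & Q2 (e, rho)].
have gH : separatedK V (evals (polyfam A)) H.
  apply: separated_or.
    apply: separated_and Qg; apply: (goodK_zero (f := fun e => (g e.1).[e.2])).
    by exists g => //; exact: gN.1.
  apply: (separated_around_center A_ring psf gQ2
    (R := fun e => simple_zero V (shift (g e.1.1) e.1.2) e.2)).
  apply: (separated_simple_zero V (q := fun e => shift (g e.1) e.2)).
  by apply: polyfam_shift => //; exact: gN.1.
have gpr p r : List.In p ps ->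
  separatedK V A (fun y => exists x, [/\ (p y)^`(r) != 0, root (p y)^`(r) x & H (y,
    x)]).
  move=> /psN pN; apply: (IHn _ _ (fun y => (p y)^`(r))) => //.
  by apply: (polyfamN_derivn A_ring _ pN); exact: leq_subr.
have ggr r :
  separatedK V A (fun y => exists x, [/\ (g y)^`(r.+1) != 0, root (g y)^`(r.+1) x &
    H (y, x)]).
  apply: (IHn _ _ (fun y => (g y)^`(r.+1))) => //.
  by apply: (polyfamN_derivn A_ring _ gN); rewrite subSS leq_subr.
have g1 := IHn _ _ _ _ A_ring g0N Qg.
have G := separated_or (separated_at0 A_ring gH)
  (separated_or (separated_exists_in (s := ps) (fun p pps =>
    separated_exists_in (s := iota 0 n.+2) (fun r _ => gpr p r pps)))
   (separated_exists_in (s := iota 0 n.+2) (fun r _ => ggr r))).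
apply: separated_ext (separated_or (separated_and ga g1) (separated_and
  (separated_not ga) G)) => y.
split.
  case=> [[a0 [x]]|[/eqP a0 cases]]; first by rewrite g0E //; exists x.
  have gy0 : g y != 0 by apply: contraNneq a0 => e; rewrite /a e coef0.
  have {cases}[c] : exists c, H (y, c).
    case: cases => [?|[[p [_ [r [_ [x [_ _ ?]]]]]]|[r [_ [x [_ _ ?]]]]]];
      by [exists 0|exists x].
  case=> [[/eqP gc Qc]|[[z xi] [/eqP xi0 sz reg Q2c]]]; first by exists c.
  have [w [w0 rvw rw]] := simple_zero_root xi0 sz.
  have gx : root (g y) (w + c) by rewrite rootE -(horner_shift _ c) addrK.
  exists (w + c); split=> //; apply/(QQ1 y _ a0 gx).
  have wc : w + c != c by rewrite -subr_eq0 addrK.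
  by apply/(QQ2 y c _ wc); rewrite addrK rvw.
case=> x [gy0 gx Qx].
have [/eqP a0|a0] := boolP (a y == 0).
  by left; split=> //; exists x; rewrite g0E.
right; split; first exact/eqP.
have [c [cS cP]] := regular_center V C_char0 [seq p y | p <- ps] (g y) x.
(* The leading term of x - c witnesses H. *)
have Hc : H (y, c).
  have [xc|xc] := eqVneq x c; first by left; rewrite -xc; split=> //; exact/eqP.
  have [reg simp] := cP xc; right; exists (rv V (x - c)).
  have reg' p : List.In p ps -> regular V (shift (p y) c) (rv V (x - c)).
    by move=> pps; apply: reg; exact: eval_In_map.
  split=> //.
  - by apply/eqP; rewrite rv2_neq0 // subr_eq0.
  - exact: simp.
  - by apply/(QQ2 y c x xc) => //; apply/(QQ1 y x a0 gx).
case: cS => [c0|[q [r [qps q0 rq]]]|[r [q0 rq]]].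
- by left; rewrite -c0.
- have [p pps qE] := In_map_eval qps; rewrite qE in q0 rq.
  right; left; exists p; split=> //; exists r; split; last by exists c.
  apply/List_InP; rewrite mem_iota /= add0n.
  rewrite (leq_trans (derivn_neq0_size q0)) // ltnW // ltnS.
  exact: (psN p pps).2.
- right; right; exists r; split; last by exists c.
  apply/List_InP; rewrite mem_iota /= add0n.
  by rewrite ltnW // (leq_trans (derivn_neq0_size q0)) //; exact: gN.2.
Qed.

(** The quantifier over x is split into one over a center c, which is 0 or a
    root and so falls under [root_elim], and one over the leading term of x -
    c. *)
Theorem field_elim (Y : Type) (A : (Y -> K) -> Prop) (Q : Y * K -> Prop) :
  subring A -> separatedK V (evals (polyfam A)) Q ->
  separatedK V A (fun y => exists x, Q (y, x)).
Proof.
move=> A_ring Qg.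
have [ps [Q2 [psf gQ2 QQ2]]] := separated_near_center A_ring (fun p (pf : polyfam A
  p) => pf) Qg.
have [N psN] : exists N, forall p, List.In p ps -> polyfamN A N p.
  elim: ps psf {QQ2} => [|p ps IHs] psf; first by exists 0%N.
  have [|N HN] := IHs; first by move=> q qs; apply: psf; right.
  have pp := psf p (or_introl erefl); have [[M pM] _] := pp.
  exists (maxn M N) => q [<-|/HN[qf qN]]; split=> // y.
    by rewrite leq_max pM.
  by rewrite leq_max qN orbT.
pose H (e : Y * K) := Q e \/ exists rho : int * C,
  [/\ rho.2 <> 0, True,
    forall p, List.In p ps -> regular V (shift (p e.1) e.2) rho & Q2 (e, rho)].
have gH : separatedK V (evals (polyfam A)) H.
  apply: separated_or => //.
  exact: (separated_around_center A_ring psf gQ2 (separated_const _ _ True)).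
have gpr p r : List.In p ps ->
  separatedK V A (fun y => exists x, [/\ (p y)^`(r) != 0, root (p y)^`(r) x & H (y,
    x)]).
  move=> /psN pN; apply: (root_elim (n := N) (g := fun y => (p y)^`(r))) => //.
  by apply: (polyfamN_derivn A_ring _ pN); exact: leq_subr.
have G := separated_or (separated_at0 A_ring gH)
  (separated_exists_in (s := ps) (fun p pps =>
    separated_exists_in (s := iota 0 N) (fun r _ => gpr p r pps))).
apply: separated_ext G => y; split.
  move=> cases; have {cases}[c] : exists c, H (y, c).
    case: cases => [?|[p [_ [r [_ [x [_ _ ?]]]]]]]; by [exists 0|exists x].
  case=> [Qc|[[z xi] [/eqP xi0 _ reg Q2c]]]; first by exists c.
  have [w [w0 rvw]] := rv_surj V z xi0.
  have wc : w + c != c by rewrite -subr_eq0 addrK.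
  by exists (w + c); apply/(QQ2 y c _ wc); rewrite addrK rvw.
case=> x Qx.
have [c [cS cP]] := regular_center V C_char0 [seq p y | p <- ps] 0 x.
have Hc : H (y, c).
  have [xc|xc] := eqVneq x c; first by left; rewrite -xc.
  have [reg _] := cP xc; right; exists (rv V (x - c)).
  have reg' p : List.In p ps -> regular V (shift (p y) c) (rv V (x - c)).
    by move=> pps; apply: reg; exact: eval_In_map.
  split=> //; first by apply/eqP; rewrite rv2_neq0 // subr_eq0.
  exact/(QQ2 y c x xc).
case: cS => [c0|[q [r [qps q0 rq]]]|[r []]].
- by left; rewrite -c0.
- have [p pps qE] := In_map_eval qps; rewrite qE in q0 rq.
  right; exists p; split=> //; exists r; split; last by exists c.
  apply/List_InP; rewrite mem_iota /= add0n.
  by rewrite (leq_trans (derivn_neq0_size q0)) //; exact: (psN p pps).2.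
- by rewrite derivn_poly0 ?size_poly0 ?eqxx.
Qed.

End FieldElimination.

(** * Formulas and definable families of residues *)

(** Formulas of the language of rings with constants in A, in de Bruijn style:
    the variable 0 is bound by the innermost quantifier. *)
Inductive dbterm (A : Type) :=
| TVar of nat | TConst of A | TOne | TSub of dbterm A & dbterm A |
  TMul of dbterm A & dbterm A.
Arguments TVar {A}. Arguments TOne {A}.

Inductive dbformula (A : Type) :=
| FEq of dbterm A & dbterm A | FAnd of dbformula A & dbformula A |
  FNot of dbformula A | FEx of dbformula A.

Definition env_cons (T : Type) (x : T) (e : nat -> T) (i : nat) : T :=
  if i is j.+1 then e j else x.

Section Semantics.
Variables (A : Type) (L : fieldType) (kappa : A -> L).

Fixpoint dbeval (e : nat -> L) (u : dbterm A) : L :=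
  match u with
  | TVar i => e i
  | TConst a => kappa a
  | TOne => 1
  | TSub u1 u2 => dbeval e u1 - dbeval e u2
  | TMul u1 u2 => dbeval e u1 * dbeval e u2
  end.

Fixpoint sat (e : nat -> L) (f : dbformula A) : Prop :=
  match f with
  | FEq u1 u2 => dbeval e u1 = dbeval e u2
  | FAnd f1 f2 => sat e f1 /\ sat e f2
  | FNot f1 => ~ sat e f1
  | FEx f1 => exists x, sat (env_cons x e) f1
  end.

End Semantics.

Section QuantifierElimination.
Variables (C : closedFieldType) (K : fieldType) (V : henselian_field C K).
Hypothesis C_char0 : [pchar C] =i pred0.
Variables (B : Type) (kappa : B -> K).

(** Quantifier elimination. The ring A of functions grows by one polynomial
    variable with each quantifier. *)
Lemma sat_separated (f : dbformula B) (Y : Type) (A : (Y -> K) -> Prop) (e : Y ->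
  nat -> K) :
  subring A -> (forall b, A (fun=> kappa b)) -> (forall i, A (fun y => e y i)) ->
  separatedK V A (fun y => sat kappa (e y) f).
Proof.
elim: f Y A e => [u1 u2|f1 IH1 f2 IH2|f1 IH1|f1 IH1] Y A e A_ring Ak Ae /=.
- have tA u : A (fun y => dbeval kappa (e y) u).
    elim: u => //= [|u IHu w IHw|u IHu w IHw]; first exact: subring1.
      exact: subringB.
    exact: subringM.
  apply: separated_ext (goodK_zero V (subringB A_ring (tA u1) (tA u2))) => y.
  by split=> [/eqP|->]; rewrite ?subrr // subr_eq0 => /eqP.
- by apply: separated_and; [exact: IH1|exact: IH2].
- by apply: separated_not; exact: IH1.
- apply: (field_elim C_char0 (Q := fun z => sat kappa (env_cons z.2 (e z.1)) f1)) => //.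
  apply: (IH1 _ _ (fun z => env_cons z.2 (e z.1))); first exact: subring_evals.
    by move=> b; exact: (evals_fst A_ring (Ak b)).
  case=> [|i] /=; first exact: evals_snd.
  exact: (evals_fst A_ring (Ae i)).
Qed.

(** Each set Q y is finite or cofinite, with a bound on the exceptions that is
    uniform in y. *)
Definition almost_decided (Y : Type) (Q : Y -> C -> Prop) := exists N : nat, forall y,
  exists2 s : seq C, (size s <= N)%N &
    (forall xi, xi \notin s -> Q y xi) \/ (forall xi, xi \notin s -> ~ Q y xi).

Section AlmostDecided.
Variable Y : Type.
Local Notation full := (fun _ : Y -> K => True).
Local Notation polys := (polyfam full).

(** At a residue xi outside a finite set the polynomial is regular, so its
    value is that of the terms of least value, whatever xi is. *)
Lemma horner_lift (p : {poly K}) : exists2 s : seq C, (size s <= (size p).+1)%N &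
  forall xi, xi \notin s ->
    vord V p.[lift_res V xi] = (if p == 0 then None else Some (min_value V p 0)) /\
    ac V p.[lift_res V xi] = (initial V p 0).[xi].
Proof.
have [->|p0] := eqVneq p 0.
  exists [::] => // xi _; rewrite horner0 vord0 ac0; split=> //.
  by rewrite /initial eqxx horner0.
have [s ss sP] := poly_roots_list (initial_neq0 V 0 p0).
exists (0 :: s) => /= [|xi]; first by rewrite ltnS (leq_trans ss) // size_initial.
rewrite inE negb_or => /andP[xi0 xis].
have l0 : lift_res V xi = monom V 0 xi by rewrite /monom expr0z mul1r.
have vl : vord V (lift_res V xi) = Some 0 by rewrite l0 vord_monom.
have al : ac V (lift_res V xi) = xi by rewrite l0 ac_monom.
have r0 : (initial V p 0).[ac V (lift_res V xi)] != 0.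
  by rewrite al; apply: contraNN xis => /sP.
by have [-> ->] := horner_initial p0 vl r0; rewrite al.
Qed.

(** All but boundedly many residues give the same values. *)
Lemma value_pred_almost A : value_pred (valF V (evals polys)) A ->
  almost_decided (fun y xi => A (y, lift_res V xi)).
Proof.
move=> [hs [hsP hsA]].
have [N HN] : exists N : nat, forall y, exists2 s : seq C, (size s <= N)%N &
    forall xi xi', xi \notin s -> xi' \notin s ->
    forall h, List.In h hs -> h (y, lift_res V xi) = h (y, lift_res V xi').
  elim: hs hsP {hsA} => [|h hs IH] hsP; first by exists 0%N => y; exists [::].
  have [|N HN] := IH; first by move=> k kh; apply: hsP; right.
  have [_ [p [[M pM] _] ->] hE] := hsP h (or_introl erefl).
  exists (M.+1 + N)%N => y; have [s sN sP] := HN y.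
  have [r rM rP] := horner_lift (p y).
  exists (r ++ s).
    by rewrite size_cat leq_add // (leq_trans rM) // ltnS.
  move=> xi xi'; rewrite !mem_cat !negb_or => /andP[xr xs] /andP[x'r x's] k.
  case=> [<-|/(sP _ _ xs x's)//]; rewrite hE /=.
  by have [-> _] := rP _ xr; have [-> _] := rP _ x'r.
exists N => y; have [s sN sP] := HN y; exists s => //.
have [nA|] := pselect (forall xi, xi \notin s -> ~ A (y, lift_res V xi));
  first by right.
move=> /existsNP[x0 /not_implyP[x0s /contrapT Ax0]]; left=> xi xs.
by apply: hsA Ax0 => h hh; apply: sP.
Qed.

Lemma ratfun_almost f : ratfun (acF V (evals polys)) f -> exists N : nat, forall y,
  exists s (p q : {poly C}), [/\ (size s <= N)%N, (size p <= N)%N, (size q <= N)%N &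
    forall xi, xi \notin s -> q.[xi] != 0 /\ f (y, lift_res V xi) = p.[xi] / q.[xi]].
Proof.
elim=> [_ [_ [p [[N pN] _] ->] ->]|c
  |{}f g _ [N fN] _ [M gM]|{}f g _ [N fN] _ [M gM]|{}f _ [N fN]|{}f _ [N fN]].
- exists N.+1 => y; have [s sN sP] := horner_lift (p y).
  exists s, (initial V (p y) 0), 1; split.
  + by rewrite (leq_trans sN) // ltnS.
  + by rewrite (leq_trans (size_initial _ _ _)) // (leq_trans (pN y)).
  + by rewrite size_poly1.
  + by move=> xi /sP[_ e]; rewrite hornerC oner_eq0 divr1.
- exists 1%N => y; exists [::], c%:P, 1; split=> //.
  + exact: size_polyC_leq1.
  + by rewrite size_poly1.
  + by move=> xi _; rewrite !hornerC oner_eq0 divr1.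
- exists (N + M)%N => y.
  have [s [p [q [sN pN qN sP]]]] := fN y; have [r [p' [q' [rN p'N q'N rP]]]] := gM y.
  exists (s ++ r), (p * q' + p' * q), (q * q'); split.
  + by rewrite size_cat leq_add.
  + rewrite (leq_trans (size_polyD _ _)) // geq_max.
    apply/andP; split; rewrite (leq_trans (size_polyMleq _ _)) // (leq_trans
      (leq_pred _)) //.
      by rewrite leq_add.
    by rewrite addnC leq_add.
  + by rewrite (leq_trans (size_polyMleq _ _)) // (leq_trans (leq_pred _)) // leq_add.
  + move=> xi; rewrite mem_cat negb_or => /andP[/sP[q0 ->] /rP[q'0 ->]].
    rewrite hornerD !hornerM mulf_neq0 //; split=> //.
    by field; rewrite q0 q'0.
- exists (N + M)%N => y.
  have [s [p [q [sN pN qN sP]]]] := fN y; have [r [p' [q' [rN p'N q'N rP]]]] := gM y.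
  exists (s ++ r), (p * p'), (q * q'); split.
  + by rewrite size_cat leq_add.
  + by rewrite (leq_trans (size_polyMleq _ _)) // (leq_trans (leq_pred _)) // leq_add.
  + by rewrite (leq_trans (size_polyMleq _ _)) // (leq_trans (leq_pred _)) // leq_add.
  + move=> xi; rewrite mem_cat negb_or => /andP[/sP[q0 ->] /rP[q'0 ->]].
    rewrite !hornerM mulf_neq0 //; split=> //.
    by field; rewrite q0 q'0.
- exists N => y; have [s [p [q [sN pN qN sP]]]] := fN y.
  exists s, (- p), q; split=> //; first by rewrite size_polyN.
  by move=> xi /sP[q0 ->]; rewrite hornerN mulNr.
- exists (N + N).+1 => y; have [s [p [q [sN pN qN sP]]]] := fN y.
  have [p0|p0] := eqVneq p 0.
    exists s, 0, 1; split; rewrite ?size_poly0 ?size_poly1 //.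
      by rewrite (leq_trans sN) // ltnW // ltnS leq_addr.
    move=> xi /sP[q0 ->]; rewrite p0 !hornerC oner_eq0 !mul0r invr0.
    by [].
  have [r rp rP] := poly_roots_list p0.
  exists (s ++ r), q, p; split.
  + by rewrite size_cat ltnW // ltnS leq_add // (leq_trans rp).
  + by rewrite (leq_trans qN) // ltnW // ltnS leq_addr.
  + by rewrite (leq_trans pN) // ltnW // ltnS leq_addr.
  + move=> xi; rewrite mem_cat negb_or => /andP[/sP[q0 ->] xr].
    by rewrite invf_div; split=> //; apply: contraNN xr => /rP.
Qed.

(** Values are generically constant and rational functions have few zeros, so
    a separated predicate has uniformly finite or cofinite traces on the
    residue field. *)
Lemma separated_almost Q : separatedK V (evals polys) Q ->
  almost_decided (fun y xi => Q (y, lift_res V xi)).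
Proof.
elim=> [A /value_pred_almost //|f /ratfun_almost[N fN]|P {}Q _ [N PN]
  _ [M QM]|P _ [N PN]].
- exists (N + N)%N => y; have [s [p [q [sN pN qN sP]]]] := fN y.
  have [p0|p0] := eqVneq p 0.
    exists s; first by rewrite (leq_trans sN) // leq_addr.
    by left=> xi /sP[_ ->]; rewrite p0 horner0 mul0r.
  have [r rp rP] := poly_roots_list p0.
  exists (s ++ r); first by rewrite size_cat leq_add // (leq_trans rp).
  right=> xi; rewrite mem_cat negb_or => /andP[/sP[q0 ->] xr] /eqP.
  rewrite mulf_eq0 invr_eq0 (negPf q0) orbF => /rP xr'.
  by rewrite xr' in xr.
- exists (N + M)%N => y; have [s sN sP] := PN y; have [r rM rP] := QM y.
  exists (s ++ r); first by rewrite size_cat leq_add.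
  case: sP => sP; last first.
    by right=> xi; rewrite mem_cat negb_or => /andP[/sP nP _] [/nP].
  case: rP => rP; last first.
    by right=> xi; rewrite mem_cat negb_or => /andP[_ /rP nP] [_ /nP].
  by left=> xi; rewrite mem_cat negb_or => /andP[/sP ? /rP].
- exists N => y; have [s sN [sP|sP]] := PN y; exists s => //; last by left.
  by right=> xi /sP Px; apply.
Qed.

End AlmostDecided.
End QuantifierElimination.

(** * A calculus of first-order predicates *)

Definition env_cat (T : Type) (s : seq T) (e : nat -> T) : nat -> T :=
  foldr (@env_cons T) e s.
Definition env_drop (T : Type) n (e : nat -> T) : nat -> T := fun i => e (n + i)%N.
Definition env_take (T : Type) n (e : nat -> T) : n.-tuple T := [tuple e i | i < n].

Lemma env_cat_lt (T : Type) (s : seq T) (e : nat -> T) x0 i : (i < size s)%N ->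
  env_cat s e i = nth x0 s i.
Proof. by elim: s i => // a s IHs [|i] //= /IHs. Qed.
Lemma env_cat_ge (T : Type) (s : seq T) (e : nat ->
  T) i : env_cat s e (size s + i)%N = e i.
Proof. by elim: s. Qed.
Lemma env_drop_cat (T : Type) n (x : n.-tuple T) e : env_drop n (env_cat x e) = e.
Proof. by apply/funext => i; have := env_cat_ge x e i; rewrite size_tuple. Qed.
Lemma env_take_cat (T : Type) n (x : n.-tuple T) e : env_take n (env_cat x e) = x.
Proof.
apply: eq_from_tnth => i; rewrite tnth_mktuple (tnth_nth (tnth x i)).
by rewrite (env_cat_lt _ (tnth x i)) ?size_tuple.
Qed.

Section Renaming.
Variable A : Type.

Definition up_renaming (r : nat -> nat) i := if i is j.+1 then (r j).+1 else 0%N.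

Fixpoint rename_term r (u : dbterm A) : dbterm A :=
  match u with
  | TVar i => TVar (r i)
  | TConst a => TConst a
  | TOne => TOne
  | TSub u1 u2 => TSub (rename_term r u1) (rename_term r u2)
  | TMul u1 u2 => TMul (rename_term r u1) (rename_term r u2)
  end.

Fixpoint rename_formula r (f : dbformula A) : dbformula A :=
  match f with
  | FEq u1 u2 => FEq (rename_term r u1) (rename_term r u2)
  | FAnd f1 f2 => FAnd (rename_formula r f1) (rename_formula r f2)
  | FNot f1 => FNot (rename_formula r f1)
  | FEx f1 => FEx (rename_formula (up_renaming r) f1)
  end.

Variables (L : fieldType) (kappa : A -> L).

Lemma dbeval_rename r e u : dbeval kappa e (rename_term r u) = dbeval kappa (e \o r) u.
Proof. by elim: u => //= u1 -> u2 ->. Qed.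

Lemma sat_rename f r e : sat kappa e (rename_formula r f) <-> sat kappa (e \o r) f.
Proof.
elim: f r e => [u1 u2|f1 IH1 f2 IH2|f1 IH1|f1 IH1] r e /=.
- by rewrite !dbeval_rename.
- by have := IH1 r e; have := IH2 r e; tauto.
- by have := IH1 r e; tauto.
- have E x : env_cons x e \o up_renaming r = env_cons x (e \o r) by apply/funext; case.
  by split=> -[x H]; exists x; move: H; rewrite IH1 E.
Qed.

End Renaming.

(** A definition of the valuation ring by a formula: if x is not integral,
    then 1 + t x^2 has odd value and cannot be a square; see [sqrt_ringP]. *)
Definition sqrt_ring (L : fieldType) (t x : L) := exists y, y * y = 1 + t * (x * x).

(** Predicates on environments are considered simultaneously in all the fields
    L i, so that one formula can be transferred from one field to another;
    with a single field whose elements are all constants this is definability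
    with parameters. *)
Section UniformDefinability.
Variables (T : Type) (L : T -> fieldType) (A : Type) (kappa : forall i, A -> L i).

Definition pred_family := forall i : T, (nat -> L i) -> Prop.

Definition fo_pred (P : pred_family) := exists f : dbformula A,
  forall i e, P i e <-> sat (kappa i) e f.
Definition fo_term (v : forall i : T, (nat -> L i) -> L i) := exists u : dbterm A,
  forall i e, v i e = dbeval (kappa i) e u.
(** Environments and tuples that are obtained from the current environment by
    reindexing. *)
Definition fo_env (g : forall i : T, (nat -> L i) -> nat -> L i) :=
  exists r : nat -> nat, forall i e, g i e = e \o r.
Definition fo_tuple n (x : forall i : T, (nat -> L i) -> n.-tuple (L i)) :=
  exists r : nat -> nat, forall i e k, tnth (x i e) k = e (r k).

Lemma fo_env_id : fo_env (fun i e => e).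
Proof. by exists id. Qed.
Lemma fo_env_drop n g : fo_env g -> fo_env (fun i e => env_drop n (g i e)).
Proof. by move=> [r E]; exists (fun i => r (n + i)%N) => i e; rewrite E. Qed.
Lemma fo_tuple_take n g : fo_env g -> fo_tuple (fun i e => env_take n (g i e)).
Proof. by move=> [r E]; exists r => i e k; rewrite E tnth_mktuple. Qed.
Lemma fo_env_cat n (x : forall i, (nat -> L i) -> n.-tuple (L i)) g :
  fo_tuple x -> fo_env g -> fo_env (fun i e => env_cat (x i e) (g i e)).
Proof.
move=> [r E] [s F]; exists (fun k => if (k < n)%N then r k else s (k - n)%N) => i e.
apply/funext => k /=; case: ltnP => kn.
  by rewrite (env_cat_lt _ (e 0%N)) ?size_tuple // -(E i e (Ordinal kn)) (tnth_nth
    (e 0%N)).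
by have := env_cat_ge (x i e) (g i e) (k - n); rewrite size_tuple subnKC // F.
Qed.

Lemma fo_term_var j g : fo_env g -> fo_term (fun i e => g i e j).
Proof. by move=> [r E]; exists (TVar (r j)) => i e; rewrite E. Qed.
Lemma fo_term_drop n j g : fo_env g -> fo_term (fun i e => env_drop n (g i e) j).
Proof. by move=> /(fo_env_drop n)/fo_term_var. Qed.
Lemma fo_term_env j : fo_term (fun i e => e j).
Proof. by exists (TVar j). Qed.
Lemma fo_term_tnth n (x : forall i, (nat -> L i) -> n.-tuple (L i)) k :
  fo_tuple x -> fo_term (fun i e => tnth (x i e) k).
Proof. by move=> [r E]; exists (TVar (r k)) => i e; rewrite E. Qed.
Lemma fo_term_const a : fo_term (fun i _ => kappa i a).
Proof. by exists (TConst a). Qed.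
Lemma fo_term1 : fo_term (fun i _ => 1).
Proof. by exists TOne. Qed.
Lemma fo_termB v w : fo_term v -> fo_term w -> fo_term (fun i e => v i e - w i e).
Proof. by move=> [u E] [u' F]; exists (TSub u u') => i e; rewrite E F. Qed.
Lemma fo_termM v w : fo_term v -> fo_term w -> fo_term (fun i e => v i e * w i e).
Proof. by move=> [u E] [u' F]; exists (TMul u u') => i e; rewrite E F. Qed.
Lemma fo_term0 : fo_term (fun i _ => 0).
Proof. by exists (TSub TOne TOne) => i e /=; rewrite subrr. Qed.
Lemma fo_termD v w : fo_term v -> fo_term w -> fo_term (fun i e => v i e + w i e).
Proof.
by move=> [u E] [u' F]; exists (TSub u (TSub (TSub TOne TOne) u')) => i e /=;
  rewrite E F subrr sub0r opprK.
Qed.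

Lemma fo_pred_ext (P Q : pred_family) : (forall i e, P i e <-> Q i e) ->
  fo_pred P -> fo_pred Q.
Proof. by move=> PQ [f E]; exists f => i e; rewrite -PQ. Qed.
Lemma fo_pred_sat f g : fo_env g -> fo_pred (fun i e => sat (kappa i) (g i e) f).
Proof. by move=> [r E]; exists (rename_formula r f) => i e; rewrite E sat_rename. Qed.
Lemma fo_pred_eq v w : fo_term v -> fo_term w -> fo_pred (fun i e => v i e = w i e).
Proof. by move=> [u E] [u' F]; exists (FEq u u') => i e; rewrite E F. Qed.
Lemma fo_pred_and P Q : fo_pred P -> fo_pred Q -> fo_pred (fun i e => P i e /\ Q i e).
Proof. by move=> [f E] [g F]; exists (FAnd f g) => i e; rewrite E F. Qed.
Lemma fo_pred_not P : fo_pred P -> fo_pred (fun i e => ~ P i e).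
Proof. by move=> [f E]; exists (FNot f) => i e; rewrite E. Qed.
Lemma fo_pred_imp P Q : fo_pred P -> fo_pred Q -> fo_pred (fun i e => P i e -> Q i e).
Proof.
move=> fP fQ; apply: fo_pred_ext (fo_pred_not (fo_pred_and fP (fo_pred_not fQ))) => i e.
split=> [H Pe|PQ [/PQ]//]; apply: contrapT => nQ; exact: H.
Qed.
Lemma fo_pred_or P Q : fo_pred P -> fo_pred Q -> fo_pred (fun i e => P i e \/ Q i e).
Proof.
move=> fP fQ; apply: fo_pred_ext (fo_pred_imp (fo_pred_not fP) fQ) => i e.
split=> [H|[//|//]]; by have [|/H] := pselect (P i e); [left|right].
Qed.
Lemma fo_pred_true : fo_pred (fun _ _ => True).
Proof. by exists (FEq TOne TOne). Qed.
Lemma fo_pred_false : fo_pred (fun _ _ => False).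
Proof. by apply: fo_pred_ext (fo_pred_not fo_pred_true) => i e; tauto. Qed.

(** Under the quantifier the bound element is read off from the environment,
    and the old environment is what remains after dropping it; the tuple
    version is analogous. *)
Lemma fo_pred_ex (R : forall i, L i -> (nat -> L i) -> Prop) :
  fo_pred (fun i e => R i (e 0%N) (env_drop 1 e)) -> fo_pred (fun i e => exists x,
    R i x e).
Proof.
move=> [f E]; exists (FEx f) => i e /=.
by split=> -[x H]; exists x; [apply: (E i (env_cons x e)).1|apply: (E i (env_cons x
  e)).2].
Qed.

Lemma fo_pred_ex_tuple n (R : forall i, n.-tuple (L i) -> (nat -> L i) -> Prop) :
  fo_pred (fun i e => R i (env_take n e) (env_drop n e)) -> fo_pred (fun i e =>
    exists x, R i x e).
Proof.
move=> [f E]; have H : forall i e,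
    (exists x : n.-tuple (L i), R i x e) <-> exists x : n.-tuple (L i),
      sat (kappa i) (env_cat x e) f.
  move=> i e; split=> -[x H]; exists x; move: H.
    by rewrite -E env_take_cat env_drop_cat.
  by rewrite -E env_take_cat env_drop_cat.
suff [g G] : exists g, forall i e, (exists x : n.-tuple (L i),
  sat (kappa i) (env_cat x e) f) <->
     sat (kappa i) e g.
  by exists g => i e; rewrite H.
elim: n f {R E H} => [|n IHn] f.
  exists f => i e; split=> [[x]|H]; first by rewrite tuple0.
  by exists [tuple].
have [g G] := IHn (FEx f); exists g => i e; rewrite -G; split.
  move=> [x]; case/tupleP: x => a x H; exists x; exists a; exact: H.
by move=> [x [a H]]; exists [tuple of a :: x].
Qed.

Lemma fo_pred_all (R : forall i, L i -> (nat -> L i) -> Prop) :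
  fo_pred (fun i e => R i (e 0%N) (env_drop 1 e)) -> fo_pred (fun i e => forall x,
    R i x e).
Proof.
move=> fR; apply: fo_pred_ext (fo_pred_not (fo_pred_ex (R := fun i x e =>
  ~ R i x e) (fo_pred_not fR))).
move=> i e; split=> [H x|H [x]]; last by apply.
by apply: contrapT => nR; apply: H; exists x.
Qed.

Lemma fo_pred_all_tuple n (R : forall i, n.-tuple (L i) -> (nat -> L i) -> Prop) :
  fo_pred (fun i e => R i (env_take n e) (env_drop n e)) -> fo_pred (fun i e =>
    forall x, R i x e).
Proof.
move=> fR; apply: fo_pred_ext
  (fo_pred_not (fo_pred_ex_tuple (R := fun i x e => ~ R i x e) (fo_pred_not fR))).
move=> i e; split=> [H x|H [x]]; last by apply.
by apply: contrapT => nR; apply: H; exists x.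
Qed.

Lemma fo_pred_ex_in (I : Type) (s : seq I) (P : I -> pred_family) :
  (forall k, fo_pred (P k)) -> fo_pred (fun i e => exists2 k, List.In k s & P k i e).
Proof.
move=> fP; elim: s => [|a s IHs].
  by apply: fo_pred_ext fo_pred_false => i e; split=> // -[].
apply: fo_pred_ext (fo_pred_or (fP a) IHs) => i e; split.
  by case=> [Pa|[k ks Pk]]; [exists a; first left|exists k; first right].
by case=> k [<-|ks] Pk; [left|right; exists k].
Qed.

Lemma fo_pred_ex_ord n (P : 'I_n -> pred_family) :
  (forall k, fo_pred (P k)) -> fo_pred (fun i e => exists k, P k i e).
Proof.
move=> fP; apply: fo_pred_ext (fo_pred_ex_in (enum 'I_n) fP) => i e; split.
  by case=> k _ Pk; exists k.
by case=> k Pk; exists k => //; apply/List_InP; rewrite mem_enum.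
Qed.

Lemma fo_pred_all_ord n (P : 'I_n -> pred_family) :
  (forall k, fo_pred (P k)) -> fo_pred (fun i e => forall k, P k i e).
Proof.
move=> fP; apply: fo_pred_ext (fo_pred_not (fo_pred_ex_ord (fun k =>
  fo_pred_not (fP k)))).
move=> i e; split=> [H k|H [k]]; last by apply.
by apply: contrapT => nP; apply: H; exists k.
Qed.

End UniformDefinability.

Lemma fo_pred_sqrt_ring (T : Type) (L : T -> fieldType) (A : Type)
    (kappa : forall i, A -> L i) (t v : forall i, (nat -> L i) -> L i) :
  fo_term kappa (fun i e => t i (env_drop 1 e)) -> fo_term kappa (fun i e =>
    v i (env_drop 1 e)) ->
  fo_pred kappa (fun i e => sqrt_ring (t i e) (v i e)).
Proof.
move=> ht hv; apply: (fo_pred_ex (R := fun i y e =>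
  y * y = 1 + t i e * (v i e * v i e))).
have y0 := fo_term_env kappa 0.
exact: fo_pred_eq (fo_termM y0 y0) (fo_termD (fo_term1 kappa) (fo_termM ht
  (fo_termM hv hv))).
Qed.

(** One step of a proof that a predicate is first-order, directed by its head
    symbol. *)
Ltac definability := lazymatch goal with
  | |- fo_env (fun i e => e) => exact: fo_env_id
  | |- fo_env (fun i e => env_drop _ _) => refine (fo_env_drop _ _)
  | |- fo_env (fun i e => env_cat _ _) => refine (fo_env_cat _ _)
  | |- fo_tuple (fun i e => env_take _ _) => refine (fo_tuple_take _ _)
  | |- fo_term _ (fun i e => tnth _ _) => refine (fo_term_tnth _ _ _)
  | |- fo_term _ (fun i e => @?a i e - @?b i e) => refine (fo_termB _ _)
  | |- fo_term _ (fun i e => @?a i e + @?b i e) => refine (fo_termD _ _)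
  | |- fo_term _ (fun i e => @?a i e * @?b i e) => refine (fo_termM _ _)
  | |- fo_term _ (fun i e => 1) => refine (fo_term1 _)
  | |- fo_term _ (fun i e => 0) => refine (fo_term0 _)
  | |- fo_term _ (fun i e => env_drop _ _ _) => refine (fo_term_drop _ _ _ _)
  | |- fo_term _ (fun i e => e _) => exact: fo_term_env
  | |- fo_term _ _ => exact: fo_term_const
  | |- fo_pred _ (fun i e => @?P i e /\ @?Q i e) => refine (fo_pred_and _ _)
  | |- fo_pred _ (fun i e => @?P i e \/ @?Q i e) => refine (fo_pred_or _ _)
  | |- fo_pred _ (fun i e => ~ @?P i e) => refine (fo_pred_not _)
  | |- fo_pred _ (fun i e => sqrt_ring _ _) => refine (fo_pred_sqrt_ring _ _)
  | |- fo_pred _ (fun i e => sat _ _ _) => refine (fo_pred_sat _ _ _)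
  | |- fo_pred _ (fun i e => _ = _) => refine (fo_pred_eq _ _)
  | |- fo_pred _ (fun i e => exists x : 'I__, _) => refine (fo_pred_ex_ord _) => ?
  | |- fo_pred _ (fun i e => exists x : _.-tuple _, _) => refine (fo_pred_ex_tuple _)
  | |- fo_pred _ (fun i e => exists x, _) => refine (fo_pred_ex _)
  | |- fo_pred _ (fun i e => @?P i e -> @?Q i e) => refine (fo_pred_imp _ _)
  | |- fo_pred _ (fun i e => forall x : 'I__, _) => refine (fo_pred_all_ord _) => ?
  | |- fo_pred _ (fun i e => forall x : _.-tuple _, _) => refine (fo_pred_all_tuple _)
  | |- fo_pred _ (fun i e => forall x, _) => refine (fo_pred_all _)
  end; lazy beta.

(** * Translations between formulas *)

Section ToFormula.
Variables (A : Type) (L : fieldType) (kappa : A -> L).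

Definition lookup (e : seq L) (v : L + nat) : L :=
  match v with inl c => c | inr j => e`_j end.

Fixpoint gterm (r : nat -> L + nat) (u : dbterm A) : GRing.term L :=
  match u with
  | TVar i => match r i with inl c => GRing.Const c | inr j => GRing.Var L j end
  | TConst a => GRing.Const (kappa a)
  | TOne => GRing.NatConst L 1
  | TSub u1 u2 => GRing.Add (gterm r u1) (GRing.Opp (gterm r u2))
  | TMul u1 u2 => GRing.Mul (gterm r u1) (gterm r u2)
  end.

(** De Bruijn indices become levels: the innermost quantifier binds the
    variable of index k, and r interprets the free indices by constants or by
    variables of index less than k. *)
Fixpoint gformula k (r : nat -> L + nat) (f : dbformula A) : GRing.formula L :=
  match f with
  | FEq u1 u2 => GRing.Equal (gterm r u1) (gterm r u2)
  | FAnd f1 f2 => GRing.And (gformula k r f1) (gformula k r f2)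
  | FNot f1 => GRing.Not (gformula k r f1)
  | FEx f1 => GRing.Exists k (gformula k.+1 (env_cons (inr k) r) f1)
  end.

Lemma gterm_rterm r u : GRing.rterm (gterm r u).
Proof. by elim: u => //= [i|u1 -> u2 ->|u1 -> u2 ->] //; case: (r i). Qed.

Lemma gformula_rformula f k r : GRing.rformula (gformula k r f).
Proof.
elim: f k r => [u1 u2|f1 IH1 f2 IH2|f1 IH1|f1 IH1] k r //=.
- by rewrite !gterm_rterm.
- by rewrite IH1 IH2.
Qed.

Lemma eval_gterm r e u : GRing.eval e (gterm r u) = dbeval kappa (lookup e \o r) u.
Proof.
elim: u => //= [i|u1 -> u2 ->|u1 -> u2 ->] //.
by case: (r i).
Qed.

Lemma holds_gformula f k r e : (forall i j, r i = inr j -> (j < k)%N) ->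
  GRing.holds e (gformula k r f) <-> sat kappa (lookup e \o r) f.
Proof.
elim: f k r e => [u1 u2|f1 IH1 f2 IH2|f1 IH1|f1 IH1] k r e rk /=.
- by rewrite !eval_gterm.
- by have := IH1 k r e rk; have := IH2 k r e rk; tauto.
- by have := IH1 k r e rk; tauto.
- have rk' i j : env_cons (inr k) r i = inr j -> (j < k.+1)%N.
    by case: i => [[<-]|i /rk /ltnW] //=.
  have E x : lookup (set_nth 0 e k x) \o env_cons (inr k) r = env_cons x (lookup e
    \o r).
    apply/funext => -[|i] /=; first by rewrite nth_set_nth /= eqxx.
    case ri : (r i) => [c|j] //=; rewrite nth_set_nth /=.
    by case: eqP => // jk; have := rk _ _ ri; rewrite jk ltnn.
  by split=> -[x H]; exists x; move: H; rewrite IH1 // E.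
Qed.

End ToFormula.

Lemma map_gformula (A : Type) (K M : fieldType) (kappa : A -> K) (iota : K -> M)
   (f : dbformula A) k (r : nat -> K + nat) :
  map_formula iota (gformula kappa k r f) =
  gformula (iota \o kappa) k (fun i => match r i with inl c => inl (iota c) |
    inr j => inr j end) f.
Proof.
have tE u r' : map_term iota (gterm kappa r' u) = gterm (iota \o kappa)
   (fun i => match r' i with inl c => inl (iota c) | inr j => inr j end) u.
  by elim: u => //= [i|u1 -> u2 ->|u1 -> u2 ->] //; case: (r' i).
elim: f k r => [u1 u2|f1 IH1 f2 IH2|f1 IH1|f1 IH1] k r /=.
- by rewrite !tE.
- by rewrite IH1 IH2.
- by rewrite IH1.
- rewrite IH1; congr (GRing.Exists _ (gformula _ _ _ _)).
  by apply/funext; case.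
Qed.

Lemma formula_over_setT (K : unitRingType) (phi : GRing.formula K) :
  formula_over setT phi.
Proof.
have H (u : GRing.term K) : term_over setT u by elim: u => //=.
by elim: phi => //=.
Qed.

Section OfFormula.
Variable M : fieldType.

(** Inverses do not occur in formulas of the language of rings; they are sent
    to an arbitrary term. *)
Fixpoint unterm (r : nat -> nat) (u : GRing.term M) : dbterm M :=
  match u with
  | GRing.Var i => TVar (r i)
  | GRing.Const c => TConst c
  | GRing.NatConst n => TConst n%:R
  | GRing.Add u1 u2 => TSub (unterm r u1) (TSub (TConst 0) (unterm r u2))
  | GRing.Opp u1 => TSub (TConst 0) (unterm r u1)
  | GRing.NatMul u1 n => TMul (unterm r u1) (TConst n%:R)
  | GRing.Mul u1 u2 => TMul (unterm r u1) (unterm r u2)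
  | GRing.Inv u1 => TOne
  | GRing.Exp u1 n => iter n (TMul (unterm r u1)) TOne
  end.

Definition FOr A (f g : dbformula A) := FNot (FAnd (FNot f) (FNot g)).

Fixpoint unformula (r : nat -> nat) (phi : GRing.formula M) : dbformula M :=
  match phi with
  | GRing.Bool b => FEq (TConst (b%:R : M)) TOne
  | GRing.Equal u1 u2 => FEq (unterm r u1) (unterm r u2)
  | GRing.Unit u => FEq TOne TOne
  | GRing.And p q => FAnd (unformula r p) (unformula r q)
  | GRing.Or p q => FOr (unformula r p) (unformula r q)
  | GRing.Implies p q => FOr (FNot (unformula r p)) (unformula r q)
  | GRing.Not p => FNot (unformula r p)
  | GRing.Exists i p => FEx (unformula (fun j => if j == i then 0%N else (r j).+1) p)
  | GRing.Forall i p =>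
      FNot (FEx (FNot (unformula (fun j => if j == i then 0%N else (r j).+1) p)))
  end.

Lemma unterm_eval r (e : seq M) e' u : (forall i, e`_i = e' (r i)) -> GRing.rterm u ->
  dbeval id e' (unterm r u) = GRing.eval e u.
Proof.
move=> ee'; elim: u => //=.
- by move=> u1 IH1 u2 IH2 /andP[/IH1 -> /IH2 ->]; rewrite sub0r opprK.
- by move=> u1 IH1 /IH1 ->; rewrite sub0r.
- by move=> u1 IH1 n /IH1 ->; rewrite mulr_natr.
- by move=> u1 IH1 u2 IH2 /andP[/IH1 -> /IH2 ->].
- move=> u1 IH1 n /IH1 E; elim: n => [|n IHn] //=; by rewrite E IHn exprS.
Qed.

Lemma sat_unformula phi r (e : seq M) e' : (forall i, e`_i = e' (r i)) ->
  GRing.rformula phi -> sat id e' (unformula r phi) <-> GRing.holds e phi.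
Proof.
elim: phi r e e' => /=.
- move=> b r e e' _ _; case: b => /=; first by split.
  by split=> // /eqP; rewrite eq_sym oner_eq0.
- by move=> u1 u2 r e e' ee' /andP[r1 r2]; rewrite !(unterm_eval ee').
- by [].
- by move=> p IHp q IHq r e e' ee' /andP[rp rq];
  rewrite (IHp _ _ _ ee' rp) (IHq _ _ _ ee' rq).
- move=> p IHp q IHq r e e' ee' /andP[rp rq].
  have := IHp _ _ _ ee' rp; have := IHq _ _ _ ee' rq.
  by case: (pselect (GRing.holds e p)); case: (pselect (GRing.holds e q)); tauto.
- move=> p IHp q IHq r e e' ee' /andP[rp rq].
  have := IHp _ _ _ ee' rp; have := IHq _ _ _ ee' rq.
  by case: (pselect (GRing.holds e p)); case: (pselect (GRing.holds e q)); tauto.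
- by move=> p IHp r e e' ee' rp; rewrite (IHp _ _ _ ee' rp).
- move=> i p IHp r e e' ee' rp; split=> -[x H]; exists x; move: H.
    apply: (IHp _ _ _ _ rp).1 => j; rewrite nth_set_nth /=.
    by case: eqP => //= _; exact: ee'.
  apply: (IHp _ _ _ _ rp).2 => j; rewrite nth_set_nth /=.
  by case: eqP => //= _; exact: ee'.
- move=> i p IHp r e e' ee' rp.
  have E x : sat id (env_cons x e') (unformula (fun j =>
    if j == i then 0%N else (r j).+1) p)
      <-> GRing.holds (set_nth 0 e i x) p.
    apply: IHp => // j; rewrite nth_set_nth /=.
    by case: eqP => //= _; exact: ee'.
  split=> [H x|H [x]]; last by rewrite E; apply; exact: H.
  by rewrite -E; apply: contrapT => nH; apply: H; exists x.
Qed.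

End OfFormula.

(** Constants are traded for variables placed after the k variables in use, in
    order that a formula with parameters can be transferred. *)
Section AbstractConstants.
Variables (M : fieldType) (cs : seq M).

Definition shift_tail k i := if (i < k)%N then i else (i + size cs)%N.

Fixpoint abstract_term k (u : dbterm M) : dbterm unit :=
  match u with
  | TVar i => TVar (shift_tail k i)
  | TConst c => TVar (k + index c cs)
  | TOne => TOne
  | TSub u1 u2 => TSub (abstract_term k u1) (abstract_term k u2)
  | TMul u1 u2 => TMul (abstract_term k u1) (abstract_term k u2)
  end.

Fixpoint abstract_formula k (f : dbformula M) : dbformula unit :=
  match f with
  | FEq u1 u2 => FEq (abstract_term k u1) (abstract_term k u2)
  | FAnd f1 f2 => FAnd (abstract_formula k f1) (abstract_formula k f2)
  | FNot f1 => FNot (abstract_formula k f1)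
  | FEx f1 => FEx (abstract_formula k.+1 f1)
  end.

Fixpoint term_consts (u : dbterm M) : seq M :=
  match u with
  | TConst c => [:: c]
  | TSub u1 u2 | TMul u1 u2 => term_consts u1 ++ term_consts u2
  | _ => [::]
  end.

Fixpoint formula_consts (f : dbformula M) : seq M :=
  match f with
  | FEq u1 u2 => term_consts u1 ++ term_consts u2
  | FAnd f1 f2 => formula_consts f1 ++ formula_consts f2
  | FNot f1 | FEx f1 => formula_consts f1
  end.

Variable kappa : unit -> M.

Lemma sat_abstract_formula f s e : {subset formula_consts f <= cs} ->
  sat kappa (env_cat s (env_cat cs e)) (abstract_formula (size s) f) <-> sat id
    (env_cat s e) f.
Proof.
have tE u : {subset term_consts u <= cs} -> forall s,
    dbeval kappa (env_cat s (env_cat cs e)) (abstract_term (size s) u) = dbeval id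
      (env_cat s e) u.
  move=> + {}s; elim: u => //= [i _|c ccs|u1 IH1 u2 IH2 sub|u1 IH1 u2 IH2 sub].
  - rewrite /shift_tail; case: ltnP => si; first by rewrite !(env_cat_lt _ 0).
    by rewrite -{1}(subnKC si) -addnA !env_cat_ge addnC env_cat_ge -{2}(subnKC si)
      env_cat_ge.
  - have cc : c \in cs by apply: ccs; rewrite inE.
    by rewrite env_cat_ge (env_cat_lt _ 0) ?index_mem // nth_index.
  - by rewrite IH1 ?IH2 // => c cu; apply: sub; rewrite mem_cat cu ?orbT.
  - by rewrite IH1 ?IH2 // => c cu; apply: sub; rewrite mem_cat cu ?orbT.
elim: f s => [u1 u2|f1 IH1 f2 IH2|f1 IH1|f1 IH1] s sub /=.
- by rewrite !tE // => c cu; apply: sub; rewrite mem_cat cu ?orbT.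
- rewrite IH1 ?IH2 // => c cu; apply: sub; by rewrite mem_cat cu ?orbT.
- by rewrite IH1.
- by split=> -[x H]; exists x; move: H; rewrite -(IH1 (x :: s)).
Qed.

End AbstractConstants.

(** * Compactness over a complete henselian field *)

(** Definable compactness of bounded closed sets, as a property of a pair of
    formulas B and D that define the family of the D b for b in B: in the
    order of the hypotheses, the family is non-empty, has non-empty members,
    is directed, has closed members, and is bounded. Neighbourhoods are
    polydiscs with radii the entries of s. *)
Definition definably_compact_in (L : fieldType) (O : L -> Prop) m d
    (B : m.-tuple L -> Prop) (D : m.-tuple L -> d.-tuple L -> Prop) : Prop :=
  (exists b, B b) ->
  (forall b, B b -> exists x, D b x) ->
  (forall b b', B b -> B b' -> exists b'',
     B b'' /\ forall x, D b'' x -> D b x /\ D b' x) ->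
  (forall b x, B b ->
    (forall s : d.-tuple L, (forall k, tnth s k <> 0) -> exists x', D b x' /\
       forall k, exists o, O o /\ tnth x' k - tnth x k = tnth s k * o) -> D b x) ->
  (exists s, s <> 0 /\ forall b x, B b -> D b x -> forall k, O (s * tnth x k)) ->
  exists x, forall b, B b -> D b x.

Section Compactness.
Variables (C : closedFieldType) (K : fieldType) (V : henselian_field C K).
Hypothesis C_char0 : [pchar C] =i pred0.
Local Notation t := (unif V).
Local Notation O := (intg V).

Lemma vord_dominant x y i j : vord V x = Some i -> vge V j y -> i < j ->
  vord V (x + y) = Some i.
Proof.
move=> /vordP[gx rx] gy ij; apply/vordP; split.
  by apply: vgeD => //; apply: vge_le gy; exact: ltW.
rewrite /res_at mulrDl resD //; last exact: vge_le (ltW ij) gy.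
by rewrite -/(res_at V i x) -/(res_at V i y) (res_at_gt ij gy) addr0.
Qed.

(** For x integral, 1 + t x^2 reduces to 1 and has a square root by Hensel's
    lemma. Otherwise its value is 1 + 2 v(x), which is odd. *)
Lemma sqrt_ringP x : sqrt_ring t x <-> O x.
Proof.
split=> [[y yE]|Ox].
  rewrite -vge_intg; apply/vgeP; case vx : (vord V x) => [i|//].
  rewrite leNgt; apply/negP => i0.
  have vt : vord V t = Some 1.
    apply/vordP; rewrite /has_vord /vge /res_at unifzN expr1z divff ?unif_neq0 //.
    by rewrite res1 oner_eq0; split=> //; exact: intg1.
  have vtx := vordM vt (vordM vx vx).
  have y0 : y != 0.
    apply/eqP => y0; have : vord V (1 + t * (x * x)) = Some (1 + (i + i)).
      rewrite addrC; apply: (vord_dominant vtx (j := 0)); last by lia.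
      by rewrite vge_intg; exact: intg1.
    by rewrite -yE y0 mul0r vord0.
  have [j vy] := vord_ex V y0; have vyy := vordM vy vy.
  have : vord V (1 + t * (x * x)) = Some (1 + (i + i)).
    rewrite addrC; apply: (vord_dominant vtx (j := 0)); last by lia.
    by rewrite vge_intg; exact: intg1.
  by rewrite -yE vyy => -[]; lia.
pose c := 1 + t * (x * x).
have Ot := intg_unif V.
have Oxx : O (x * x) by exact: intgM.
have Otx : O (t * (x * x)) by exact: intgM.
have Oc : O c by apply: intgD => //; exact: intg1.
have rc : res V c = 1.
  by rewrite resD ?res1 ?resM ?res_unif ?mul0r ?addr0 //; exact: intg1.
(* Hensel's lemma at the zero 1 of X^2 - 1, simple as 2 != 0. *)
pose p : {poly K} := 'X^2 - c%:P.
have redE : reduction V p = 'X^2 - 1%:P.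
  apply/polyP => k; rewrite coef_reduction !coefB !coefXn !coefC.
  have O01 (b : bool) : O b%:R by case: b; [exact: intg1|exact: intg0].
  have r01 (b : bool) : res V b%:R = b%:R by case: b; rewrite ?res1 ?res0.
  rewrite resB // ?r01; last by case: ifP => // _; exact: intg0.
  by congr (_ - _); case: ifP => // _; rewrite res0.
have [k|||y [_ _ /eqP ry]] := @hensel _ _ V p 1.
- rewrite coefB coefXn coefC; apply: intgB; first by case: (k == 2)%N;
  [exact: intg1|exact: intg0].
  by case: ifP => // _; exact: intg0.
- by rewrite -[X in X.[_]]/(reduction V p) redE !hornerE expr1n subrr.
- rewrite -[X in X^`()]/(reduction V p) redE derivB derivC derivXn !hornerE subr0
  -mulr2n.
  by rewrite ((pcharf0P _).1 C_char0).
exists y; move: ry; rewrite /p hornerD hornerN hornerXn hornerC expr2 => /eqP.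
by rewrite subr_eq0 => /eqP ->.
Qed.

(** Either some member is finite, and a member contained in a finite set of
    least size lies in all the others; or all members are cofinite, and a
    member missing as many points as possible does. *)
Lemma directed_common (I : Type) (B : I -> Prop) (E : I -> C -> Prop) :
  almost_decided E -> (exists b, B b) -> (forall b, B b -> exists xi, E b xi) ->
  (forall b b', B b -> B b' -> exists b'', B b'' /\ forall xi, E b'' xi ->
    E b xi /\ E b' xi) ->
  exists xi, forall b, B b -> E b xi.
Proof.
move=> [N EN] [b0 Bb0] E_ne E_dir.
have [fin|nofin] := pselect (exists n, `[< exists b (s : seq C),
    [/\ B b, size s = n & forall xi, E b xi -> xi \in s] >]).
  case: (ex_minnP fin) => n /asboolP[b [s [Bb sn Es]]] n_min.
  (* A residue of E b outside E b' can be removed from the finite set. *)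
  have [xi Exi] := E_ne _ Bb; exists xi => b' Bb'; apply: contrapT => nE.
  have [b'' [Bb'' b''P]] := E_dir _ _ Bb Bb'.
  have : (n <= size (rem xi s))%N.
    apply: n_min; apply/asboolP; exists b'', (rem xi s); split=> // z Ez.
    have [Ebz Eb'z] := b''P _ Ez.
    have zxi : z != xi by apply/eqP => zxi; apply: nE; rewrite -zxi.
    have := Es _ Ebz; rewrite (perm_mem (perm_to_rem (Es _ Exi))) inE.
    by rewrite (negPf zxi).
  rewrite size_rem ?Es // sn.
  have : (0 < size s)%N by case: s Es {sn n_min} => // /(_ _ Exi).
  by rewrite sn; lia.
(* The numbers of points that a member can miss; they are bounded by N. *)
pose coex n := `[< exists b (s : seq C),
   [/\ B b, uniq s, size s = n & forall xi, xi \in s -> ~ E b xi] >].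
have ex0 : exists n, coex n by exists 0%N; apply/asboolP; exists b0, [::].
have coexN n : coex n -> (n <= N)%N.
  move=> /asboolP[b [s [Bb us <- sE]]]; have [r rN [rE|rE]] := EN b; last first.
    exfalso; apply: nofin; exists (size r); apply/asboolP; exists b, r; split=> // xi.
    by move=> Exi; apply: contraT => /rE.
  apply: leq_trans rN; apply: uniq_leq_size => // xi /sE nE.
  by apply: contraT => /rE.
case: (ex_maxnP ex0 coexN) => n /asboolP[b [s [Bb us sn sE]]] n_max.
have [xi Exi] := E_ne _ Bb; exists xi => b' Bb'; apply: contrapT => nE.
have [b'' [Bb'' b''P]] := E_dir _ _ Bb Bb'.
have : (n.+1 <= n)%N; last by rewrite ltnn.
apply: n_max; apply/asboolP; exists b'', (xi :: s); split=> //=.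
- by rewrite us andbT; apply/negP => /sE.
- by rewrite sn.
- by move=> z; rewrite inE => /orP[/eqP ->|/sE nEz] /b''P[].
Qed.

Let kappa := fun _ : unit => t.
Local Notation full Y := (fun _ : Y -> K => True).

Lemma subring_full Y : subring (full Y). Proof. by []. Qed.

Lemma env_cat_class (Z : Type) (AA : (Z -> K) -> Prop) n (x : Z -> n.-tuple K) g :
  (forall k, AA (fun z => tnth (x z) k)) -> (forall j, AA (fun z => g z j)) ->
  forall j, AA (fun z => env_cat (x z) (g z) j).
Proof.
move=> Ax Ag j; have [jn|nj] := ltnP j n.
  have -> : (fun z => env_cat (x z) (g z) j) = fun z => tnth (x z) (Ordinal jn).
    by apply/funext => z; rewrite (env_cat_lt _ 0) ?size_tuple // (tnth_nth 0).
  exact: Ax.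
have -> : (fun z => env_cat (x z) (g z) j) = fun z => g z (j - n)%N.
  apply/funext => z; have := env_cat_ge (x z) (g z) (j - n).
  by rewrite size_tuple subnKC.
exact: Ag.
Qed.

Section Digits.
Variables (m d : nat) (f : dbformula unit) (e0 : nat -> K) (B : m.-tuple K -> Prop).

Definition fiber (b : m.-tuple K) (x : d.-tuple K) :=
  sat kappa (env_cat x (env_cat b e0)) f.

Definition meets_box b (a : 'I_d -> K) (r : 'I_d -> int) :=
  exists x, fiber b x /\ forall k, vge V (r k) (tnth x k - a k).

Definition add_digit (a : 'I_d -> K) (r : 'I_d -> int) (i : 'I_d) (xi : C) k :=
  a k + (if k == i then t ^ r k * lift_res V xi else 0).
Definition raise (r : 'I_d -> int) (i : 'I_d) k := if k == i then r k + 1 else r k.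

(** The meeting of the fiber with a box is a first-order condition on the
    center of the box, so quantifier elimination applies to the digit that is
    added. *)
Lemma digit_decided a r i :
  almost_decided (fun b xi => meets_box b (add_digit a r i xi) (raise r i)).
Proof.
pose L := fun _ : unit => K; pose kap := fun _ : unit => kappa.
pose P : pred_family L := fun _ e => exists x : d.-tuple K,
  sat kappa (env_cat x (env_drop d (env_drop d e))) f /\
  forall k, exists o, sqrt_ring t o /\
    tnth x k - tnth (env_take d e) k = tnth (env_take d (env_drop d e)) k * o.
have [h hP] : fo_pred kap P.
  rewrite /P; repeat definability.
pose Y := m.-tuple K; pose AX := evals (polyfam (full Y)).
have AXr : subring AX by apply: subring_evals; exact: subring_full.
pose c (u : K) := [tuple a k + (if k == i then t ^ r k * u else 0) | k < d].
pose s := [tuple t ^ raise r i k | k < d].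
pose env (z : Y * K) := env_cat (c z.2) (env_cat s (env_cat z.1 e0)).
have cstAX x : AX (fun=> x) by apply: (evals_fst (subring_full Y) (f := fun=> x)).
have H : separatedK V AX (fun z => sat kappa (env z) h).
  apply: sat_separated => // j.
  apply: env_cat_class => [k|{}j].
    have -> : (fun z : Y * K => tnth (c z.2) k) =
      fun z => a k + (if k == i then t ^ r k else 0) * z.2.
      by apply/funext => z; rewrite tnth_mktuple; case: eqP => // _; rewrite mul0r.
    apply: (subringD AXr) => //; apply: subringM => //.
    exact: (evals_snd (subring_full Y)).
  apply: env_cat_class => // {}j.
  apply: env_cat_class => // k.
  exact: (evals_fst (subring_full Y) (f := fun y => tnth y k)).
have [N HN] := separated_almost H; exists N => b; have [l lN lP] := HN b;
  exists l => //.
have E xi : sat kappa (env (b, lift_res V xi)) h <->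
    meets_box b (add_digit a r i xi) (raise r i).
  rewrite -(hP tt) /P /env !(env_drop_cat, env_take_cat).
  split=> -[x [fx xP]]; exists x; split=> // k.
    apply/vge_factor; have [o [/sqrt_ringP Oo oE]] := xP k; exists o; split=> //.
    by move: oE; rewrite !tnth_mktuple.
  have /vge_factor[o [Oo oE]] := xP k; exists o; split; first exact/sqrt_ringP.
  by rewrite !tnth_mktuple.
by case: lP => lP; [left|right] => xi /lP; rewrite E.
Qed.

Hypotheses (B_ne : exists b, B b)
  (B_dir : forall b b', B b -> B b' -> exists b'',
     B b'' /\ forall x, fiber b'' x -> fiber b x /\ fiber b' x).

Definition all_meet a r := forall b, B b -> meets_box b a r.

(** The possible digits form a directed family, because the digits
    allowed by a member are allowed by every member that contains it. *)
Lemma next_digit a r i : all_meet a r ->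
  exists xi, all_meet (add_digit a r i xi) (raise r i).
Proof.
move=> am; apply: (directed_common (digit_decided a r i)) => // [b Bb|b b' Bb Bb'].
  have [x [fx xP]] := am b Bb; exists (res_at V (r i) (tnth x i - a i)), x; split=>
    // k.
  rewrite /add_digit /raise; case: eqP => [->|_]; last by rewrite addr0.
  rewrite opprD addrA -/(monom V _ _).
  have gm := vge_monom V (r i) (res_at V (r i) (tnth x i - a i)).
  apply: res_at_eq0; first by apply: vgeB => //; exact: xP.
  by rewrite (res_atB (xP i) gm) res_at_monom subrr.
have [b'' [Bb'' b''P]] := B_dir Bb Bb'; exists b''; split=> // xi [x [fx xP]].
by have [? ?] := b''P _ fx; split; exists x.
Qed.

Lemma next_round a (j : int) : all_meet a (fun=> j) ->
  exists a', all_meet a' (fun=> j + 1) /\ forall k, vge V j (a' k - a k).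
Proof.
move=> am.
have H n : (n <= d)%N -> exists a', all_meet a' (fun k =>
  if (k < n)%N then j + 1 else j) /\
    forall k, vge V j (a' k - a k).
  elim: n => [|n IHn] nd.
    by exists a; split=> // k; rewrite subrr; exact: vge0.
  have [a' [am' ga']] := IHn (ltnW nd); pose i := Ordinal nd.
  have [xi amx] := next_digit i am'; exists (add_digit a' (fun k : 'I_d =>
    if (k < n)%N then j + 1 else j) i xi).
  split=> [b Bb|k].
    have [x [fx xP]] := amx b Bb; exists x; split=> // k.
    have := xP k; rewrite /raise -val_eqE /=; case: (ltngtP k n) => kn.
    - by rewrite ltnS ltnW.
    - by rewrite ltnS leqNgt kn.
    - by rewrite kn ltnSn.
  rewrite /add_digit addrAC; apply: vgeD => //.
  case: eqP => [->|_]; last exact: vge0.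
  by rewrite /= ltnn; exact: vge_monom.
have [a' [am' ga']] := H d (leqnn d); exists a'; split=> // b Bb.
have [x [fx xP]] := am' b Bb; exists x; split=> // k.
by have := xP k; rewrite ltn_ord.
Qed.

End Digits.

Hypothesis K_complete : forall (j : int) (a : nat -> K),
  (forall l : nat, vge V (j + l%:Z) (a l.+1 - a l)) ->
  exists x, forall l : nat, vge V (j + l%:Z) (x - a l).

Lemma vge_div i s x : vord V s = Some i -> vge V i x -> O (x / s).
Proof.
move=> vs gx; have s0 : s != 0 by apply/eqP => s0; rewrite s0 vord0 in vs.
rewrite -vge_intg; apply/vgeP; case vq : (vord V (x / s)) => [j|//].
have := vordM vq vs; rewrite divfK // => vx; move/vgeP: gx; rewrite vx; lia.
Qed.

(** The successive boxes meet all members of the family, and by completeness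
    they shrink to a point; the members being closed, the point belongs to
    them. *)
Theorem compact_henselian m d (f : dbformula unit) (e0 : nat ->
  K) (B : m.-tuple K -> Prop) :
  definably_compact_in (sqrt_ring t) B
    (fun b (x : d.-tuple K) => sat kappa (env_cat x (env_cat b e0)) f).
Proof.
have -> : sqrt_ring t = O by apply/funext => x; apply/propext; exact: sqrt_ringP.
rewrite -/(fiber f e0) => B_ne D_ne B_dir D_cl [s [/eqP s0 sP]].
have [j vs] := vord_ex V s0.
have am0 : all_meet (d := d) f e0 B (fun=> 0) (fun=> - j).
  move=> b Bb; have [x fx] := D_ne b Bb; exists x; split=> // k.
  rewrite subr0; have := sP b x Bb fx k; rewrite -vge_intg => g.
  apply/vgeP; case vx : (vord V (tnth x k)) => [i|//].
  by move/vgeP: g; rewrite (vordM vs vx); lia.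
have [step stepP] : exists step : int -> ('I_d -> K) -> 'I_d -> K, forall j a,
    all_meet f e0 B a (fun=> j) ->
    all_meet f e0 B (step j a) (fun=> j + 1) /\ forall k, vge V j (step j a k - a k).
  have H (ja : int * ('I_d -> K)) : exists a', all_meet f e0 B ja.2 (fun=> ja.1) ->
      all_meet f e0 B a' (fun=> ja.1 + 1) /\ forall k, vge V ja.1 (a' k - ja.2 k).
    have [am|nam] := pselect (all_meet f e0 B ja.2 (fun=> ja.1)); last by exists ja.2.
    by have [a' ?] := next_round B_ne B_dir am; exists a'.
  have [F FP] := choice H; exists (fun j a => F (j, a)) => j' a'; exact: (FP (j', a')).
pose a := fix a l := if l is n.+1 then step (- j + n%:Z) (a n) else fun=> 0.
have aP l : all_meet f e0 B (a l) (fun=> - j + l%:Z).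
  elim: l => [|l IHl]; first by rewrite addr0.
  have [+ _] := stepP _ _ IHl.
  by have -> : - j + l%:Z + 1 = - j + l.+1%:Z by lia.
have /choice[x xP] : forall k, exists xk, forall l : nat,
  vge V (- j + l%:Z) (xk - a l k).
  move=> k; apply: (K_complete (a := fun l => a l k)) => l.
  exact: (stepP _ _ (aP l)).2.
exists [tuple x k | k < d] => b Bb; apply: D_cl => // r r0.
have [l lP] : exists l : nat, forall k, exists2 i, vord V (tnth r k) = Some i &
  i <= - j + l%:Z.
  have /choice[v vP] : forall k, exists i, vord V (tnth r k) = Some i.
    by move=> k; apply: vord_ex; exact/eqP.
  (* A sum in place of a maximum of the indices required by the radii. *)
  exists (\sum_k absz (v k + j)%R)%N => k; exists (v k); first exact: vP.
  have : (absz (v k + j)%R <= \sum_k absz (v k + j)%R)%N by rewrite (bigD1 k) //=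
    leq_addr.
  by lia.
have [x' [fx' x'P]] := aP l b Bb; exists x'; split=> // k.
have [i vi il] := lP k.
have gx : vge V i (tnth x' k - x k).
  apply: (vge_le il); have := vgeB (x'P k) (xP k l).
  by rewrite opprB addrA subrK.
exists ((tnth x' k - x k) / tnth r k); split; first exact: vge_div gx.
by rewrite tnth_mktuple mulrC divfK //; exact/eqP.
Qed.

End Compactness.

Section Completeness.
Variables (C K : fieldType) (V : henselian_field C K).
Local Notation t := (unif V).

(** Translation and scaling bring the sequence into the valuation ring. *)
Lemma complete_of_integral :
  (forall y : nat -> K, (forall l, intg V (y l)) ->
    (forall l : nat, vge V l%:Z (y l.+1 - y l)) ->
    exists x, forall l : nat, vge V l%:Z (x - y l)) ->
  forall (j : int) (a : nat -> K), (forall l : nat, vge V (j + l%:Z) (a l.+1 - a l)) ->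
  exists x, forall l : nat, vge V (j + l%:Z) (x - a l).
Proof.
move=> Oc j a aP; pose y l := (a l - a 0%N) * t ^ (- j).
have tj x : x * t ^ (- j) * t ^ j = x by rewrite -mulrA -unifzD addNr expr0z mulr1.
have yP (l : nat) : vge V l%:Z (y l.+1 - y l).
  rewrite /y -mulrBl opprB addrA subrK -(vge_shift _ j) tj; exact: aP.
have yO l : intg V (y l).
  rewrite -vge_intg; elim: l => [|l IHl]; first by rewrite /y subrr mul0r; exact: vge0.
  by rewrite -(subrK (y l) (y l.+1)); apply: vgeD => //; apply: vge_le (yP l).
have [x xP] := Oc y yO yP; exists (a 0%N + x * t ^ j) => l.
have -> : a 0%N + x * t ^ j - a l = (x - y l) * t ^ j.
  by rewrite /y mulrBl tj opprB addrCA addrA.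
by rewrite vge_shift.
Qed.

End Completeness.

Lemma laurent_complete (C : fieldType) (j : int) (a : nat -> laurent C) :
  (forall l : nat, vge (laurent_henselian C) (j + l%:Z) (a l.+1 - a l)) ->
  exists x, forall l : nat, vge (laurent_henselian C) (j + l%:Z) (x - a l).
Proof.
apply: complete_of_integral => y yO yP.
have /choice[f fE] : forall l, exists f, @FracField.tofrac (powerSeries C) f = y l.
  by move=> l; apply/integral_seriesP; exact: yO.
have gE g (l : nat) : vge (laurent_henselian C) l%:Z (@FracField.tofrac
  (powerSeries C) g) <->
    Xdvd l g.
  rewrite (vge_factor (laurent_henselian C)); split=>
    [[_ [/integral_seriesP[h <-]]]|[h ->]].
    rewrite -exprnP -tofracXn -tofracM => /tofrac_inj ->; by exists h.
  exists (@FracField.tofrac (powerSeries C) h); split; first exact: integral_tofrac.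
  by rewrite -exprnP tofracM tofracXn.
have fP l : Xdvd l (f l.+1 - f l) by apply/gE; rewrite tofracB !fE; exact: yP.
have fle k l : (k <= l)%N -> Xdvd k (f l - f k).
  elim: l => [|l IHl].
    by rewrite leqn0 => /eqP ->; rewrite subrr; exists 0; rewrite mulr0.
  rewrite leq_eqVlt => /orP[/eqP ->|].
    by rewrite subrr; exists 0; rewrite mulr0.
  rewrite ltnS => kl; rewrite -(subrKA (f l)); apply: XdvdD; last exact: IHl.
  exact: Xdvd_le (fP l).
pose g := PowerSeries (fun k => coefps (f k.+1) k).
exists (@FracField.tofrac (powerSeries C) g) => l; rewrite -fE -tofracB; apply/gE.
apply/XdvdP => k kl; have /XdvdP/(_ k (ltnSn k)) := fle _ _ kl.
rewrite -[coefps (f l - _) k]/(coefps (f l) k - coefps (f k.+1) k).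
rewrite -[coefps (g - _) k]/(coefps (f k.+1) k - coefps (f l) k).
by move=> /eqP; rewrite subr_eq0 => /eqP ->; rewrite subrr.
Qed.

(** * Transfer along an elementary map *)

(** The structures of the transfer: fields with a distinguished element, which
    is the interpretation of the only constant. *)
Definition pointed_field := {L : fieldType & L}.
Definition carrier (i : pointed_field) : fieldType := projT1 i.
Definition base_point (i : pointed_field) (_ : unit) : carrier i := projT2 i.

Section Transfer.
Variables (C : closedFieldType) (M : fieldType) (iota : laurent C -> M).
Hypothesis C_char0 : [pchar C] =i pred0.
Hypothesis iota_elem : elementary_on [set: laurent C]%classic iota.
Local Notation K := (laurent C).
Local Notation tK := (laurent_t C).
Local Notation tM := (iota tK).
Local Notation pK := (existT (fun L : fieldType => L : Type) K tK : pointed_field).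
Local Notation pM := (existT (fun L : fieldType => L : Type) M tM : pointed_field).

Lemma iota_formula (phi : GRing.formula K) : GRing.rformula phi ->
  GRing.holds [::] phi <-> GRing.holds [::] (map_formula iota phi).
Proof. by move=> rphi; apply: iota_elem => //; exact: formula_over_setT. Qed.

Lemma iota0 : iota 0 = 0.
Proof. by have [/(_ erefl)] := @iota_formula (GRing.Equal (GRing.Const 0)
  (GRing.NatConst K 0)) isT. Qed.

Lemma elementary_transfer (P : pred_family carrier) : fo_pred base_point P ->
  P pK (fun=> 0) -> P pM (fun=> 0).
Proof.
move=> [f fP]; rewrite !fP => Kf.
have := iota_formula (gformula_rformula (base_point pK) f 0 (fun=> inl 0)).
rewrite map_gformula !holds_gformula //.
by rewrite /comp /= iota0 => -[+ _]; apply.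
Qed.

Lemma sqrt_ring_formula : exists f : dbformula unit, forall i (e : nat -> carrier i),
  sqrt_ring (base_point i tt) (e 0%N) <-> sat (base_point i) e f.
Proof.
have [f fP] : fo_pred base_point (fun i e => sqrt_ring (base_point i tt) (e 0%N)).
  by repeat definability.
by exists f.
Qed.

(** All formulas that define the power series in C((t)) are equivalent there,
    hence equivalent to the one of [sqrt_ring] after transfer. *)
Lemma valuation_ringE : valuation_ring iota = sqrt_ring tM.
Proof.
have [f fP] := sqrt_ring_formula.
pose phi0 := gformula (base_point pK) 1 (fun=> inr 0%N) f.
have phi0K (y : K) : GRing.holds [:: y] phi0 <-> integral_series y.
  rewrite holds_gformula; last by move=> _ j [<-].
  apply: iff_trans (iff_sym (fP pK (lookup [:: y] \o (fun=> inr 0%N)))) _.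
  exact: (sqrt_ringP (laurent_henselian C) C_char0 y).
have phi0M (y : M) : GRing.holds [:: y] (map_formula iota phi0) <-> sqrt_ring tM y.
  rewrite map_gformula holds_gformula; last by move=> _ j [<-].
  exact: iff_sym (fP pM (lookup [:: y] \o (fun=> inr 0%N))).
have rphi0 : GRing.rformula phi0 by exact: gformula_rformula.
apply/funext => x; apply/propext; split.
  move=> [phi [rphi phiE phix]]; apply/phi0M.
  have [+ _] := @iota_formula (GRing.Forall 0 (GRing.Implies phi phi0)) (introT
    andP (conj rphi rphi0)).
  move=> /=; apply=> // y phiy; apply/phi0K.
  by rewrite -phiE.
move=> xO; exists phi0; split=> //; last exact/phi0M.
by apply/seteqP; split=> y /phi0K.
Qed.

Lemma sqrt_ring_valuation :
  [/\ sqrt_ring tM 1,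
      forall x y, sqrt_ring tM x -> sqrt_ring tM y -> sqrt_ring tM (x - y),
      forall x y, sqrt_ring tM x -> sqrt_ring tM y -> sqrt_ring tM (x * y) &
      forall x, sqrt_ring tM x \/ exists y, x * y = 1 /\ sqrt_ring tM y].
Proof.
pose V := laurent_henselian C; have OK := sqrt_ringP V C_char0.
split.
- apply: (@elementary_transfer (fun i _ => sqrt_ring (base_point i tt) 1)).
    by repeat definability.
  by apply/OK; exact: intg1.
- apply: (@elementary_transfer (fun i _ => forall x y : carrier i,
     sqrt_ring (base_point i tt) x -> sqrt_ring (base_point i tt) y ->
     sqrt_ring (base_point i tt) (x - y))).
    by repeat definability.
  by move=> x y /OK Ox /OK Oy; apply/OK; exact: intgB.
- apply: (@elementary_transfer (fun i _ => forall x y : carrier i,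
     sqrt_ring (base_point i tt) x -> sqrt_ring (base_point i tt) y ->
     sqrt_ring (base_point i tt) (x * y))).
    by repeat definability.
  by move=> x y /OK Ox /OK Oy; apply/OK; exact: intgM.
- apply: (@elementary_transfer (fun i _ => forall x : carrier i,
     sqrt_ring (base_point i tt) x \/
     exists y, x * y = 1 /\ sqrt_ring (base_point i tt) y)).
    by repeat definability.
  move=> x; case vx : (vord V x) => [i|]; last first.
    by left; apply/OK; rewrite ((vord_None _ _).1 vx); exact: intg0.
  have x0 : x != 0 by apply/eqP => x0; rewrite x0 vord0 in vx.
  have [i0|i0] := leP 0 i.
    by left; apply/OK; rewrite -vge_intg; apply/vgeP; rewrite vx.
  right; exists x^-1; split; first exact: divff.
  apply/OK; rewrite -[x^-1]mul1r; apply: (vge_div vx).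
  by apply: (@vge_le _ _ V _ 0); [exact: ltW|rewrite vge_intg; exact: intg1].
Qed.

(** The parameters of the two formulas are universally quantified in the
    sentence that is transferred. *)
Lemma definably_compact_in_elementary m d (fB fD : dbformula M) :
  definably_compact_in (sqrt_ring tM)
    (fun b : m.-tuple M => sat id (env_cat b (fun=> 0)) fB)
    (fun b (x : d.-tuple M) => sat id (env_cat x (env_cat b (fun=> 0))) fD).
Proof.
pose cs := formula_consts fB ++ formula_consts fD.
pose gB := abstract_formula cs m fB; pose gD := abstract_formula cs (d + m) fD.
pose P : pred_family carrier := fun i e => forall q : (size cs).-tuple (carrier i),
  definably_compact_in (sqrt_ring (base_point i tt))
    (fun b : m.-tuple (carrier i) => sat (base_point i) (env_cat b (env_cat q e)) gB)
    (fun b (x : d.-tuple (carrier i)) =>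
      sat (base_point i) (env_cat x (env_cat b (env_cat q e))) gD).
have fP : fo_pred base_point P.
  by rewrite /P /definably_compact_in; lazy beta; repeat definability.
have PK : P pK (fun=> 0).
  move=> q.
  exact: (compact_henselian (V := laurent_henselian C) C_char0 (@laurent_complete C)).
have PM := elementary_transfer fP PK (in_tuple cs).
have EB (b : m.-tuple M) : sat (base_point pM) (env_cat b (env_cat cs (fun=> 0))) gB =
    sat id (env_cat b (fun=> 0)) fB.
  apply/propext; rewrite -(sat_abstract_formula (cs :=
    cs) (base_point pM)) ?size_tuple //.
  by move=> c cf; rewrite mem_cat cf.
have ED (b : m.-tuple M) (x : d.-tuple M) :
    sat (base_point pM) (env_cat x (env_cat b (env_cat cs (fun=> 0)))) gD =
    sat id (env_cat x (env_cat b (fun=> 0))) fD.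
  have scat2 (e : nat -> M) : env_cat x (env_cat b e) = env_cat (x ++ b) e by
    rewrite /env_cat foldr_cat.
  apply/propext; rewrite !scat2 -(sat_abstract_formula (cs := cs) (base_point pM)).
    by rewrite size_cat !size_tuple.
  by move=> c cf; rewrite mem_cat cf orbT.
move: PM; congr (definably_compact_in _ _ _); first exact/funext.
by apply/funext => b; apply/funext => x; exact: ED.
Qed.

End Transfer.

Local Open Scope classical_set_scope.

(** * Definable sets of tuples *)

Section DefinableSets.
Variable M : fieldType.
Let LM := fun _ : unit => M.
Let idM := fun _ : unit => @id M.

Lemma definable_formula n (X : set (n.-tuple M)) : definable X ->
  exists f : dbformula M, forall x : n.-tuple M, X x <-> sat id (env_cat x (fun=> 0)) f.
Proof.
move=> [phi rphi ->]; exists (unformula id phi) => x /=.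
rewrite (sat_unformula (e := x)) // => i /=.
have [xi|xi] := ltnP i (size x); first by rewrite (env_cat_lt _ 0).
by rewrite nth_default // -(subnKC xi) env_cat_ge.
Qed.

Lemma fo_pred_definable n (P : (nat -> M) -> Prop) :
  fo_pred (L := LM) idM (fun _ => P) ->
  definable [set x : n.-tuple M | P (env_cat x (fun=> 0))].
Proof.
move=> [f fP].
exists (gformula id n (fun i => if (i < n)%N then inr i else inl 0) f).
  exact: gformula_rformula.
apply/funext => x; apply/propext; rewrite /= (fP tt) holds_gformula => [|i j].
  suff -> : env_cat x (fun=> 0 : M) =
    lookup x \o (fun i => if (i < n)%N then inr i else inl 0) by [].
  apply/funext => i /=; case: ltnP => ni /=.
    by rewrite (env_cat_lt _ 0) ?size_tuple.
  by have := env_cat_ge x (fun=> 0 : M) (i - n); rewrite size_tuple subnKC.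
by case: ifP => // ni [<-].
Qed.

(** The formula of X interprets indices beyond n by 0, which is provided by an
    auxiliary quantified variable. *)
Lemma fo_pred_mem n (X : set (n.-tuple M)) (v : forall i : unit, (nat -> M) ->
  n.-tuple M) :
  definable X -> fo_tuple (L := LM) (fun i e => v i (env_drop 1 e)) ->
  fo_pred (L := LM) idM (fun i e => X (v i e)).
Proof.
move=> /definable_formula[f fP] vr.
have H : fo_pred (L := LM) idM (fun i e => exists z, z = 0 /\
    sat id (env_cat (v i e) (fun=> z)) f).
  apply: (fo_pred_ex (R := fun i z e => z = 0 /\ sat id (env_cat (v i e) (fun=> z)) f)).
  apply: fo_pred_and.
    by apply: fo_pred_eq; [exact: fo_term_env|exact: fo_term0].
  apply: (fo_pred_sat idM f (g := fun i e => env_cat (v i (env_drop 1 e)) (fun=>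
    e 0%N))).
  by apply: (fo_env_cat vr); exists (fun=> 0%N).
apply: fo_pred_ext H => i e; rewrite fP.
by split=> [[z [-> //]]|H]; exists 0.
Qed.

Lemma fo_tuple_cat n m (x : forall i : unit, (nat -> M) -> n.-tuple M)
    (y : forall i : unit, (nat -> M) -> m.-tuple M) :
  fo_tuple (L := LM) x -> fo_tuple (L := LM) y ->
  fo_tuple (L := LM) (fun i e => cat_tuple (x i e) (y i e)).
Proof.
move=> [r rE] [s sE]; exists (fun k => if (k < n)%N then r k else s (k - n)%N) => i e k.
rewrite (tnth_nth (e 0%N)) /= nth_cat size_tuple; case: ltnP => kn.
  by rewrite -(rE i e (Ordinal kn)) (tnth_nth (e 0%N)).
have kn' : (k - n < m)%N by rewrite ltn_subLR.
by rewrite -(sE i e (Ordinal kn')) (tnth_nth (e 0%N)).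
Qed.

Lemma fo_tuple_behead n (x : forall i : unit, (nat -> M) -> n.+1.-tuple M) :
  fo_tuple (L := LM) x -> fo_tuple (L := LM) (fun i e =>
    behead_tuple (x i e) : n.-tuple M).
Proof.
move=> [r rE]; exists (fun k => r k.+1) => i e k.
rewrite (tnth_nth (e 0%N)) /= nth_behead.
have kn : (k.+1 < n.+1)%N by rewrite ltnS.
by rewrite -(rE i e (Ordinal kn)) (tnth_nth (e 0%N)).
Qed.

End DefinableSets.

(** * Directed families and polydiscs *)

Section DirectedFamilies.
Variables (T : Type) (F : set (set T)).
Hypotheses (F_ne : F !=set0)
  (F_dir : forall A B, F A -> F B -> exists2 D, F D & D `<=` A `&` B).

(** Finitely many conditions that pass to subsets and hold of some member hold
    simultaneously of a common lower bound. *)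
Lemma directed_avoid (I : eqType) (s : seq I) (Q : I -> set T -> Prop) :
  (forall i A B, A `<=` B -> Q i B -> Q i A) ->
  (forall i, i \in s -> exists2 A, F A & Q i A) ->
  exists2 A, F A & forall i, i \in s -> Q i A.
Proof.
move=> Qmono; elim: s => [|i s IHs] Qs; first by have [A FA] := F_ne; exists A.
have [|A FA As] := IHs; first by move=> j js; apply: Qs; rewrite inE js orbT.
have [B FB Bi] := Qs i (mem_head i s).
have [D FD DAB] := F_dir FA FB; exists D => // j.
rewrite inE => /orP[/eqP ->|/As].
  by apply: Qmono Bi => x /DAB[].
by apply: Qmono => x /DAB[].
Qed.

Lemma directed_meets (I : eqType) (s : seq I) (P : I -> set T) :
  (forall A x, F A -> A x -> exists2 i, i \in s & P i x) ->
  (forall A, F A -> A !=set0) ->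
  exists2 i, i \in s & forall A, F A -> A `&` P i !=set0.
Proof.
move=> cover ne; apply: contrapT => nex.
have [|i si|A FA As] := @directed_avoid I s (fun i A => A `&` P i = set0).
- move=> i A B AB BP; apply/seteqP; split=> // x [/AB Bx Px].
  by rewrite -BP.
- apply: contrapT => nA; apply: nex; exists i => // A FA.
  by apply/set0P/negP => /eqP AP; apply: nA; exists A.
have [x Ax] := ne A FA; have [i si Px] := cover A x FA Ax.
by have : (A `&` P i) x by []; rewrite As.
Qed.

End DirectedFamilies.

Section ValuationGeometry.
Variables (M : fieldType) (O : set M).
Hypotheses (O1 : O 1) (OB : forall x y, O x -> O y -> O (x - y))
  (OM : forall x y, O x -> O y -> O (x * y))
  (O_total : forall x, O x \/ exists y, x * y = 1 /\ O y).

Lemma valring0 : O 0. Proof. by rewrite -(subrr 1); exact: OB. Qed.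
Lemma valringD x y : O x -> O y -> O (x + y).
Proof. by move=> Ox Oy; rewrite -(opprK y) -(sub0r y); apply/OB/OB/Oy/valring0. Qed.

(** Used to meet finitely many conditions on the size of a polyradius at once. *)
Lemma clear_denominators (s : seq M) : exists a, [/\ a != 0, O a & forall g,
  g \in s -> O (a * g)].
Proof.
elim: s => [|g s [a [a0 Oa aP]]]; first by exists 1; split=> //; exact: oner_neq0.
have [b [b0 Ob Obg]] : exists b, [/\ b != 0, O b & O (b * g)].
  have [Og|[y [gy Oy]]] := O_total g.
    by exists 1; split; rewrite ?oner_neq0 ?mul1r.
  exists y; split=> //; last by rewrite mulrC gy.
  by apply: contra_eq_neq gy => ->; rewrite mulr0 eq_sym oner_neq0.
exists (a * b); split; [exact: mulf_neq0|exact: OM|move=> h].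
rewrite inE => /orP[/eqP ->|/aP Oh]; first by rewrite -mulrA; exact: OM.
by rewrite mulrAC; exact: OM.
Qed.

Section Polydiscs.
Variable d : nat.
Implicit Types (U V : set (d.-tuple M)) (u y : d.-tuple M) (a b s : M).

Definition near_pt s u y := forall i, O ((tnth y i - tnth u i) / s).

Lemma near_pt_refl s u : near_pt s u u.
Proof. by move=> i; rewrite subrr mul0r; exact: valring0. Qed.
Lemma near_pt_sym s u y : near_pt s u y -> near_pt s y u.
Proof.
by move=> uy i; rewrite -opprB mulNr -[- _]sub0r; apply: OB;
  [exact: valring0|exact: uy].
Qed.
Lemma near_pt_trans s u y z : near_pt s u y -> near_pt s y z -> near_pt s u z.
Proof.
by move=> uy yz i; rewrite -(subrKA (tnth y i)) mulrDl; apply: valringD;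
  [exact: yz|exact: uy].
Qed.
Lemma near_pt_le a b u y : a != 0 -> O (a / b) -> near_pt a u y -> near_pt b u y.
Proof.
move=> a0 ab uy i; have := OM (uy i) ab.
by rewrite mulrA divfK.
Qed.

Lemma openP U : valuation_topology O U <->
  forall u, U u -> exists2 a, a != 0 & forall y, near_pt a u y -> U y.
Proof.
split=> Uo u /Uo.
  move=> [c [c0 cP]]; have [a [a0 _ aP]] := clear_denominators [seq (c i)^-1 |
    i <- enum 'I_d].
  exists a => // y uy; apply: cP => i; have := OM (uy i) (aP (c i)^-1 _).
  rewrite mulrA divfK //; apply.
  by apply/mapP; exists i; rewrite ?mem_enum.
by move=> [a a0 aP]; exists (fun=> a).
Qed.

Lemma open_bigcap (I : finType) (V : I -> set (d.-tuple M)) u :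
  (forall i, valuation_topology O (V i)) -> (forall i, V i u) ->
  exists2 a, a != 0 & forall i y, near_pt a u y -> V i y.
Proof.
move=> Vo Vu.
have /choice[c cP] : forall i, exists a, a != 0 /\ forall y, near_pt a u y -> V i y.
  by move=> i; have [a a0 aP] := (openP (V i)).1 (Vo i) u (Vu i); exists a.
have [a [a0 _ aP]] := clear_denominators [seq (c i)^-1 | i <- enum I].
exists a => // i y uy; apply: (cP i).2; apply: near_pt_le uy => //.
by apply: aP; apply/mapP; exists i; rewrite ?mem_enum.
Qed.

(** Bounded by the inverse of a, and at distance at least the size of a from
    the complement of U. *)
Definition inner U a : set (d.-tuple M) :=
  [set u | (forall i, O (a * tnth u i)) /\ forall y, near_pt a u y -> U y].

Lemma inner_sub U a : inner U a `<=` U.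
Proof. by move=> u [_]; apply; exact: near_pt_refl. Qed.

Lemma inner_mono U a b : a != 0 -> b != 0 -> O (b / a) -> inner U a `<=` inner U b.
Proof.
move=> a0 b0 ba u [au uP]; split=> [i|y uy]; last first.
  by apply: uP; apply: near_pt_le uy.
have := OM ba (au i); by rewrite mulrA divfK.
Qed.

(** Both conditions are invariant under translation by s O^d when s and s / a
    and s a are small enough; this makes the set clopen. *)
Lemma inner_near U a : a != 0 -> exists2 s, s != 0 &
  forall u y, near_pt s u y -> inner U a u -> inner U a y.
Proof.
(* Smallness of s a keeps the bound, smallness of s / a keeps the polydisc. *)
move=> a0; have [s [s0 _ sP]] := clear_denominators [:: a; a^-1].
have sa : O (s * a) by apply: sP; rewrite !inE eqxx.
have sa' : O (s / a) by apply: sP; rewrite !inE eqxx orbT.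
exists s => // u y uy [au uP]; split=> [i|z yz].
  have := valringD (au i) (OM (uy i) sa); rewrite mulrA divfK // [_ * a]mulrC -mulrDr.
  by rewrite addrC subrK.
apply: uP; apply: near_pt_trans yz; exact: near_pt_le uy.
Qed.

Lemma inner_open U a : a != 0 -> valuation_topology O (inner U a).
Proof.
move=> a0; apply/openP => u uin; have [s s0 sP] := inner_near U a0.
by exists s => // y uy; exact: sP uin.
Qed.

Lemma inner_cover U u : valuation_topology O U -> U u ->
  exists2 a, a != 0 & inner U a u.
Proof.
move=> /openP Uo Uu; have [c c0 cP] := Uo u Uu.
have [a [a0 _ aP]] := clear_denominators (c^-1 :: [seq tnth u i | i <- enum 'I_d]).
exists a => //; split=> [i|y uy].
  by apply: aP; rewrite inE; apply/orP; right; apply/mapP; exists i; rewrite ?mem_enum.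
by apply: cP; apply: near_pt_le uy => //; apply: aP; rewrite inE eqxx.
Qed.

End Polydiscs.

Lemma value_group_neq0 (gamma : value_group O) a : sval gamma a -> a != 0.
Proof.
case: gamma => G [b b0 GE] /=; rewrite GE => -[u [u0 _ _] <-]; exact: mulf_neq0.
Qed.

Lemma value_group_ratio (gamma : value_group O) a b :
  sval gamma a -> sval gamma b -> O (b / a).
Proof.
case: gamma => G [c c0 GE] /=; rewrite GE => -[u [u0 Ou Ou'] <-] [v [v0 Ov _] <-].
rewrite invfM mulrACA divff // mul1r; exact: OM.
Qed.

Lemma value_group_ex (gamma : value_group O) : exists a, sval gamma a.
Proof.
case: gamma => G [c c0 GE] /=; rewrite GE; exists c, 1; rewrite ?mulr1 //.
by split; rewrite ?oner_neq0 ?invr1.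
Qed.

Lemma value_group_of a : a != 0 -> exists gamma : value_group O, sval gamma a.
Proof.
move=> a0; exists (exist _ [set a * u | u in valuation_unit O]
  (ex_intro2 _ _ a a0 erefl)).
exists 1; rewrite ?mulr1 //.
by split; rewrite ?oner_neq0 ?invr1.
Qed.

End ValuationGeometry.

(** * The exhaustion of a weak manifold *)

Section Manifold.
Variables (M : fieldType) (tM : M).
Local Notation O := (sqrt_ring tM : set M).
Hypotheses (O1 : O 1) (OB : forall x y, O x -> O y -> O (x - y))
  (OM : forall x y, O x -> O y -> O (x * y))
  (O_total : forall x, O x \/ exists y, x * y = 1 /\ O y).
Hypothesis O_compact : forall m d (fB fD : dbformula M),
  definably_compact_in O
    (fun b : m.-tuple M => sat id (env_cat b (fun=> 0)) fB)
    (fun b (x : d.-tuple M) => sat id (env_cat x (env_cat b (fun=> 0))) fD).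

Variables (n : nat) (X : set (n.-tuple M)) (tau : set (set (n.-tuple M))).
Hypothesis tau_top : is_topology X tau.

Section Chart.
Variables (d e : nat) (P : set (n.-tuple M)) (pi : n.-tuple M -> d.-tuple M)
  (U : set (d.-tuple M)).
Hypotheses (P_open : tau P) (chart : weak_chart O P (subspace_topology tau P) e pi U).

Let tauI : forall A B, tau A -> tau B -> tau (A `&` B) := let: And4 _ _ H _ :=
  tau_top in H.

Lemma chart_preimage_open V : valuation_topology O V -> V `<=` U ->
  tau (P `&` pi @^-1` V).
Proof.
case: chart => _ [_ [_ pi_cont _] _ _] Vo VU.
have [|T Ttau TE] := pi_cont V; last by rewrite -TE; exact: tauI.
by exists V => //; apply/seteqP; split=> x; [case|split=> //; exact: VU].
Qed.

Variables (a : M) (W A : set (n.-tuple M)).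
Hypotheses (a0 : a != 0) (W_open : tau W)
  (W_chart : forall x, P x -> W x <-> inner O U a (pi x))
  (A_closed : closed_in W (subspace_topology tau W) A).

(** Suppose that u, a limit of images of points of A in P, has no preimage in
    A. Over a neighbourhood of u the domain P splits into sheets S j, and each
    sheet contains a point above u and a neighbourhood of it that avoids A.
    Images of these neighbourhoods are open; near u, injectivity on the sheets
    excludes points of A above them. *)
Lemma chart_image_closed (u : d.-tuple M) :
  (forall s, s != 0 -> exists2 y, (pi @` (A `&` P)) y & near_pt O s u y) ->
  (pi @` (A `&` P)) u.
Proof.
case: chart => _ [[_ Uo piU] [_ _ pi_open] _ splits] u_lim; apply: contrapT => nu.
have [AW [T Ttau TE]] := A_closed.
have u_in : inner O U a u.
  have [s s0 sP] := inner_near O1 OB OM O_total U a0.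
  have [_ [x [Ax Px] <-] ux] := u_lim s s0.
  apply: sP (near_pt_sym O1 OB ux) _; apply/(W_chart Px); exact: AW.
have Uu : U u := inner_sub O1 OB u_in.
have [V [_ Vo Vu VU [S [Scover Sdisj SP]]]] := splits u Uu.
(* A neighbourhood N j of u above which the sheet S j has no point of A. *)
have /choice[N NP] : forall j : 'I_e, exists N, [/\ valuation_topology O N, N u &
    forall x, A x -> S j x -> ~ N (pi x)].
  move=> j; have [_ [T1 T1tau T1E] [[Sfun Sinj Ssurj] _ _]] := SP j.
  have [x Sx pix] := Ssurj u Vu.
  have SPi y : S j y -> P y by rewrite -T1E => -[].
  have Wx : W x by apply/(W_chart (SPi _ Sx)); rewrite pix.
  have nAx : ~ A x by move=> Ax; apply: nu; exists x => //; split=> //; exact: SPi.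
  have Tx : T x by have : (W `\` A) x by []; rewrite -TE => -[].
  pose N := S j `&` (W `&` T).
  have [|G Go GE] := pi_open N.
    exists (T1 `&` (W `&` T)); first by apply: tauI => //; exact: tauI.
    by rewrite /N -T1E setIA.
  exists G; split=> //.
    have : (pi @` N) u by exists x => //; split.
    by rewrite -GE => -[].
  move=> y Ay Sy Gy.
  have : (U `&` G) (pi y) by split=> //; apply: VU; exact: Sfun.
  rewrite GE => -[z [Sz [Wz Tz]] zy].
  have zE : z = y by apply: Sinj => //; exact: mem_set.
  by have : (W `&` T) z by []; rewrite TE zE => -[].
have [s1 s10 s1P] := (openP O1 OM O_total V).1 Vo u Vu.
have [s2 s20 s2P] := open_bigcap O1 OM O_total (fun j => let: And3 H _ _ := NP j in H)
  (fun j => let: And3 _ H _ := NP j in H).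
have [s [s0 _ sP]] := clear_denominators O1 OM O_total [:: s1^-1; s2^-1].
have [_ [x [Ax Px] <-] ux] := u_lim s s0.
have : (\bigcup_j S j) x.
  rewrite Scover; split=> //; apply: s1P; apply: near_pt_le ux => //.
  by apply: sP; rewrite inE eqxx.
case=> j _ Sx; have [_ _] := NP j; apply; [exact: Ax|exact: Sx|].
by apply: s2P; apply: near_pt_le ux => //; apply: sP; rewrite !inE eqxx orbT.
Qed.

End Chart.

Variables (d k : nat) (P : 'I_k -> set (n.-tuple M)) (e : 'I_k -> nat)
  (pi : 'I_k -> n.-tuple M -> d.-tuple M) (U : 'I_k -> set (d.-tuple M)).
Hypotheses (P_part : partition [set: 'I_k] P X)
  (P_def : forall i, definable (P i) /\ tau (P i))
  (P_chart : forall i, weak_chart O (P i) (subspace_topology tau (P i)) (e i) (pi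
    i) (U i)).

Let Uo i : valuation_topology O (U i) :=
  let: conj _ (And4 (And3 _ H _) _ _ _) := P_chart i in H.

Lemma chart_domains_disjoint i j x : P i x -> P j x -> i = j.
Proof.
by case: P_part => _ tP _ Pix Pjx; apply: tP => //; exists x.
Qed.

(** The representative a of gamma is quantified existentially; by
    [exhaustionP] all representatives define the same set. *)
Definition exhaustion (gamma : value_group O) : set (n.-tuple M) :=
  [set x | exists i a, [/\ P i x, sval gamma a & inner O (U i) a (pi i x)]].

Lemma exhaustionP (gamma : value_group O) a i x : sval gamma a -> P i x ->
  exhaustion gamma x <-> inner O (U i) a (pi i x).
Proof.
move=> ga Px; split=> [[j [b [Pjx gb]]]|ux]; last by exists i, a.
rewrite (chart_domains_disjoint Pjx Px); apply: inner_mono => //;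
  first exact: value_group_neq0 gb.
  exact: value_group_neq0 ga.
exact: (value_group_ratio OM) gb ga.
Qed.

Let tauU : forall F, F `<=` tau -> tau (\bigcup_(A in F) A) :=
  let: And4 _ _ _ H := tau_top in H.

Lemma exhaustion_open gamma : tau (exhaustion gamma).
Proof.
have [a ga] := value_group_ex O1 gamma.
have -> : exhaustion gamma = \bigcup_(A in [set P i `&` pi i @^-1` inner O (U i) a
  | i in [set: 'I_k]]) A.
  apply/seteqP; split=> x.
    move=> Wx; have [i [b [Px gb ux]]] := Wx.
    exists (P i `&` pi i @^-1` inner O (U i) a); first by exists i.
    by split=> //; apply/(exhaustionP ga Px).
  by move=> [_ [i _ <-] [Px ux]]; exists i, a.
apply: tauU => _ [i _ <-].
apply: (chart_preimage_open (P_def i).2 (P_chart i)); last exact: (inner_sub O1 OB).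
exact: (inner_open O1 OB OM O_total) (value_group_neq0 ga).
Qed.

Lemma exhaustion_cover : X = \bigcup_gamma exhaustion gamma.
Proof.
case: P_part => PX _ _; apply/seteqP; split=> x.
  rewrite -PX => -[i _ Px].
  have Ux : U i (pi i x).
    by case: (P_chart i) => _ [[_ _ <-] _ _ _]; exists x.
  have [a a0 ax] := inner_cover O1 OM O_total (@Uo i) Ux.
  by have [gamma ga] := value_group_of O1 a0; exists gamma => //; exists i, a.
move=> [gamma _ [i [a [Px _ _]]]]; rewrite -PX; by exists i.
Qed.

Lemma exhaustion_mono gamma gamma' : value_le gamma gamma' ->
  exhaustion gamma `<=` exhaustion gamma'.
Proof.
move=> [a [b [ga gb ba]]] x Wx; have [i [_ [Px _ _]]] := Wx.
apply/(exhaustionP gb Px); move: Wx => /(exhaustionP ga Px).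
exact: (inner_mono OM) (value_group_neq0 ga) (value_group_neq0 gb) ba _.
Qed.

Let graph i : definable [set cat_tuple x (pi i x) | x in P i] :=
  let: conj _ (And4 _ (And3 H _ _) _ _) := P_chart i in H.
Let U_def i : definable (U i) :=
  let: conj _ (And4 (And3 H _ _) _ _ _) := P_chart i in H.

Lemma graphP i (x : n.-tuple M) (u : d.-tuple M) :
  [set cat_tuple x (pi i x) | x in P i] (cat_tuple x u) <-> P i x /\ pi i x = u.
Proof.
split=> [[y Py /(congr1 val) /= /eqP]|[Px <-]]; last by exists x.
rewrite eqseq_cat ?size_tuple // => /andP[/eqP/val_inj xy /eqP/val_inj yu].
by rewrite -xy -yu.
Qed.

Lemma exhaustion_definable : uniformly_definable_value exhaustion.
Proof.
pose Q (z : n.+1.-tuple M) := thead z <> 0 /\ exists i : 'I_k, exists u : d.-tuple M,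
  [set cat_tuple x (pi i x) | x in P i] (cat_tuple (behead_tuple z : n.-tuple M) u) /\
  ((forall j, O (thead z * tnth u j)) /\ forall y : d.-tuple M,
   (forall j, exists o, O o /\ tnth y j - tnth u j = thead z * o) -> U i y).
pose LM := fun _ : unit => M; pose idM := fun _ : unit => @id M.
have QE : [set z | exists gamma, sval gamma (thead z) /\
  exhaustion gamma (behead_tuple z)] =
    [set z : n.+1.-tuple M | Q (env_take n.+1 (env_cat z (fun=> 0)))].
  apply/seteqP; split=> z /=; rewrite env_take_cat.
    move=> [gamma [gz Wz]]; have z0 := value_group_neq0 gz.
    split; first exact/eqP.
    have [i [_ [Pz _ _]]] := Wz.
    have [Oz Uz] := (exhaustionP gz Pz).1 Wz.
    exists i, (pi i (behead_tuple z)); split; first exact/graphP.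
    split=> // y yP; apply: Uz => j; have [o [Oo ->]] := yP j.
    by rewrite mulrC mulKf.
  move=> [/eqP z0 [i [u [/graphP[Pz piz] [Oz Uz]]]]].
  have [gamma gz] := value_group_of O1 z0; exists gamma; split=> //.
  exists i, (thead z); split=> //; rewrite piz; split=> // y yP; apply: Uz => j.
  exists ((tnth y j - tnth u j) / thead z); split; first exact: yP.
  by rewrite mulrC divfK.
rewrite /uniformly_definable_value QE; apply: (@fo_pred_definable M n.+1 (fun e =>
  Q (env_take n.+1 e))).
rewrite /Q /thead.
repeat definability; last first.
  by apply: fo_pred_mem => //; repeat definability.
apply: fo_pred_mem => //; apply: fo_tuple_cat; last by repeat definability.
by apply: fo_tuple_behead; repeat definability.
Qed.

(** The family meets a single chart domain throughout, its image under the
    chart is a family of closed bounded sets of M^d and has a common point u,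
    and the fibre of u is finite, so that one of its points lies in all
    members. *)
Lemma exhaustion_compact gamma :
  definably_compact (exhaustion gamma) (subspace_topology tau (exhaustion gamma)).
Proof.
set W := exhaustion gamma => F [m [B [D [B_def D_def FE]]]] F_ne F_closed F_dir.
have [a ga] := value_group_ex O1 gamma; have a0 := value_group_neq0 ga.
(* All members meet the domain of one chart. *)
have [i _ F_meets] : exists2 i, i \in enum 'I_k & forall A, F A -> A `&` P i !=set0.
  apply: (directed_meets F_ne F_dir) => [A x FA Ax|A /F_closed[]//].
  have [[AW _] _] := F_closed A FA; have [i [_ [Px _ _]]] := AW x Ax.
  by exists i; rewrite ?mem_enum.
pose LM := fun _ : unit => M; pose idM := fun _ : unit => @id M.
have [fB fBP] := definable_formula B_def.
have [fD fDP] : exists fD : dbformula M, forall (b : m.-tuple M) (u : d.-tuple M),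
    (exists x, D (cat_tuple b x) /\ (P i x /\ pi i x = u)) <->
    sat id (env_cat u (env_cat b (fun=> 0))) fD.
  have [f fP] : fo_pred (L := LM) idM (fun _ e => exists x : n.-tuple M,
      D (cat_tuple (env_take m (env_drop d e)) x) /\
      [set cat_tuple x (pi i x) | x in P i] (cat_tuple x (env_take d e))).
    by repeat definability; apply: fo_pred_mem => //; apply: fo_tuple_cat;
      repeat definability.
  exists f => b u; rewrite -(fP tt) env_drop_cat !env_take_cat.
  by split=> -[x [Dx gx]]; exists x; split=> //; apply/graphP.
have FB A : F A <-> exists b, B b /\ A = [set x | D (cat_tuple b x)].
  by rewrite FE; split=> [[b Bb <-]|[b [Bb ->]]]; exists b.
have [u uP] : exists u, forall b, B b ->
    exists x, D (cat_tuple b x) /\ (P i x /\ pi i x = u).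
  have [|||||u uP] := @O_compact m d fB fD.
  - have [A /FB[b [Bb _]]] := F_ne; exists b; exact/fBP.
  - move=> b /fBP Bb; have [|x [Dx Px]] := F_meets [set x | D (cat_tuple b x)].
      by apply/FB; exists b.
    by exists (pi i x); apply/fDP; exists x.
  - move=> b b' /fBP Bb /fBP Bb'.
    have [||_ /FB[b'' [Bb'' ->]] sub] := F_dir [set x | D (cat_tuple b x)] [set x |
      D (cat_tuple b' x)].
    + by apply/FB; exists b.
    + by apply/FB; exists b'.
    exists b''; split; first exact/fBP.
    by move=> u /fDP[x [Dx Pu]]; have [? ?] := sub x Dx; split; apply/fDP; exists x.
  - move=> b u /fBP Bb u_lim; apply/fDP.
    have FA : F [set x | D (cat_tuple b x)] by apply/FB; exists b.
    have [|x [Dx Px] <-] := chart_image_closed (P_chart i) a0 (exhaustion_open gamma)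
      (fun x Px => exhaustionP ga Px) (F_closed _ FA).1 (u := u); last by exists x.
    move=> s s0; have [|_ [/fDP[x [Dx [Px <-]]] xu]] := u_lim [tuple s | _ < d].
      by move=> j; rewrite tnth_mktuple; exact/eqP.
    exists (pi i x); first by exists x.
    by move=> j; have [o [Oo ->]] := xu j; rewrite tnth_mktuple mulrC mulKf.
  - exists a; split; first exact/eqP.
    move=> b u /fBP Bb /fDP[x [Dx [Px <-]]] j.
    have FA : F [set x | D (cat_tuple b x)] by apply/FB; exists b.
    have [[AW _] _] := F_closed _ FA.
    by have [H _] := (exhaustionP ga Px).1 (AW x Dx).
  - by exists u => b /fBP/uP/fDP.
have [s sE] : exists s : seq (n.-tuple M), P i `&` pi i @^-1` [set u] = [set` s].
  apply/finite_seqP; case: (P_chart i) => _ [[_ _ piU] _ fibers _].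
  have Uu : U i u.
    have [A /FB[b [Bb _]]] := F_ne; have [x [_ [Px <-]]] := uP b Bb.
    by rewrite -piU; exists x.
  by rewrite (eq_finite_set (fibers u Uu)).
(* Otherwise some member would avoid the whole fibre of u. *)
have [x xP] : exists x, forall A, F A -> A x.
  apply: contrapT => nx.
  have [|x _|A /FB[b [Bb AE]] As] := directed_avoid F_ne F_dir (s := s)
    (Q := fun x A => ~ A x).
  - by move=> x A A' AA' nA' /AA'.
  - by apply: contrapT => nA; apply: nx; exists x => A FA; apply: contrapT => nAx;
    apply: nA; exists A.
  have [x [Dx Pu]] := uP b Bb.
  have : (P i `&` pi i @^-1` [set u]) x by [].
  by rewrite sE /= => /As; apply; rewrite AE.
by exists x => A /xP.
Qed.

Lemma exhaustion_exhausts : value_exhaustion X tau exhaustion.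
Proof.
split; [exact: exhaustion_definable| |exact: exhaustion_mono|exact: exhaustion_cover].
by move=> gamma; split; [exact: exhaustion_open|exact: exhaustion_compact].
Qed.

End Manifold.

Theorem proposition3p5 (R : realType) (M : fieldType)
    (iota : laurent (complex R) -> M) (kappa : Type)
    (M_monster : monster iota kappa)
    (n : nat) (X : set (n.-tuple M)) (tau : set (set (n.-tuple M)))
    (X_manifold : weak_manifold (valuation_ring iota) X tau) :
  exists W : value_group (valuation_ring iota) -> set (n.-tuple M),
    value_exhaustion X tau W.
Proof.
have [iota_elem _ _ _] := M_monster.
have C_char0 : [pchar complex R] =i pred0 by exact: pchar_num.
move: X_manifold; rewrite (valuation_ringE C_char0 iota_elem).
have [O1 OB OM O_total] := sqrt_ring_valuation C_char0 iota_elem.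
have O_compact := definably_compact_in_elementary C_char0 iota_elem.
case=> _ [tau_top _] [d [k [P [P_part P_def]]]].
move=> /choice[e /choice[pi /choice[U P_chart]]].
exists (exhaustion P pi U).
exact: (exhaustion_exhausts O1 OB OM O_total O_compact tau_top P_part P_def P_chart).
Qed.
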